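(* Let $A$ and $B$ be countable (discrete) groups and let $A \stackrel{_2}{\ast} B$ be their second nilpotent product. Each of the following properties, if it holds for both $A$ and $B$, also holds for $A \stackrel{_2}{\ast} B$: (1) amenability; (2) the Haagerup approximation property; (3) Kazhdan's property (T); (4) exactness.
   Context: Commutators are $[a,b]=aba^{-1}b^{-1}$. For groups $A,B$ with free product $A\ast B$, let $[A,B]$ be the subgroup of $A\ast B$ generated by all $[a,b]$, $a\in A$, $b\in B$, and let $[A\ast B,[A,B]]$ be the subgroup generated by all $[p,q]$ with $p\in A\ast B$, $q\in[A,B]$ (it is normal in $A\ast B$). The second nilpotent product is $A \stackrel{_2}{\ast} B:=(A\ast B)/[A\ast B,[A,B]]$; that is, one makes all the commutators $[a,b]$ ($a\in A$, $b\in B$) central. Groups are discrete. *)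

(* Defs.v *)
From HB Require Import structures.
From mathcomp Require Import all_boot all_order all_algebra.
From mathcomp Require Import complex.
From mathcomp Require Import all_classical all_reals all_analysis.
From mathcomp Require Import ring lra.
Set Implicit Arguments.
Unset Strict Implicit.
Unset Printing Implicit Defensive.
Import numFieldNormedType.Exports.
Import Order.TTheory GRing.Theory Num.Theory.
Local Open Scope ring_scope.
Local Open Scope classical_set_scope.

Section Subgroups.
Variable G : groupType.
Local Open Scope group_scope.

Definition is_subgroup (K : set G) : Prop :=
  K 1 /\ (forall x y, K x -> K y -> K (x * y^-1)).

Definition generated (S : set G) : set G :=
  [set x | forall K, is_subgroup K -> S `<=` K -> K x].

(* [x, y] = x y x^-1 y^-1, whereas MathComp's [~ x, y] is x^-1 y^-1 x y. *)
Definition comm (x y : G) : G := x * y * x^-1 * y^-1.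

Lemma generated_subgroup (S : set G) : is_subgroup (generated S).
Proof.
split=> [K [K1 _] _ //|x y Sx Sy K sK SK].
by case: (sK) => _; apply; [exact: Sx|exact: Sy].
Qed.

Lemma subset_generated (S : set G) : S `<=` generated S.
Proof. by move=> x Sx K _; apply. Qed.

Lemma subgroup1 (K : set G) : is_subgroup K -> K 1.
Proof. by case. Qed.

Lemma subgroupV (K : set G) x : is_subgroup K -> K x -> K x^-1.
Proof. by move=> [K1 KM] Kx; rewrite -[_^-1]mul1g; apply: KM. Qed.

Lemma subgroupM (K : set G) x y : is_subgroup K -> K x -> K y -> K (x * y).
Proof.
by move=> sK Kx Ky; rewrite -[y]invgK; apply: sK.2 => //; exact: subgroupV.
Qed.

(* Follows from x [p, q] x^-1 = [x p, q] [x, q]^-1. *)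
Lemma comm_generated_normal (K : set G) (x y : G) :
  let N := generated [set z | exists p q, K q /\ z = comm p q] in
  N y -> N (x * y * x^-1).
Proof.
set S := [set z | _] => N Ny.
have sN : is_subgroup N by exact: generated_subgroup.
pose L := [set z | forall u, N (u * z * u^-1)].
suff : L y by apply.
apply: Ny.
  split=> [u|z t Lz Lt u]; first by rewrite mulg1 mulgV; exact: subgroup1.
  have -> : u * (z * t^-1) * u^-1 = (u * z * u^-1) * (u * t * u^-1)^-1.
    by rewrite !invgM invgK !mulgA mulgVK.
  by apply: sN.2.
move=> _ [p [q [Kq ->]]] u.
have -> : u * comm p q * u^-1 = comm (u * p) q * (comm u q)^-1.
  by rewrite /comm !invgM !invgK !mulgA !mulgVK.
by apply: sN.2; apply: subset_generated; [exists (u * p), q|exists u, q].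
Qed.

End Subgroups.

Record normalSubgroup (G : groupType) := NormalSubgroup {
  nsub_set :> G -> Prop;
  nsub_subgroup : is_subgroup nsub_set;
  nsub_normal : forall x y : G, nsub_set y -> nsub_set (x * y * x^-1)%g }.

Section QuotientGroup.
Variables (G : groupType) (N : normalSubgroup G).
Local Open Scope group_scope.
Local Open Scope quotient_scope.

Definition coset_rel (x y : G) : bool := `[< N (x^-1 * y) >].

Let sN : is_subgroup N := nsub_subgroup N.

Fact coset_rel_refl : reflexive coset_rel.
Proof. by move=> x; apply/asboolP; rewrite mulVg; exact: subgroup1. Qed.

Fact coset_rel_sym : symmetric coset_rel.
Proof.
by move=> x y; apply/asboolP/asboolP => /(subgroupV sN); rewrite invgM invgK.
Qed.

Fact coset_rel_trans : transitive coset_rel.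
Proof.
move=> y x z /asboolP xy /asboolP yz; apply/asboolP.
by have := subgroupM sN xy yz; rewrite mulgA mulgK.
Qed.

Canonical coset_rel_equiv :=
  EquivRel coset_rel coset_rel_refl coset_rel_sym coset_rel_trans.

Definition quotient_group : Type := {eq_quot coset_rel}.
HB.instance Definition _ := Choice.on quotient_group.
HB.instance Definition _ := EqQuotient.on quotient_group.

Lemma coset_eqP (x y : G) :
  \pi_quotient_group x = \pi_quotient_group y <-> N (x^-1 * y).
Proof.
by split=> [/eqmodP/asboolP //|h]; apply/eqmodP; apply/asboolP.
Qed.

Lemma coset_repr (x : G) : N ((repr (\pi_quotient_group x))^-1 * x).
Proof. by apply/coset_eqP; rewrite reprK. Qed.

Definition quot_mul (a b : quotient_group) : quotient_group :=
  \pi_quotient_group (repr a * repr b).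
Definition quot_inv (a : quotient_group) : quotient_group :=
  \pi_quotient_group ((repr a)^-1).
Definition quot_one : quotient_group := \pi_quotient_group 1.

Lemma quot_mulE (x y : G) :
  quot_mul (\pi_quotient_group x) (\pi_quotient_group y) = \pi_quotient_group (x * y).
Proof.
apply/coset_eqP; set a := repr _; set b := repr _.
have -> : (a * b)^-1 * (x * y) = (b^-1 * (a^-1 * x) * b) * (b^-1 * y).
  by rewrite invgM !mulgA mulgK.
apply: subgroupM => //; last exact: coset_repr.
by rewrite -[X in _ * X]invgK; apply: nsub_normal; exact: coset_repr.
Qed.

Lemma quot_invE (x : G) : quot_inv (\pi_quotient_group x) = \pi_quotient_group x^-1.
Proof.
apply/coset_eqP; rewrite invgK; set a := repr _.
have -> : a * x^-1 = x * (x^-1 * a) * x^-1 by rewrite !mulgA mulgV mul1g.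
apply: nsub_normal; rewrite -[_ * _]invgK invgM invgK.
by apply: subgroupV => //; exact: coset_repr.
Qed.

Fact quot_mulgA : associative quot_mul.
Proof.
move=> a b c; rewrite -[a]reprK -[b]reprK -[c]reprK.
set x := repr a; set y := repr b; set z := repr c.
by rewrite (quot_mulE x y) (quot_mulE y z) !quot_mulE mulgA.
Qed.
Fact quot_mul1g : left_id quot_one quot_mul.
Proof. by move=> c; rewrite -[c]reprK quot_mulE mul1g. Qed.
Fact quot_mulg1 : right_id quot_one quot_mul.
Proof. by move=> c; rewrite -[c]reprK quot_mulE mulg1. Qed.
Fact quot_mulVg : left_inverse quot_one quot_inv quot_mul.
Proof. by move=> c; rewrite -[c]reprK quot_invE quot_mulE mulVg. Qed.
Fact quot_mulgV : right_inverse quot_one quot_inv quot_mul.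
Proof. by move=> c; rewrite -[c]reprK quot_invE quot_mulE mulgV. Qed.

HB.instance Definition _ := isGroup.Build quotient_group
  quot_mulgA quot_mul1g quot_mulg1 quot_mulVg quot_mulgV.

End QuotientGroup.

(* The free product: words in the letters of A and of B, modulo the congruence
   generated by multiplication inside each factor and deletion of units. *)
Section FreeProduct.
Variables A B : groupType.
Local Open Scope group_scope.
Local Open Scope quotient_scope.

Inductive word_equiv : seq (A + B) -> seq (A + B) -> Prop :=
| we_refl w : word_equiv w w
| we_sym w w' : word_equiv w w' -> word_equiv w' w
| we_trans w w' w'' : word_equiv w w' -> word_equiv w' w'' -> word_equiv w w''
| we_cat u v w w' : word_equiv w w' -> word_equiv (u ++ w ++ v) (u ++ w' ++ v)
| we_onel : word_equiv [:: inl 1] [::]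
| we_oner : word_equiv [:: inr 1] [::]
| we_mull a a' : word_equiv [:: inl a; inl a'] [:: inl (a * a')]
| we_mulr b b' : word_equiv [:: inr b; inr b'] [:: inr (b * b')].

Definition word_rel (w w' : seq (A + B)) : bool := `[< word_equiv w w' >].

Fact word_rel_refl : reflexive word_rel.
Proof. by move=> w; apply/asboolP; exact: we_refl. Qed.
Fact word_rel_sym : symmetric word_rel.
Proof. by move=> w w'; apply/asboolP/asboolP; exact: we_sym. Qed.
Fact word_rel_trans : transitive word_rel.
Proof.
by move=> w w' w'' /asboolP h /asboolP h'; apply/asboolP; exact: we_trans h h'.
Qed.

Canonical word_rel_equiv :=
  EquivRel word_rel word_rel_refl word_rel_sym word_rel_trans.

Definition free_product : Type := {eq_quot word_rel}.
HB.instance Definition _ := Choice.on free_product.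
HB.instance Definition _ := EqQuotient.on free_product.

Lemma word_eqP (w w' : seq (A + B)) :
  \pi_free_product w = \pi_free_product w' <-> word_equiv w w'.
Proof.
by split=> [/eqmodP/asboolP //|h]; apply/eqmodP; apply/asboolP.
Qed.

Lemma word_repr (w : seq (A + B)) : word_equiv (repr (\pi_free_product w)) w.
Proof. by apply/word_eqP; rewrite reprK. Qed.

Definition letter_inv (l : A + B) : A + B :=
  match l with inl a => inl a^-1 | inr b => inr b^-1 end.
Definition word_inv (w : seq (A + B)) : seq (A + B) := rev (map letter_inv w).

Lemma we_cat2 u u' v v' :
  word_equiv u u' -> word_equiv v v' -> word_equiv (u ++ v) (u' ++ v').
Proof.
move=> uu' vv'; apply: (@we_trans _ (u' ++ v)).
  exact: (@we_cat [::] v u u').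
by have := we_cat u' [::] vv'; rewrite !cats0.
Qed.

Lemma we_inv w w' : word_equiv w w' -> word_equiv (word_inv w) (word_inv w').
Proof.
rewrite /word_inv; elim=> {w w'}.
- by move=> w; exact: we_refl.
- by move=> w w' _; exact: we_sym.
- by move=> w w' w'' _ h _; exact: we_trans h.
- move=> u v w w' _ h; rewrite !map_cat !rev_cat -!catA.
  by apply: we_cat.
- by rewrite /= invg1; exact: we_onel.
- by rewrite /= invg1; exact: we_oner.
- by move=> a a'; rewrite /rev /= invgM; exact: we_mull.
- by move=> b b'; rewrite /rev /= invgM; exact: we_mulr.
Qed.

Lemma we_mulVw w : word_equiv (word_inv w ++ w) [::].
Proof.
elim: w => [|l w IHw]; first exact: we_refl.
rewrite /word_inv map_cons rev_cons cat_rcons.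
apply: we_trans IHw; apply: (@we_cat _ w [:: letter_inv l; l] [::]).
case: l => x /=.
- by apply: (we_trans (we_mull _ _)); rewrite mulVg; exact: we_onel.
- by apply: (we_trans (we_mulr _ _)); rewrite mulVg; exact: we_oner.
Qed.

Lemma word_invK w : word_inv (word_inv w) = w.
Proof.
rewrite /word_inv map_rev revK -map_comp map_id_in // => -[x|x] _ /=;
  by rewrite invgK.
Qed.

Definition fp_mul (x y : free_product) : free_product :=
  \pi_free_product (repr x ++ repr y).
Definition fp_inv (x : free_product) : free_product :=
  \pi_free_product (word_inv (repr x)).
Definition fp_one : free_product := \pi_free_product [::].

Lemma fp_mulE (u v : seq (A + B)) :
  fp_mul (\pi_free_product u) (\pi_free_product v) = \pi_free_product (u ++ v).
Proof. by apply/word_eqP; apply: we_cat2; exact: word_repr. Qed.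

Lemma fp_invE (u : seq (A + B)) :
  fp_inv (\pi_free_product u) = \pi_free_product (word_inv u).
Proof. by apply/word_eqP; apply: we_inv; exact: word_repr. Qed.

Fact fp_mulgA : associative fp_mul.
Proof.
move=> x y z; rewrite -[x]reprK -[y]reprK -[z]reprK.
set u := repr x; set v := repr y; set w := repr z.
by rewrite (fp_mulE u v) (fp_mulE v w) !fp_mulE catA.
Qed.
Fact fp_mul1g : left_id fp_one fp_mul.
Proof. by move=> c; rewrite -[c]reprK fp_mulE. Qed.
Fact fp_mulg1 : right_id fp_one fp_mul.
Proof. by move=> c; rewrite -[c]reprK fp_mulE cats0. Qed.
Fact fp_mulVg : left_inverse fp_one fp_inv fp_mul.
Proof.
by move=> c; rewrite -[c]reprK fp_invE fp_mulE; apply/word_eqP; exact: we_mulVw.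
Qed.
Fact fp_mulgV : right_inverse fp_one fp_inv fp_mul.
Proof.
move=> c; rewrite -[c]reprK fp_invE fp_mulE; apply/word_eqP.
by rewrite -{1}[repr c]word_invK; exact: we_mulVw.
Qed.

HB.instance Definition _ := isGroup.Build free_product
  fp_mulgA fp_mul1g fp_mulg1 fp_mulVg fp_mulgV.

Definition fp_inl (a : A) : free_product := \pi_free_product [:: inl a].
Definition fp_inr (b : B) : free_product := \pi_free_product [:: inr b].

(* The subgroup [A, B] of A * B. *)
Definition cross_comm : set free_product :=
  generated [set z | exists a b, z = comm (fp_inl a) (fp_inr b)].

(* The normal subgroup [A * B, [A, B]] of A * B. *)
Definition triple_comm : normalSubgroup free_product :=
  @NormalSubgroup free_product
    (generated [set z | exists p q, cross_comm q /\ z = comm p q])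
    (@generated_subgroup free_product _)
    (@comm_generated_normal free_product cross_comm).

Definition nilpotent_product2 : groupType := quotient_group triple_comm.

End FreeProduct.

Section RealSum.
Variables (R : realType) (I : choiceType).
Implicit Types (h k p q : I -> R) (c : R).

Definition summableR h : Prop := (\esum_(i in [set: I]) `|h i|%:E < +oo)%E.

Definition psumR p : R := fine (\esum_(i in [set: I]) (p i)%:E).

(* The unconditional sum of an absolutely summable real family. *)
Definition sumR h : R :=
  psumR (fun i => Num.max (h i) 0) - psumR (fun i => Num.max (- h i) 0).

Lemma le_summableR h k :
  (forall i, `|h i| <= `|k i|) -> summableR k -> summableR h.
Proof.
move=> hk; apply: le_lt_trans; apply: le_esum => i _; rewrite lee_fin; exact: hk.
Qed.

Lemma psumRK p : summableR p -> (forall i, 0 <= p i) ->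
  (psumR p)%:E = \esum_(i in [set: I]) (p i)%:E.
Proof.
move=> sp p0; rewrite /psumR fineK // ge0_fin_numE; last first.
  by apply: esum_ge0 => i _; rewrite lee_fin.
apply: le_lt_trans sp; apply: le_esum => i _; by rewrite lee_fin ler_norm.
Qed.

Lemma summableRD h k : summableR h -> summableR k -> summableR (h \+ k).
Proof.
move=> sh sk; have := lte_add_pinfty sh sk; rewrite -esumD; [|by move=> i _; rewrite lee_fin..].
apply: le_lt_trans; apply: le_esum => i _.
by rewrite -EFinD lee_fin ler_normD.
Qed.

Lemma summableRN h : summableR h -> summableR (fun i => - h i).
Proof. by apply: le_summableR => i; rewrite normrN. Qed.

Lemma psumRD p q : summableR p -> summableR q ->
  (forall i, 0 <= p i) -> (forall i, 0 <= q i) ->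
  psumR (p \+ q) = psumR p + psumR q.
Proof.
move=> sp sq p0 q0; apply: EFin_inj; rewrite EFinD psumRK; last 2 first.
- exact: summableRD.
- by move=> i; rewrite /= addr_ge0.
rewrite !psumRK // -esumD => [//|i _|i _]; by rewrite lee_fin.
Qed.

Lemma esumRZ c p : 0 <= c -> (forall i, 0 <= p i) ->
  (\esum_(i in [set: I]) (c * p i)%:E <= c%:E * \esum_(i in [set: I]) (p i)%:E)%E.
Proof.
move=> c0 p0; apply: ge_ereal_sup => _ [X [finX _] <-].
under eq_fsbigr do rewrite EFinM.
rewrite -ge0_mule_fsumr; last by move=> i; rewrite lee_fin.
apply: lee_wpmul2l; first by rewrite lee_fin.
by apply: ereal_sup_ubound; exists X.
Qed.

Lemma summableRZ c h : summableR h -> summableR (fun i => c * h i).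
Proof.
move=> sh; rewrite /summableR.
under eq_esum do rewrite normrM.
apply: le_lt_trans (esumRZ _ _) _ => //.
by rewrite lte_mul_pinfty // lee_fin.
Qed.

Lemma psumRZ c p : summableR p -> 0 <= c -> (forall i, 0 <= p i) ->
  psumR (fun i => c * p i) = c * psumR p.
Proof.
move=> sp; rewrite le_eqVlt => /predU1P[<-|c0] p0.
  rewrite mul0r /psumR esum1 // => i _; by rewrite mul0r.
have cp0 i : 0 <= c * p i by rewrite mulr_ge0 // ltW.
have scp := summableRZ c sp.
apply/eqP; rewrite eq_le; apply/andP; split; rewrite -lee_fin.
  by rewrite EFinM !psumRK //; apply: esumRZ => //; rewrite ltW.
rewrite lee_fin -ler_pdivlMl // -lee_fin EFinM !psumRK //.
apply: le_trans (esumRZ _ _) => //; last by rewrite invr_ge0 ltW.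
apply: le_esum => i _; by rewrite mulKf // gt_eqF.
Qed.

Lemma psumR_ge0 p : (forall i, 0 <= p i) -> 0 <= psumR p.
Proof.
by move=> p0; apply: fine_ge0; apply: esum_ge0 => i _; rewrite lee_fin.
Qed.

Lemma ler_psumR p (s : seq I) : summableR p -> (forall i, 0 <= p i) ->
  uniq s -> \sum_(i <- s) p i <= psumR p.
Proof.
move=> sp p0 us; rewrite -lee_fin psumRK //; apply: ereal_sup_ubound => /=.
exists [set` s]; first by split => //; exact: finite_seq.
by rewrite -fsbig_seq // sumEFin.
Qed.

Lemma summableR_bound h M :
  (forall s, uniq s -> \sum_(i <- s) `|h i| <= M) -> summableR h.
Proof.
move=> hM; apply: le_lt_trans (ltry M); apply: ge_ereal_sup.
move=> _ [X [/finite_seqP[s ->] _] <-].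
have e : [set` s] = [set` undup s] by apply/seteqP; split=> i /=; rewrite mem_undup.
by rewrite e -fsbig_seq ?undup_uniq // sumEFin lee_fin hM ?undup_uniq.
Qed.

Lemma psumR_le p M : (forall i, 0 <= p i) ->
  (forall s, uniq s -> \sum_(i <- s) p i <= M) -> psumR p <= M.
Proof.
move=> p0 pM.
have sp : summableR p.
  apply: (@summableR_bound p M) => s us.
  by under eq_bigr do rewrite ger0_norm //; exact: pM.
rewrite -lee_fin psumRK //; apply: ge_ereal_sup.
move=> _ [X [/finite_seqP[s ->] _] <-].
have e : [set` s] = [set` undup s] by apply/seteqP; split=> i /=; rewrite mem_undup.
by rewrite e -fsbig_seq ?undup_uniq // sumEFin lee_fin pM ?undup_uniq.
Qed.

Lemma sumRB p q : summableR p -> summableR q ->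
  (forall i, 0 <= p i) -> (forall i, 0 <= q i) ->
  sumR (p \- q) = psumR p - psumR q.
Proof.
move=> sp sq p0 q0; rewrite /sumR; set u := fun i => _; set v := fun i => _.
have u0 i : 0 <= u i by rewrite /u le_max lexx orbT.
have v0 i : 0 <= v i by rewrite /v le_max lexx orbT.
have su : summableR u.
  apply: le_summableR sp => i; rewrite !ger0_norm // /u /= ge_max p0 andbT.
  by rewrite lerBlDr lerDl.
have sv : summableR v.
  apply: le_summableR sq => i; rewrite !ger0_norm // /v /= ge_max q0 andbT.
  by rewrite opprB lerBlDr lerDl.
suff e : psumR u + psumR q = psumR v + psumR p.
  by apply/eqP; rewrite subr_eq addrAC eq_sym subr_eq e addrC.
rewrite -!psumRD //; congr psumR; apply/funext => i; rewrite /u /v /=.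
case: (lerP 0 (p i - q i)) => h.
  by rewrite max_r ?oppr_le0 //; ring.
by rewrite max_l ?oppr_ge0 ?(ltW h) //; ring.
Qed.

Lemma sumR_posneg h : summableR h -> exists p q,
  [/\ summableR p, summableR q, forall i, 0 <= p i, forall i, 0 <= q i
    & h = p \- q].
Proof.
move=> sh; exists (fun i => `|h i| + h i), (fun i => `|h i|); split.
- apply: summableRD => //; apply: le_summableR sh => i; by rewrite normr_id.
- by apply: le_summableR sh => i; rewrite normr_id.
- by move=> i; have := ler_norm (- h i); rewrite normrN; lra.
- by [].
- by apply/funext => i /=; rewrite addrAC subrr add0r.
Qed.

Lemma sumRD h k : summableR h -> summableR k ->
  sumR (h \+ k) = sumR h + sumR k.
Proof.
move=> /sumR_posneg[p [q [sp sq p0 q0 ->]]] /sumR_posneg[u [v [su sv u0 v0 ->]]].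
have -> : (p \- q) \+ (u \- v) = (p \+ u) \- (q \+ v).
  by apply/funext => i /=; ring.
rewrite !sumRB ?psumRD //; first by ring.
- exact: summableRD.
- exact: summableRD.
- by move=> i; rewrite addr_ge0.
- by move=> i; rewrite addr_ge0.
Qed.

Lemma sumRN h : summableR h -> sumR (fun i => - h i) = - sumR h.
Proof.
move=> /sumR_posneg[p [q [sp sq p0 q0 ->]]].
have -> : (fun i => - (p \- q) i) = q \- p by apply/funext => i /=; ring.
by rewrite !sumRB //; ring.
Qed.

Lemma sumRZ c h : summableR h -> sumR (fun i => c * h i) = c * sumR h.
Proof.
wlog c0 : c / 0 <= c => [W sh|].
  case: (lerP 0 c) => [c0|/ltW c0]; first exact: W.
  have -> : (fun i => c * h i) = (fun i => - (- c * h i)).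
    by apply/funext => i; ring.
  by rewrite sumRN ?W ?oppr_ge0 //; [ring|exact: summableRZ].
move=> /sumR_posneg[p [q [sp sq p0 q0 ->]]].
have -> : (fun i => c * (p \- q) i) = (fun i => c * p i) \- (fun i => c * q i).
  by apply/funext => i /=; ring.
rewrite !sumRB ?psumRZ //; first by ring.
- exact: summableRZ.
- exact: summableRZ.
- by move=> i; rewrite mulr_ge0.
- by move=> i; rewrite mulr_ge0.
Qed.

Lemma sumR_lin a b h k l : summableR h -> summableR k -> summableR l ->
  sumR (fun i => a * h i + b * k i + l i) = a * sumR h + b * sumR k + sumR l.
Proof.
move=> sh sk sl; have sah := summableRZ a sh; have sbk := summableRZ b sk.
rewrite (sumRD (summableRD sah sbk) sl) (sumRD sah sbk).
by rewrite (sumRZ a sh) (sumRZ b sk).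
Qed.

Lemma sumR_ge0E p : summableR p -> (forall i, 0 <= p i) -> sumR p = psumR p.
Proof.
move=> sp p0; rewrite /sumR [X in _ - X](_ : _ = 0) ?subr0.
  by congr psumR; apply/funext => i; rewrite max_l.
by rewrite /psumR esum1 // => i _; rewrite max_r // oppr_le0.
Qed.

End RealSum.

Section L2.
Variables (R : realType) (I : choiceType).
Implicit Types (f g : I -> R[i]) (z w : R[i]).
Local Open Scope complex_scope.

(* |z|^2 as a real number. *)
Definition normsq z : R := complex.Re z ^+ 2 + complex.Im z ^+ 2.

Lemma normsq_ge0 z : 0 <= normsq z.
Proof. by rewrite addr_ge0 // sqr_ge0. Qed.

Lemma normsq_eq0 z : normsq z = 0 -> z = 0.
Proof.
case: z => a b; rewrite /normsq /= => /eqP.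
by rewrite paddr_eq0 ?sqr_ge0 // !sqrf_eq0 => /andP[/eqP -> /eqP ->].
Qed.

Definition square_summable f : Prop := summableR (fun i => normsq (f i)).

Definition l2_pred : {pred I -> R[i]} := mem [set f | square_summable f].

Lemma le_square_summable f (h : I -> R) : square_summable f ->
  (forall i, `|h i| <= normsq (f i)) -> summableR h.
Proof.
move=> sf hf; apply: le_summableR sf => i.
by rewrite (ger0_norm (normsq_ge0 _)).
Qed.

Lemma l2_submod_closed : submod_closed l2_pred.
Proof.
split.
  rewrite inE /= /square_summable /summableR esum1 ?ltry // => i _.
  by rewrite /normsq /= expr0n /= addr0 normr0.
move=> a f g; rewrite !inE /= => sf sg.
have := summableRD (summableRZ (2 * normsq a) sf) (summableRZ 2 sg).
apply: le_summableR => i /=.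
rewrite !ger0_norm ?normsq_ge0 ?addr_ge0 ?mulr_ge0 ?normsq_ge0 //.
have -> : (a *: f + g) i = a * f i + g i by [].
rewrite /normsq; case: (f i) (g i) a => [x y] [u v] [c d] /=.
suff : 0 <= (c * x - d * y - u) ^+ 2 + (c * y + d * x - v) ^+ 2. by nra.
by rewrite addr_ge0 // sqr_ge0.
Qed.

HB.instance Definition _ := GRing.isSubmodClosed.Build R[i] (I -> R[i]) l2_pred
  l2_submod_closed.

Record l2 := L2 { l2_fun :> I -> R[i]; l2_funP : l2_fun \in l2_pred }.

HB.instance Definition _ := [isSub for l2_fun].
HB.instance Definition _ := [Choice of l2 by <:].
HB.instance Definition _ := [SubChoice_isSubLmodule of l2 by <:].

Lemma l2P (x y : l2) : (forall i, x i = y i) -> x = y.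
Proof. by move=> h; apply/val_inj/funext. Qed.

Lemma l2_summable (x : l2) : square_summable x.
Proof. by have := l2_funP x; rewrite inE. Qed.

Definition l2_dot (x y : l2) : R[i] :=
  Complex (sumR (fun i => complex.Re (x i * (y i)^*)))
          (sumR (fun i => complex.Im (x i * (y i)^*))).

Lemma norm_pair_le (a b c d : R) :
  `|a * c + b * d| <= (a ^+ 2 + b ^+ 2) + (c ^+ 2 + d ^+ 2).
Proof.
pose q := a ^+ 2 + b ^+ 2 + c ^+ 2 + d ^+ 2.
have q0 : 0 <= q by rewrite !addr_ge0 // sqr_ge0.
rewrite ler_norml -subr_ge0 -[X in _ && X]subr_ge0; apply/andP; split.
  have -> : a * c + b * d - - (a ^+ 2 + b ^+ 2 + (c ^+ 2 + d ^+ 2)) =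
            ((a + c) ^+ 2 + (b + d) ^+ 2 + q) / 2 by rewrite /q; field.
  by rewrite divr_ge0 // !addr_ge0 // sqr_ge0.
have -> : a ^+ 2 + b ^+ 2 + (c ^+ 2 + d ^+ 2) - (a * c + b * d) =
          ((a - c) ^+ 2 + (b - d) ^+ 2 + q) / 2 by rewrite /q; field.
by rewrite divr_ge0 // !addr_ge0 // sqr_ge0.
Qed.

Lemma summable_Re (x y : l2) : summableR (fun i => complex.Re (x i * (y i)^*)).
Proof.
have := summableRD (l2_summable x) (l2_summable y).
apply: le_summableR => i /=.
rewrite (ger0_norm (addr_ge0 (normsq_ge0 _) (normsq_ge0 _))) /normsq.
case: (x i) (y i) => [a b] [c d] /=.
by have := norm_pair_le a b c d; congr (_ <= _); congr `|_|; ring.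
Qed.

Lemma summable_Im (x y : l2) : summableR (fun i => complex.Im (x i * (y i)^*)).
Proof.
have := summableRD (l2_summable x) (l2_summable y).
apply: le_summableR => i /=.
rewrite (ger0_norm (addr_ge0 (normsq_ge0 _) (normsq_ge0 _))) /normsq.
case: (x i) (y i) => [a b] [c d] /=.
have := norm_pair_le b a c (- d); rewrite sqrrN [b ^+ 2 + _]addrC.
by congr (_ <= _); congr `|_|; ring.
Qed.

Lemma l2_dotC (x y : l2) : l2_dot x y = (-1) ^+ false * (l2_dot y x)^*.
Proof.
rewrite expr0 mul1r /l2_dot; apply/eqP; rewrite eq_complex /=; apply/andP; split.
  apply/eqP; congr sumR; apply/funext => i.
  by case: (x i) (y i) => [a b] [c d] /=; ring.
rewrite -sumRN; last exact: summable_Im.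
apply/eqP; congr sumR; apply/funext => i.
by case: (x i) (y i) => [a b] [c d] /=; ring.
Qed.

Lemma l2E a (x y : l2) i : (a *: x + y) i = a * x i + y i.
Proof. by []. Qed.

Lemma l2_dot_linear (y : l2) a (x x' : l2) :
  l2_dot (a *: x + x') y = a * l2_dot x y + l2_dot x' y.
Proof.
have := l2E a x x'; move: (a *: x + x') => z.
case: a => a b zE; rewrite /l2_dot; apply/eqP; rewrite eq_complex /=.
have sR := summable_Re x y; have sI := summable_Im x y.
have sR' := summable_Re x' y; have sI' := summable_Im x' y.
apply/andP; split; apply/eqP.
  transitivity (a * sumR (fun i => complex.Re (x i * (y i)^*)) +
    (- b) * sumR (fun i => complex.Im (x i * (y i)^*)) +
    sumR (fun i => complex.Re (x' i * (y i)^*))); last by ring.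
  rewrite -sumR_lin //; congr sumR; apply/funext => i; rewrite zE.
  by case: (x i) (x' i) (y i) => [? ?] [? ?] [? ?] /=; ring.
rewrite -sumR_lin //; congr sumR; apply/funext => i; rewrite zE.
by case: (x i) (x' i) (y i) => [? ?] [? ?] [? ?] /=; ring.
Qed.

Fact l2_dot_bilinear :
  bilinear_for (GRing.Scale.Law.clone _ _ ( *%R) _)
               (GRing.Scale.Law.clone _ _ (Num.conj \; *%R) _) l2_dot.
Proof.
split=> [y a x x'|x a y y'] /=; first exact: l2_dot_linear.
rewrite l2_dotC l2_dot_linear [in RHS]l2_dotC [X in _ = _ + X]l2_dotC.
by rewrite !expr0 !mul1r rmorphD rmorphM.
Qed.

HB.instance Definition _ :=
  bilinear_isBilinear.Build R[i] l2 l2 R[i] *%R (Num.conj \; *%R) l2_dot l2_dot_bilinear.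
HB.instance Definition _ :=
  isHermitianSesquilinear.Build R[i] l2 false Num.conj l2_dot l2_dotC.

Definition l2_norm2 (x : l2) : R := psumR (fun i => normsq (x i)).

Lemma l2_norm2E (x : l2) : l2_dot x x = (l2_norm2 x)%:C.
Proof.
rewrite /l2_dot; congr Complex.
  rewrite /l2_norm2 -sumR_ge0E; last 2 first.
  - exact: l2_summable.
  - by move=> i; exact: normsq_ge0.
  congr sumR; apply/funext => i; rewrite /normsq.
  by case: (x i) => a b /=; ring.
rewrite sumR_ge0E; last 2 first.
- exact: summable_Im.
- by move=> i; case: (x i) => a b /=; rewrite le_eqVlt; apply/orP; left; apply/eqP; ring.
by rewrite /psumR esum1 // => i _; case: (x i) => a b /=; congr EFin; ring.
Qed.

Lemma l2_norm2_ge0 (x : l2) : 0 <= l2_norm2 x.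
Proof. by apply: psumR_ge0 => i; exact: normsq_ge0. Qed.

Lemma l2_norm2_ge (x : l2) i : normsq (x i) <= l2_norm2 x.
Proof.
have := @ler_psumR _ _ _ [:: i] (l2_summable x) (fun i => normsq_ge0 _) isT.
by rewrite big_seq1.
Qed.

Lemma l2_norm2_eq0 (x : l2) : l2_norm2 x = 0 -> x = 0.
Proof.
move=> x0; apply: l2P => i; apply: normsq_eq0; apply/eqP.
by rewrite eq_le normsq_ge0 andbT -x0 l2_norm2_ge.
Qed.

Fact l2_dot_gt0 (x : l2) : x != 0 -> 0 < l2_dot x x.
Proof.
move=> x0; rewrite l2_norm2E ltcE /= eqxx lt_neqAle l2_norm2_ge0 andbT eq_sym.
by apply: contra_neq x0; exact: l2_norm2_eq0.
Qed.

HB.instance Definition _ := isDotProduct.Build R[i] l2 l2_dot l2_dot_gt0.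

Definition l2_norm (x : l2) : R[i] := (Num.sqrt (l2_norm2 x))%:C.

Let rdot (x y : l2) : R := complex.Re (l2_dot x y).

Lemma l2_norm2_lin (t : R) (x y : l2) :
  l2_norm2 (t%:C *: x + y) = t ^+ 2 * l2_norm2 x + 2 * t * rdot x y + l2_norm2 y.
Proof.
have e (z : l2) : l2_norm2 z = complex.Re (l2_dot z z) by rewrite l2_norm2E.
rewrite !e l2_dot_linear [l2_dot x (_ + _)]l2_dotC [l2_dot y (_ + _)]l2_dotC.
rewrite !expr0 !mul1r !l2_dot_linear [l2_dot y x]l2_dotC expr0 mul1r /rdot.
case: (l2_dot x x) (l2_dot x y) (l2_dot y y) => [a b] [c d] [u v] /=; ring.
Qed.

Lemma l2_CauchySchwarz (x y : l2) :
  rdot x y <= Num.sqrt (l2_norm2 x) * Num.sqrt (l2_norm2 y).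
Proof.
set a := l2_norm2 x; set b := l2_norm2 y; set c := rdot x y.
have a0 : 0 <= a := l2_norm2_ge0 x; have b0 : 0 <= b := l2_norm2_ge0 y.
have q t : 0 <= t ^+ 2 * a + 2 * t * c + b by rewrite -l2_norm2_lin l2_norm2_ge0.
apply: le_trans (ler_norm _) _.
rewrite -sqrtrM // -sqrtr_sqr ler_sqrt ?mulr_ge0 //.
have [a_eq0|a_neq0] := eqVneq a 0.
  have -> : c = 0.
    by rewrite /c /rdot (l2_norm2_eq0 a_eq0) linear0l.
  by rewrite expr0n /= mulr_ge0.
have a_gt0 : 0 < a by rewrite lt_neqAle eq_sym a_neq0.
have := q (- c / a).
have -> : (- c / a) ^+ 2 * a + 2 * (- c / a) * c + b = (a * b - c ^+ 2) / a.
  by field.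
by rewrite pmulr_lge0 ?invr_gt0 // subr_ge0.
Qed.

Fact l2_normD (x y : l2) : l2_norm (x + y) <= l2_norm x + l2_norm y.
Proof.
rewrite /l2_norm -rmorphD lecR.
set a := Num.sqrt (l2_norm2 x); set b := Num.sqrt (l2_norm2 y).
have ab0 : 0 <= a + b by rewrite addr_ge0 // sqrtr_ge0.
rewrite -(ger0_norm ab0) -sqrtr_sqr ler_sqrt ?sqr_ge0 //.
have -> : x + y = 1%:C *: x + y by rewrite scale1r.
have := l2_CauchySchwarz x y; rewrite -/a -/b => h.
rewrite l2_norm2_lin -[l2_norm2 x]sqr_sqrtr ?l2_norm2_ge0 //.
rewrite -[l2_norm2 y]sqr_sqrtr ?l2_norm2_ge0 // -/a -/b; nra.
Qed.

Fact l2_normZ (a : R[i]) (x : l2) : l2_norm (a *: x) = `|a| * l2_norm x.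
Proof.
have -> : `|a| = (Num.sqrt (normsq a))%:C by case: a.
rewrite /l2_norm -rmorphM -sqrtrM ?normsq_ge0 //; congr (Num.sqrt _)%:C.
rewrite /l2_norm2 -psumRZ ?normsq_ge0 //; last 2 first.
- exact: l2_summable.
- by move=> i; exact: normsq_ge0.
congr psumR; apply/funext => i.
have -> : (a *: x) i = a * x i by [].
by case: (x i) a => [u v] [c d]; rewrite /normsq /=; ring.
Qed.

Fact l2_norm_eq0 (x : l2) : l2_norm x = 0 -> x = 0.
Proof.
move=> [/eqP]; rewrite sqrtr_eq0 => h; apply: l2_norm2_eq0.
by apply/eqP; rewrite eq_le h l2_norm2_ge0.
Qed.

HB.instance Definition _ :=
  Lmodule_isNormed.Build R[i] l2 l2_normD l2_normZ l2_norm_eq0.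

Lemma l2_normE (x : l2) : `|x| = l2_norm x.
Proof. by []. Qed.

Lemma l2_norm_le (x : l2) (e : R) : 0 <= e ->
  (forall s, uniq s -> \sum_(i <- s) normsq (x i) <= e ^+ 2) -> `|x| <= e%:C.
Proof.
move=> e0 h; rewrite l2_normE /l2_norm lecR -(ger0_norm e0) -sqrtr_sqr.
rewrite ler_sqrt ?sqr_ge0 //; apply: psumR_le => // i; exact: normsq_ge0.
Qed.

Lemma l2_norm_ge (x : l2) (e : R) s : `|x| <= e%:C -> uniq s ->
  \sum_(i <- s) normsq (x i) <= e ^+ 2.
Proof.
rewrite l2_normE /l2_norm lecR => xe us.
have e0 : 0 <= e by apply: le_trans xe; exact: sqrtr_ge0.
apply: (@le_trans _ _ (l2_norm2 x)).
  by apply: ler_psumR => //; [exact: l2_summable|move=> i; exact: normsq_ge0].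
by rewrite -(sqr_sqrtr (l2_norm2_ge0 x)) ler_sqr ?nnegrE ?sqrtr_ge0.
Qed.

Lemma cauchy_l2_real (F : set_system l2) (p : R[i] -> R) i :
  (forall z w, p z - p w = p (z - w)) -> (forall z, p z ^+ 2 <= normsq z) ->
  ProperFilter F -> cauchy F -> cvg ((fun x : l2 => p (x i)) @ F).
Proof.
move=> pB p_le FF /cauchy_ballP Fc; apply: cauchy_cvg.
apply/cauchy_ballP => e e0.
have e0' : 0 < e%:C by rewrite ltcR.
have := Fc _ e0'; case=> -[A B] /= [FA FB] AB.
exists ((fun x : l2 => p (x i)) @` A, (fun x : l2 => p (x i)) @` B).
  by split; [apply: filterS FA|apply: filterS FB] => x Ax; exists x.
move=> [_ _] /= [[x Ax <-] [y By <-]].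
have := AB (x, y) (conj Ax By).
rewrite -!ball_normE /= => xy.
have h : `|p (x i) - p (y i)| ^+ 2 <= l2_norm2 (x - y).
  rewrite real_normK ?num_real // pB; apply: le_trans (p_le _) _.
  exact: (l2_norm2_ge (x - y) i).
have : l2_norm2 (x - y) < e ^+ 2.
  move: xy; rewrite l2_normE /l2_norm ltcR => xy.
  by rewrite -(sqr_sqrtr (l2_norm2_ge0 _)) ltr_sqr ?nnegrE ?sqrtr_ge0 // ltW.
move=> /(le_lt_trans h); by rewrite ltr_sqr ?nnegrE // ltW.
Qed.

Lemma l2_complete (F : set_system l2) : ProperFilter F -> cauchy F -> cvg F.
Proof.
move=> FF Fc.
have cRe i : cvg ((fun x : l2 => complex.Re (x i)) @ F).
  apply: cauchy_l2_real => //; first by move=> [a b] [c d].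
  by move=> [a b]; rewrite /normsq /= lerDl sqr_ge0.
have cIm i : cvg ((fun x : l2 => complex.Im (x i)) @ F).
  apply: cauchy_l2_real => //; first by move=> [a b] [c d].
  by move=> [a b]; rewrite /normsq /= lerDr sqr_ge0.
pose g i : R[i] := Complex (lim ((fun x : l2 => complex.Re (x i)) @ F))
                           (lim ((fun x : l2 => complex.Im (x i)) @ F)).
have key (e : R) : 0 < e -> F [set x : l2 | forall s, uniq s ->
    \sum_(i <- s) normsq (x i - g i) <= e ^+ 2].
  move=> e0; move/cauchy_ballP: (Fc) => Fc'.
  have e0' : 0 < e%:C by rewrite ltcR.
  have := Fc' _ e0'; case=> -[A B] /= [FA FB] AB.
  apply: filterS FA => x Ax s us.
  have nB z w : normsq (z - w) =
      (complex.Re z - complex.Re w) * (complex.Re z - complex.Re w) +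
      (complex.Im z - complex.Im w) * (complex.Im z - complex.Im w).
    by case: z w => [a b] [c d]; rewrite /normsq /= !expr2.
  have cs : (fun y : l2 => \sum_(i <- s) normsq (x i - y i)) @ F -->
            \sum_(i <- s) normsq (x i - g i).
    elim: (s) => [|i t IHt].
      by rewrite big_nil; under eq_fun do rewrite big_nil; exact: cvg_cst.
    rewrite big_cons nB.
    under eq_fun do rewrite big_cons nB.
    apply: cvgD IHt.
    have cr : (fun y : l2 => complex.Re (x i) - complex.Re (y i)) @ F -->
        complex.Re (x i) - complex.Re (g i).
      by apply: cvgB; [exact: cvg_cst|exact: cRe].
    have ci : (fun y : l2 => complex.Im (x i) - complex.Im (y i)) @ F -->
        complex.Im (x i) - complex.Im (g i).
      by apply: cvgB; [exact: cvg_cst|exact: cIm].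
    by apply: cvgD; apply: cvgM.
  rewrite -(cvg_lim _ cs) //; apply: limr_le; first by apply/cvg_ex; eexists; exact: cs.
  apply: filterS FB => y By.
  apply: (@l2_norm_ge (x - y)) => //; apply: ltW.
  by have := AB (x, y) (conj Ax By); rewrite -!ball_normE.
have gl2 : g \in l2_pred.
  have [x xP] := filter_ex (key 1 ltr01).
  have xg : x \- g \in l2_pred.
    rewrite inE /= /square_summable; apply: (@summableR_bound _ _ _ (1 ^+ 2)) => s us.
    under eq_bigr do rewrite ger0_norm ?normsq_ge0 //.
    exact: xP.
  have -> : g = (-1) *: (x \- g) + x.
    by apply/funext => i; rewrite -[RHS]/(-1 * (x i - g i) + x i); ring.
  by apply: l2_submod_closed.2 => //; exact: l2_funP.
apply/cvg_ex; exists (L2 gl2); apply/cvgrPdist_le => e e0.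
have eE : e = (complex.Re e)%:C.
  by case: e e0 => a b; rewrite ltcE /= => /andP[/eqP -> _].
have e0' : 0 < complex.Re e by move: e0; rewrite [X in _ < X]eE ltcR.
apply: filterS (key _ e0') => x xP; rewrite distrC eE.
by apply: l2_norm_le; [exact: ltW|exact: xP].
Qed.

HB.instance Definition _ := Uniform_isComplete.Build l2 l2_complete.

End L2.

Local Open Scope complex_scope.

Section HilbertSpaces.
Variable R : realType.

Record hilbertSpace := HilbertSpace {
  hilbert_sort :> completeNormedModType R[i];
  hdot : {dot hilbert_sort for Num.conj};
  hdot_norm : forall x : hilbert_sort, `|x| ^+ 2 = hdot x x }.
Arguments hdot : clear implicits.

Fact l2_dot_norm (I : choiceType) (x : l2 R I) : `|x| ^+ 2 = l2_dot x x.
Proof.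
by rewrite l2_normE /l2_norm -rmorphXn sqr_sqrtr ?l2_norm2_ge0 // l2_norm2E.
Qed.

Definition l2_hilbert (I : choiceType) : hilbertSpace :=
  @HilbertSpace (l2 R I) (@l2_dot R I) (@l2_dot_norm I).

(* B(H), as a set of functions. *)
Definition bounded_op (H : hilbertSpace) : set (H -> H) :=
  [set T | linear T /\ continuous T].

(* The operator norm of T is at most c; 0 <= c makes c a real number. *)
Definition op_norm_le (H : hilbertSpace) (T : H -> H) (c : R[i]) : Prop :=
  0 <= c /\ forall x, `|T x| <= c * `|x|.

Definition adjoint (H : hilbertSpace) (S T : H -> H) : Prop :=
  forall x y, hdot H (S x) y = hdot H x (T y).

(* The m x m operator matrix (T i j) is a positive operator on H^m. *)
Definition pos_op_matrix (H : hilbertSpace) m (T : 'I_m -> 'I_m -> H -> H) :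
  Prop := forall x : 'I_m -> H, 0 <= \sum_i \sum_j hdot H (T i j (x j)) (x i).

Definition linear_on (H1 H2 : hilbertSpace) (A : set (H1 -> H1))
    (f : (H1 -> H1) -> (H2 -> H2)) : Prop :=
  forall (a : R[i]) S T, A S -> A T ->
    f (fun x => a *: S x + T x) = (fun x => a *: f S x + f T x).

(* Contractive completely positive maps from A, a linear subspace of B(H1),
   to B(H2); the values of f outside A are irrelevant. *)
Definition ccp (H1 H2 : hilbertSpace) (A : set (H1 -> H1))
    (f : (H1 -> H1) -> (H2 -> H2)) : Prop :=
  [/\ forall T, A T -> bounded_op (f T),
      linear_on A f,
      forall m (T : 'I_m -> 'I_m -> H1 -> H1), (forall i j, A (T i j)) ->
        pos_op_matrix T -> pos_op_matrix (fun i j => f (T i j))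
    & forall T c, A T -> op_norm_le T c -> op_norm_le (f T) c].

Definition faithful_rep (H1 H2 : hilbertSpace) (A : set (H1 -> H1))
    (pi : (H1 -> H1) -> (H2 -> H2)) : Prop :=
  [/\ forall T, A T -> bounded_op (pi T),
      linear_on A pi,
      forall S T, A S -> A T -> pi (S \o T) = pi S \o pi T,
      forall S T, A S -> A T -> adjoint S T -> adjoint (pi S) (pi T)
    & forall S T, A S -> A T -> pi S = pi T -> S = T].

(* f is a point-norm limit of a net of contractive completely positive maps
   factoring through matrix algebras; the algebra of complex n x n matrices is
   B(l^2('I_n)).  Point-norm approximation by a net amounts to approximation
   on finite subsets up to any e > 0. *)
Definition nuclear_map (H1 H2 : hilbertSpace) (A : set (H1 -> H1))
    (f : (H1 -> H1) -> (H2 -> H2)) : Prop :=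
  forall (F : set (H1 -> H1)) (e : R), finite_set F -> F `<=` A -> 0 < e ->
  exists (n : nat)
    (phi : (H1 -> H1) -> (l2_hilbert 'I_n -> l2_hilbert 'I_n))
    (psi : (l2_hilbert 'I_n -> l2_hilbert 'I_n) -> (H2 -> H2)),
  [/\ ccp A phi, ccp (@bounded_op (l2_hilbert 'I_n)) psi
    & forall T, F T -> op_norm_le (fun x => psi (phi T) x - f T x) e%:C].

(* Exactness of a concrete C*-algebra A: some faithful representation of A on
   a Hilbert space is a nuclear map. *)
Definition exact_Cstar (H1 : hilbertSpace) (A : set (H1 -> H1)) : Prop :=
  exists (H2 : hilbertSpace) (pi : (H1 -> H1) -> (H2 -> H2)),
    faithful_rep A pi /\ nuclear_map A pi.

End HilbertSpaces.

Section GroupProperties.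
Variables (R : realType) (G : groupType).

Definition bounded_real (f : G -> R) : Prop :=
  exists M : R, forall g, `|f g| <= M.

(* A left-invariant mean on the bounded real functions on G. *)
Definition amenable : Prop :=
  exists m : (G -> R) -> R,
  [/\ forall (a : R) f h, bounded_real f -> bounded_real h ->
        m (fun g => a * f g + h g) = a * m f + m h,
      forall f, bounded_real f -> (forall g, 0 <= f g) -> 0 <= m f,
      m (fun=> 1) = 1
    & forall f k, bounded_real f -> m (fun g => f (k^-1 * g)%g) = m f].

Definition positive_definite (phi : G -> R[i]) : Prop :=
  forall n (g : 'I_n -> G) (c : 'I_n -> R[i]),
    0 <= \sum_i \sum_j (c i)^* * c j * phi ((g i)^-1 * g j)%g.

Definition vanishes_at_infinity (phi : G -> R[i]) : Prop :=
  forall e : R, 0 < e -> finite_set [set g | e%:C <= `|phi g|].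

Definition haagerup : Prop :=
  exists phi : nat -> G -> R[i],
  [/\ forall n, positive_definite (phi n),
      forall n, phi n 1%g = 1,
      forall n, vanishes_at_infinity (phi n)
    & forall g, phi n g @[n --> \oo] --> (1 : R[i]^o)].

Definition unitary_rep (H : hilbertSpace R) (pi : G -> H -> H) : Prop :=
  [/\ forall g, linear (pi g),
      forall g x y, hdot H (pi g x) (pi g y) = hdot H x y,
      forall x, pi 1%g x = x
    & forall g h x, pi (g * h)%g x = pi g (pi h x)].

(* G has a finite (that is, compact) Kazhdan set Q with Kazhdan constant e. *)
Definition property_T : Prop :=
  exists (Q : set G) (e : R), [/\ finite_set Q, 0 < e &
    forall (H : hilbertSpace R) (pi : G -> H -> H), unitary_rep pi ->
    (exists2 x : H, x != 0 & forall g, Q g -> `|pi g x - x| < e%:C * `|x|) ->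
    exists2 x : H, x != 0 & forall g, pi g x = x].

Fact left_translate_subproof (g : G) (x : l2 R G) :
  (fun h => x (g^-1 * h)%g) \in @l2_pred R G.
Proof.
rewrite inE /= /square_summable.
apply: (@summableR_bound _ _ _ (l2_norm2 x)) => s us.
under eq_bigr do rewrite ger0_norm ?normsq_ge0 //.
rewrite -(big_map (fun h => g^-1 * h)%g xpredT (fun h => normsq (x h))).
apply: ler_psumR; first exact: l2_summable.
  by move=> i; exact: normsq_ge0.
by rewrite map_inj_uniq //; exact: mulgI.
Qed.

(* The left regular representation: (lambda_g x) h = x (g^-1 h). *)
Definition left_regular (g : G) (x : l2_hilbert R G) : l2_hilbert R G :=
  L2 (left_translate_subproof g x).

(* The norm closure, in B(l^2(G)), of the span of the lambda_g. *)
Definition reduced_Cstar : set (l2_hilbert R G -> l2_hilbert R G) :=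
  [set T | bounded_op T /\
    forall e : R, 0 < e -> exists s : seq (R[i] * G),
      op_norm_le (fun x => T x - \sum_(p <- s) p.1 *: left_regular p.2 x) e%:C].

Definition exact_group : Prop := exact_Cstar reduced_Cstar.

End GroupProperties.

(* Main.v *)
(* The second nilpotent product P of A and B is a central extension of A x B by
   N = [A, B].  Since (a, b) |-> [a, b] is bimultiplicative, the subgroup
   [A, A][B, B] of P is normal, and it meets N trivially; hence P embeds into
   A x B x K, where K = P / [A, A][B, B] has nilpotency class two and so is
   amenable.  Invariant means are pushed forward along a P-equivariant map
   A x B x K -> P, and normalized positive definite functions vanishing at
   infinity are multiplied.  Exactness is equivalent, by an argument of Ozawa, to
   a form of property A, which also passes to products and to subgroups.  As for
   property (T), the abelianizations of A and B are amenable with property (T),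
   hence finite, so that N is finite; an almost invariant vector is averaged over
   N and projected onto the A-invariant vectors, on which B acts. *)
Require Import Defs.
From HB Require Import structures.
From mathcomp Require Import all_boot all_order all_algebra.
From mathcomp Require Import complex.
From mathcomp Require Import all_classical all_reals all_analysis.
From mathcomp Require Import ring lra.
Set Implicit Arguments.
Unset Strict Implicit.
Unset Printing Implicit Defensive.
Import numFieldNormedType.Exports.
Import Order.TTheory GRing.Theory Num.Theory.
Local Open Scope ring_scope.
Local Open Scope classical_set_scope.

(** * Subgroups and commutators *)

(** The Haagerup property is not stable under extensions, even though P is only a central extension
    of A x B; embedding P into a direct product leaves only products and subgroups to handle. The
    intersection of [A, B] with [A, A][B, B] is trivial because killing one factor retracts P onto
    the other: the retractions read a and b off [np_inl a * np_inr b]. In a group of class two,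
    translations commute up to the center, and those by central elements commute outright; averaging
    along powers therefore gives Reiter's condition for K. Square roots of the resulting densities
    are unit vectors that supply K with positive definite functions and with property A. Property A
    mentions no operators, so it can be carried along an equivariant map, which is hard to do with
    factorizations of the reduced algebra itself. Property (T) does not pass to subgroups and takes
    another route. The pairing [a, b] factors through the abelianizations, whence N is finite. The
    vectors fixed by A are stable under B only once N fixes them as well, since ab = [a, b] ba; this
    is why one averages over N before projecting. *)

Section Morphisms.
Variables (G H : groupType) (f : G -> H).
Local Open Scope group_scope.
Hypothesis fM : {morph f : x y / x * y}.

Lemma morph_one : f 1 = 1.
Proof. by apply: (mulgI (f 1)); rewrite -fM !mulg1. Qed.

Lemma morph_inv x : f x^-1 = (f x)^-1.
Proof. by apply: (mulgI (f x)); rewrite -fM !mulgV morph_one. Qed.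

Lemma morph_comm x y : f (comm x y) = comm (f x) (f y).
Proof. by rewrite /comm !fM !morph_inv. Qed.

Lemma morph_kernel_subgroup : is_subgroup [set x | f x = 1].
Proof.
split=> [|x y /= fx fy]; first exact: morph_one.
by rewrite fM morph_inv fx fy mulgV.
Qed.

Lemma morph_generated1 (S : set G) : S `<=` [set x | f x = 1] ->
  generated S `<=` [set x | f x = 1].
Proof. by move=> Sf x; apply => //; exact: morph_kernel_subgroup. Qed.

End Morphisms.

Section Commutators.
Variable G : groupType.
Local Open Scope group_scope.
Implicit Types x y z : G.

Lemma comm1P x y : comm x y = 1 <-> x * y = y * x.
Proof.
rewrite /comm; split=> [e|->]; last by rewrite mulgK mulgV.
by apply/eqP; rewrite -divg_eq1; apply/eqP; rewrite invgM mulgA.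
Qed.

Lemma commE x y : x * y = comm x y * (y * x).
Proof. by rewrite /comm !mulgA !mulgVK. Qed.

Lemma comm_inv x y : (comm x y)^-1 = comm y x.
Proof. by rewrite /comm !invgM !invgK !mulgA. Qed.

Definition central : set G := [set z | forall x, z * x = x * z].

Lemma central_subgroup : is_subgroup central.
Proof.
split=> [x|y z cy cz x]; first by rewrite mul1g mulg1.
rewrite -mulgA; have -> : z^-1 * x = x * z^-1.
  by apply: (mulgI z); rewrite mulVKg mulgA cz mulgK.
by rewrite !mulgA cy.
Qed.

(** From [xy, z] = x [y, z] x^-1 [x, z], where centrality removes the conjugation by x. *)
Lemma commMl x y z : central (comm y z) -> comm (x * y) z = comm x z * comm y z.
Proof.
move=> cyz; rewrite -[RHS]cyz.
transitivity (x * comm y z * z * x^-1 * z^-1).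
  by rewrite /comm !invgM !mulgA mulgVK.
by rewrite -cyz {2}/comm !mulgA.
Qed.

Lemma commMr x y z : central (comm x z) -> comm x (y * z) = comm x z * comm x y.
Proof.
move=> cxz; rewrite -comm_inv commMl.
  by rewrite invgM !comm_inv.
by rewrite -comm_inv; exact: subgroupV central_subgroup cxz.
Qed.

Definition derived : set G := generated [set z | exists x y, z = comm x y].

Lemma derived_normal x y : derived y -> derived (x * y * x^-1).
Proof.
have -> : derived = generated [set z | exists p q, setT q /\ z = comm p q].
  congr generated; apply/seteqP; split=> z /=.
    by move=> [p [q ->]]; exists p, q.
  by move=> [p [q [_ ->]]]; exists p, q.
exact: (@comm_generated_normal G setT x y).
Qed.

Definition derivedSubgroup : normalSubgroup G :=
  @NormalSubgroup G derived (@generated_subgroup G _) derived_normal.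

End Commutators.

Section QuotientMorphisms.
Variables (G : groupType) (N : normalSubgroup G).
Local Open Scope group_scope.
Local Open Scope quotient_scope.

Definition coset_pi (x : G) : quotient_group N := \pi_(quotient_group N) x.

Lemma coset_piM : {morph coset_pi : x y / x * y}.
Proof. by move=> x y; rewrite /coset_pi -quot_mulE. Qed.

Lemma coset_pi_surj (c : quotient_group N) : exists x, c = coset_pi x.
Proof. by exists (repr c); rewrite /coset_pi reprK. Qed.

Lemma coset_pi1 x : coset_pi x = 1 <-> N x.
Proof.
rewrite -(morph_one coset_piM); split=> [/esym/coset_eqP|Nx].
  by rewrite invg1 mul1g.
by apply/esym/coset_eqP; rewrite invg1 mul1g.
Qed.

Lemma quotient_lift (H : groupType) (f : G -> H) : {morph f : x y / x * y} ->
  N `<=` [set x | f x = 1] ->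
  exists2 h : quotient_group N -> H, {morph h : x y / x * y}
    & forall x, h (coset_pi x) = f x.
Proof.
move=> fM fN; pose h (c : quotient_group N) := f (repr c).
have hE x : h (coset_pi x) = f x.
  have /fN/= := coset_repr N x; rewrite fM (morph_inv fM) => /mulg1_eq.
  by rewrite invgK.
exists h => // c d; have [x ->] := coset_pi_surj c; have [y ->] := coset_pi_surj d.
by rewrite -coset_piM !hE fM.
Qed.

End QuotientMorphisms.

(** * Structure of the second nilpotent product *)

Section FreeProductMorphisms.
Variables A B : groupType.
Local Open Scope group_scope.
Local Open Scope quotient_scope.
Let F := free_product A B.
Let ql (a : A) : F := fp_inl B a.
Let qr (b : B) : F := fp_inr A b.

Lemma fp_inlM : {morph ql : x y / x * y}.
Proof.
move=> x y; apply/esym; rewrite /ql /fp_inl [LHS]fp_mulE.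
by apply/word_eqP; exact: we_mull.
Qed.

Lemma fp_inrM : {morph qr : x y / x * y}.
Proof.
move=> x y; apply/esym; rewrite /qr /fp_inr [LHS]fp_mulE.
by apply/word_eqP; exact: we_mulr.
Qed.

Lemma fp_ind (S : set F) : S 1 -> (forall a x, S x -> S (ql a * x)) ->
  (forall b x, S x -> S (qr b * x)) -> forall x, S x.
Proof.
move=> S1 SA SB x; rewrite -[x]reprK; elim: (repr x) => [//|l w IHw].
have e (v : seq (A + B)) : \pi_F (l :: v) = \pi_F [:: l] * \pi_F v.
  by apply/esym; rewrite [LHS]fp_mulE.
by rewrite e; case: l => [a|b] in e *; [exact: SA|exact: SB].
Qed.

Lemma fp_lift (K : groupType) (f : A -> K) (g : B -> K) :
  {morph f : x y / x * y} -> {morph g : x y / x * y} ->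
  exists h : F -> K, [/\ {morph h : x y / x * y},
    forall a, h (ql a) = f a & forall b, h (qr b) = g b].
Proof.
move=> fM gM; pose l1 (l : A + B) : K := match l with inl a => f a | inr b => g b end.
pose ev (w : seq (A + B)) : K := foldr (fun l k => l1 l * k) 1 w.
have ev_cat u v : ev (u ++ v) = ev u * ev v.
  by elim: u => [|l u IHu] /=; rewrite ?mul1g // IHu mulgA.
have evE w w' : word_equiv w w' -> ev w = ev w'.
  elim=> {w w'} //=.
  - by move=> w w' w'' _ -> _ ->.
  - by move=> u v w w' _ e; rewrite !ev_cat e.
  - by rewrite (morph_one fM) mul1g.
  - by rewrite (morph_one gM) mul1g.
  - by move=> a a'; rewrite fM !mulg1.
  - by move=> b b'; rewrite gM !mulg1.
pose h (x : F) := ev (repr x).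
have hE w : h (\pi_F w) = ev w by apply: evE; exact: word_repr.
exists h; split=> [x y|a|b]; last 2 first.
- by rewrite hE /= mulg1.
- by rewrite hE /= mulg1.
by rewrite -[x]reprK -[y]reprK [_ * _]fp_mulE !hE ev_cat.
Qed.

End FreeProductMorphisms.

Section NilpotentProduct.
Variables A B : groupType.
Local Open Scope group_scope.
Local Open Scope quotient_scope.
Let P := nilpotent_product2 A B.
Let T := triple_comm A B.

Definition np_inl (a : A) : P := coset_pi T (fp_inl B a).
Definition np_inr (b : B) : P := coset_pi T (fp_inr A b).

Lemma np_inlM : {morph np_inl : x y / x * y}.
Proof. by move=> x y; rewrite /np_inl fp_inlM coset_piM. Qed.

Lemma np_inrM : {morph np_inr : x y / x * y}.
Proof. by move=> x y; rewrite /np_inr fp_inrM coset_piM. Qed.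

Lemma np_ind (S : set P) : S 1 -> (forall a x, S x -> S (np_inl a * x)) ->
  (forall b x, S x -> S (np_inr b * x)) -> forall x, S x.
Proof.
move=> S1 SA SB c; have [x ->] := coset_pi_surj c; move: x; apply: (@fp_ind A B [set x | S (coset_pi T x)]) => /= [|a x Sx|b x Sx].
- by rewrite (morph_one (@coset_piM _ T)).
- by rewrite coset_piM; exact: SA.
- by rewrite coset_piM; exact: SB.
Qed.

(** The universal property for commuting pairs, where [A, B] itself is killed. It serves to build
    the retractions of P onto its two factors. *)
Lemma np_lift (K : groupType) (f : A -> K) (g : B -> K) :
  {morph f : x y / x * y} -> {morph g : x y / x * y} ->
  (forall a b, f a * g b = g b * f a) ->
  exists h : P -> K, [/\ {morph h : x y / x * y},
    forall a, h (np_inl a) = f a & forall b, h (np_inr b) = g b].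
Proof.
move=> fM gM fg; have [h [hM hl hr]] := fp_lift fM gM.
have hc : @cross_comm A B `<=` [set x | h x = 1].
  apply: morph_generated1 => // _ [a [b ->]] /=.
  by rewrite morph_comm // hl hr; apply/comm1P.
have hT : T `<=` [set x | h x = 1].
  apply: morph_generated1 => // _ [p [q [/hc/= hq ->]]] /=.
  by rewrite morph_comm // hq; apply/comm1P; rewrite mulg1 mul1g.
have [k kM kE] := quotient_lift hM hT.
by exists k; split=> // x; rewrite /np_inl /np_inr kE.
Qed.

Lemma np_comm_central a b : central (comm (np_inl a) (np_inr b)).
Proof.
move=> c; have [x ->] := coset_pi_surj c; apply/esym/comm1P.
rewrite /np_inl /np_inr -(morph_comm (@coset_piM _ T) (fp_inl B a)) -(morph_comm (@coset_piM _ T) x); apply/coset_pi1.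
apply: subset_generated; exists x, (comm (fp_inl B a) (fp_inr A b)); split=> //.
by apply: subset_generated; exists a, b.
Qed.

(* This is [A, B], the kernel of the projection onto A x B. *)
Definition np_center : set P :=
  generated [set z | exists a b, z = comm (np_inl a) (np_inr b)].

Lemma np_center_subgroup : is_subgroup np_center.
Proof. exact: generated_subgroup. Qed.

Lemma np_center_central : np_center `<=` @central P.
Proof.
move=> x; apply; first exact: central_subgroup.
by move=> _ [a [b ->]]; exact: np_comm_central.
Qed.

(** Moving [np_inr b'] past [np_inl a] costs the commutator [b', a], which is central and is
    absorbed by n. *)
Lemma np_decomp (x : P) : exists a b n, np_center n /\ x = np_inl a * np_inr b * n.
Proof.
move: x; apply: np_ind => [|a' x [a [b [n [Nn ->]]]]|b' x [a [b [n [Nn ->]]]]].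
- exists 1, 1, 1; split; first exact: subgroup1 np_center_subgroup.
  by rewrite (morph_one np_inlM) (morph_one np_inrM) !mulg1.
- by exists (a' * a), b, n; rewrite np_inlM !mulgA.
- have Nc : np_center (comm (np_inr b') (np_inl a)).
    rewrite -comm_inv; apply: (subgroupV np_center_subgroup).
    by apply: subset_generated; exists a, b'.
  exists a, (b' * b), (comm (np_inr b') (np_inl a) * n); split.
    exact: subgroupM np_center_subgroup Nc Nn.
  have := commE (np_inr b') (np_inl a); move: (comm _ _) Nc => c Nc e.
  rewrite np_inrM !mulgA e.
  by rewrite -(np_center_central Nc (_ * _ * _)) !mulgA.
Qed.

End NilpotentProduct.

Section NilpotentProductStructure.
Variables A B : groupType.
Local Open Scope group_scope.
Local Open Scope quotient_scope.
Let P := nilpotent_product2 A B.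
Let iA : A -> P := @np_inl A B.
Let iB : B -> P := @np_inr A B.
Let iAM : {morph iA : x y / x * y} := @np_inlM A B.
Let iBM : {morph iB : x y / x * y} := @np_inrM A B.

Lemma np_fst : exists h : P -> A, [/\ {morph h : x y / x * y},
  forall a, h (iA a) = a & forall b, h (iB b) = 1].
Proof.
apply: (@np_lift A B A id (fun=> 1)) => // [x y|a b]; first by rewrite mulg1.
by rewrite mulg1 mul1g.
Qed.

Lemma np_snd : exists h : P -> B, [/\ {morph h : x y / x * y},
  forall a, h (iA a) = 1 & forall b, h (iB b) = b].
Proof.
apply: (@np_lift A B B (fun=> 1) id) => // [x y|a b]; first by rewrite mulg1.
by rewrite mulg1 mul1g.
Qed.

Lemma np_comml_morph b : {morph (fun a => comm (iA a) (iB b)) : x y / x * y}.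
Proof. by move=> x y; rewrite iAM commMl //; exact: np_comm_central. Qed.

Lemma np_commr_morph a : {morph (fun b => comm (iA a) (iB b)) : x y / x * y}.
Proof.
move=> x y; rewrite iBM commMr; last exact: np_comm_central.
exact: np_comm_central.
Qed.

(** The morphism a |-> [a, b] has central values, so it kills all commutators of A. With its mirror
    image below, the pairing factors through the abelianizations. *)
Lemma np_comm_derivedl a b : derived a -> iA a * iB b = iB b * iA a.
Proof.
move=> da; apply/comm1P; move: a da.
apply: (morph_generated1 (np_comml_morph b)) => _ [x [y ->]] /=.
by rewrite (morph_comm (np_comml_morph b)); apply/comm1P; exact: np_comm_central.
Qed.

Lemma np_comm_derivedr a b : derived b -> iA a * iB b = iB b * iA a.
Proof.
move=> db; apply/comm1P; move: b db.
apply: (morph_generated1 (np_commr_morph a)) => _ [x [y ->]] /=.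
by rewrite (morph_comm (np_commr_morph a)); apply/comm1P; exact: np_comm_central.
Qed.

Definition np_derived_factors : set P :=
  [set x | exists a b, [/\ derived a, derived b & x = iA a * iB b]].

Lemma np_derived_factors_subgroup : is_subgroup np_derived_factors.
Proof.
have sA := generated_subgroup [set z : A | exists x y, z = comm x y].
have sB := generated_subgroup [set z : B | exists x y, z = comm x y].
split=> [|_ _ [a [b [da db ->]]] [a' [b' [da' db' ->]]]].
  by exists 1, 1; split; [exact: subgroup1|exact: subgroup1|
    rewrite (morph_one iAM) (morph_one iBM) mulg1].
exists (a * a'^-1), (b * b'^-1); split; [exact: sA.2|exact: sB.2|].
rewrite iAM iBM (morph_inv iAM) (morph_inv iBM) invgM -!mulgA; congr (_ * _).
rewrite -(morph_inv iAM) -(morph_inv iBM) mulgA -iBM.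
by rewrite np_comm_derivedl //; exact: subgroupV sA da'.
Qed.

(** Conjugation by an element of A preserves [A, A] and fixes [B, B] pointwise, since derived
    elements of B commute with A; symmetrically for B. *)
Lemma np_derived_factors_normal x y :
  np_derived_factors y -> np_derived_factors (x * y * x^-1).
Proof.
move: x y; apply: (@np_ind A B [set x | forall y, _ y -> _ (x * y * x^-1)]) => /=.
- by move=> y; rewrite mul1g invg1 mulg1.
- move=> c x IHx y /IHx[a [b [da db]]].
  rewrite invgM !mulgA -(mulgA _ x) -(mulgA _ (x * y)) => ->.
  exists (c * a * c^-1), b; split=> //; first exact: derived_normal.
  rewrite !iAM (morph_inv iAM) -!mulgA; do 2 congr (_ * _).
  by rewrite -(morph_inv iAM) np_comm_derivedr.
- move=> c x IHx y /IHx[a [b [da db]]].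
  rewrite invgM !mulgA -(mulgA _ x) -(mulgA _ (x * y)) => ->.
  exists a, (c * b * c^-1); split=> //; first exact: derived_normal.
  by rewrite !iBM (morph_inv iBM) !mulgA np_comm_derivedl.
Qed.

Definition np_derived_normal : normalSubgroup P :=
  NormalSubgroup np_derived_factors_subgroup np_derived_factors_normal.

(** In the quotient the generators from A commute with one another, as do those from B, and mixed
    commutators are already central in P. Two inductions on words, by [commMl] and [commMr], extend
    centrality to all commutators. *)
Lemma np_class2_quotient (x y : quotient_group np_derived_normal) :
  central (comm x y).
Proof.
set D := np_derived_normal in x y *; pose q := @coset_pi P D.
have qM : {morph q : x y / x * y} := @coset_piM P D.
have cq z : central z -> central (q z).
  by move=> cz c; have [u ->] := coset_pi_surj c; rewrite -/(q _) -!qM cz.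
have cA a a' : central (comm (q (iA a)) (q (iA a'))).
  rewrite -(morph_comm qM) -(morph_comm iAM).
  suff -> : q (iA (comm a a')) = 1 by exact: subgroup1 (@central_subgroup _).
  apply/coset_pi1; exists (comm a a'), 1; split.
  - by apply: subset_generated; exists a, a'.
  - exact: subgroup1 (@generated_subgroup _ _).
  - by rewrite (morph_one iBM) mulg1.
have cB b b' : central (comm (q (iB b)) (q (iB b'))).
  rewrite -(morph_comm qM) -(morph_comm iBM).
  suff -> : q (iB (comm b b')) = 1 by exact: subgroup1 (@central_subgroup _).
  apply/coset_pi1; exists 1, (comm b b'); split.
  - exact: subgroup1 (@generated_subgroup _ _).
  - by apply: subset_generated; exists b, b'.
  - by rewrite (morph_one iAM) mul1g.
have cAB a b : central (comm (q (iA a)) (q (iB b))).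
  by rewrite -(morph_comm qM); apply: cq; exact: np_comm_central.
have cBA a b : central (comm (q (iB b)) (q (iA a))).
  by rewrite -comm_inv; exact: subgroupV (@central_subgroup _) (cAB _ _).
have c1l z : central (comm (q 1) z).
  rewrite (morph_one qM); suff -> : comm 1 z = 1 by exact: subgroup1 (@central_subgroup _).
  by apply/comm1P; rewrite mulg1 mul1g.
have c1r z : central (comm z (q 1)).
  by rewrite -comm_inv; exact: subgroupV (@central_subgroup _) (c1l _).
have cM z t : central z -> central t -> central (z * t).
  exact: subgroupM (@central_subgroup _).
have [u ->] := coset_pi_surj x; have [v ->] := coset_pi_surj y.
move: u; apply: (@np_ind A B [set u | central (comm (q u) (q v))]) => /= [|a u cu|b u cu].
- exact: c1l.
- rewrite qM commMl //; apply: (cM) => //; move: (v).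
  apply: (@np_ind A B [set v | central (comm (q (iA a)) (q v))]) => /= [|a' w cw|b w cw] //.
  + by rewrite qM commMr //; exact: cM.
  + by rewrite qM commMr //; exact: cM.
- rewrite qM commMl //; apply: (cM) => //; move: (v).
  apply: (@np_ind A B [set v | central (comm (q (iB b)) (q v))]) => /= [|a' w cw|b' w cw] //.
  + by rewrite qM commMr //; exact: cM.
  + by rewrite qM commMr //; exact: cM.
Qed.

(* [A, B] meets the normal subgroup [A, A][B, B] trivially, so that the second
   nilpotent product embeds into the product of A, B and a group of nilpotency
   class two. *)
Lemma np_embedding : exists (K : groupType) (h : P -> A) (k : P -> B) (l : P -> K),
  [/\ [/\ {morph h : x y / x * y}, {morph k : x y / x * y} & {morph l : x y / x * y}],
      forall x y : K, central (comm x y),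
      forall c, exists x, c = l x
    & forall x, h x = 1 -> k x = 1 -> l x = 1 -> x = 1].
Proof.
have [h [hM hA hB]] := np_fst; have [k [kM kA kB]] := np_snd.
exists (quotient_group np_derived_normal), h, k, (@coset_pi _ _); split.
- by split=> //; exact: coset_piM.
- exact: np_class2_quotient.
- exact: coset_pi_surj.
move=> x hx kx /coset_pi1[a [b [_ _ xE]]].
move: hx kx; rewrite xE hM kM hA hB kA kB mulg1 mul1g => -> ->.
by rewrite (morph_one iAM) (morph_one iBM) mulg1.
Qed.

Lemma np_countable : countable [set: A] -> countable [set: B] -> countable [set: P].
Proof.
move=> /countable_injP[f fI] /countable_injP[g gI].
pose e (l : A + B) : nat + nat := match l with inl a => inl (f a) | inr b => inr (g b) end.
have eI : injective e.
  move=> [a|b] [a'|b'] //= [].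
    by move=> /(fI _ _ (mem_setT _) (mem_setT _)) ->.
  by move=> /(gI _ _ (mem_setT _) (mem_setT _)) ->.
apply/countable_injP.
exists (fun x : P => pickle (map e (repr (repr x : free_product A B)))).
move=> x y _ _ /(pcan_inj pickleK)/(inj_map eI) xy.
rewrite -[x]reprK -[y]reprK; congr (\pi_P _).
by rewrite -[repr x]reprK -[repr y]reprK xy.
Qed.

End NilpotentProductStructure.

Lemma countable_surj (T U : Type) (f : T -> U) : (forall u, exists t, u = f t) ->
  countable [set: T] -> countable [set: U].
Proof.
move=> /choice[g gP] /countable_injP[enc encI].
apply/countable_injP; exists (enc \o g) => x y _ _ /= /encI.
by rewrite !inE => /(_ I I) e; rewrite [x]gP [y]gP e.
Qed.

(** The code [enc] makes each t belong to all but finitely many [E n], which is the form that limits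
    in n require. *)
Lemma countable_exhaustion (T : eqType) : countable [set: T] ->
  exists (E : nat -> seq T) (enc : T -> nat), forall n t, (enc t <= n)%N -> t \in E n.
Proof.
move=> /countable_injP[enc encI].
have /choice[E EP] (n : nat) : exists E : seq T, forall t, (enc t <= n)%N -> t \in E.
  have [|E EE] := (finite_seqP (enc @^-1` `I_n.+1)).1.
    apply: finite_preimage; last exact: finite_II.
    by move=> x y _ _; apply: encI; rewrite inE.
  exists E => t tn; suff : (enc @^-1` `I_n.+1) t by rewrite EE.
  by rewrite /= ltnS.
by exists E, enc.
Qed.

(** Each orbit gets a base point depending on the orbit alone, since [xget] is applied to the set
    [O x]. By freeness a single group element carries it to x, and uniqueness makes this element
    equivariant in x. *)
Lemma equivariant_retraction (G : groupType) (X : choiceType) (act : G -> X -> X) :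
  X -> (forall x, act 1%g x = x) ->
  (forall g h x, act (g * h)%g x = act g (act h x)) ->
  (forall g x, act g x = x -> g = 1%g) ->
  exists rho : X -> G, forall g x, rho (act g x) = (g * rho x)%g.
Proof.
move=> x0 act1 actM free; pose O x := [set y | exists g, y = act g x].
pose c x := xget x0 (O x).
have Oact g x : O (act g x) = O x.
  apply/seteqP; split=> y /= [h ->]; first by exists (h * g)%g; rewrite actM.
  by exists (h * g^-1)%g; rewrite actM -(actM g^-1%g) mulVg act1.
have cP x : exists g, x = act g (c x).
  have : O x (c x) by apply: (@xgetPex _ x0 (O x)); exists x, 1%g; rewrite act1.
  by move=> [g ->]; exists g^-1%g; rewrite -actM mulVg act1.
pose rho x := projT1 (cid (cP x)).
have rhoP x : x = act (rho x) (c x) by rewrite /rho; case: cid.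
exists rho => g x.
have e : act (rho (act g x)) (c x) = act (g * rho x)%g (c x).
  by rewrite actM -rhoP {2}[act g x]rhoP /c Oact.
have /free/eqP : act ((g * rho x)^-1 * rho (act g x))%g (c x) = c x.
  by rewrite actM e -actM mulVg act1.
by rewrite mulg_eq1 => /eqP/invg_inj ->.
Qed.

(** * Reiter's condition for groups of nilpotency class two *)

Lemma ler_norm_sumM_in (R : realType) (T : eqType) (F : T -> R) (r : seq T) (c : R) :
  (forall x, x \in r -> `|F x| <= c) -> `|\sum_(x <- r) F x| <= c * (size r)%:R.
Proof.
move=> Fc; apply: (le_trans (ler_norm_sum _ _ _)).
rewrite big_seq; apply: (le_trans (ler_sum _ Fc)).
by rewrite -big_seq big_const_seq count_predT iter_addr addr0 mulr_natr.
Qed.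

Lemma ler_norm_sumM (R : realType) (T : eqType) (F : T -> R) (r : seq T) (c : R) :
  (forall x, `|F x| <= c) -> `|\sum_(x <- r) F x| <= c * (size r)%:R.
Proof. by move=> Fc; apply: ler_norm_sumM_in. Qed.

Section Reiter.
Variables (R : realType) (G : groupType).
Implicit Types (f : G -> R) (E s t : seq G) (g x : G).

(* The averages over the finite multiset s are almost left invariant: the dual
   form of Reiter's condition for the uniform probability on s. *)
Definition reiter_seq E (e : R) (FF : set (G -> R)) s : Prop :=
  s != [::] /\ forall g f, g \in E -> FF f -> (forall x, `|f x| <= 1) ->
  `|\sum_(x <- s) (f (g * x)%g - f x)| <= e * (size s)%:R.

Definition reiter : Prop :=
  forall E (e : R), 0 < e -> exists s, reiter_seq E e setT s.

(** Folner's construction for abelian groups: for each new element g, s is replaced by its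
    translates by g^k, k < m. Restricting to C and [FF] allows two uses on a class-two group: on
    functions invariant under the center, and on the center itself. *)
Lemma reiter_commuting (C : set G) (FF : set (G -> R)) :
  C 1%g -> (forall g h, C g -> C h -> C (g * h)%g) ->
  (forall f g, FF f -> C g -> FF (fun x => f (g * x)%g)) ->
  (forall f g h x, FF f -> C g -> C h -> f (g * (h * x))%g = f (h * (g * x))%g) ->
  forall E (e : R), {in E, forall g, C g} -> 0 < e ->
  exists s, {in s, forall x, C x} /\ reiter_seq E e FF s.
Proof.
move=> C1 CM FM FC E e CE e0; elim: E CE => [|g E IHE] CE.
  by exists [:: 1%g]; split=> [x|]; [rewrite inE => /eqP ->|].
have [x xE|s [Cs [s0 sP]]] := IHE; first by apply: CE; rewrite inE xE orbT.
have Cg : C g by apply: CE; rewrite mem_head.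
have CgX k : C (g ^+ k)%g.
  by elim: k => [|k IHk]; rewrite ?expg0 // expgS; exact: CM.
(* For g itself the sum over k telescopes to f(g^m x) - f(x), at most 2 for each x in s; this m
   makes 2 at most e m. *)
have [m m0 m_ge] : exists2 m, (0 < m)%N & 2 <= e * m%:R.
  exists (Num.truncn (2 / e)).+1 => //.
  have : 2 / e <= (Num.truncn (2 / e)).+1%:R by apply: ltW; exact: truncnS_gt.
  by rewrite ler_pdivrMr // mulrC.
exists [seq (g ^+ k * x)%g | k <- iota 0 m, x <- s]; split.
  by move=> _ /allpairsP[[k x] /= [_ xs ->]]; apply: CM => //; exact: Cs.
split; first by case: (m) m0 => // ? _; case: (s) s0.
move=> h f hE Ff f1.
rewrite big_allpairs_dep size_allpairs size_iota natrM mulrA.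
move: hE; rewrite inE => /predU1P[->|hE].
  rewrite exchange_big /= (eq_bigr (fun x => f (g ^+ m * x)%g - f x)) => [|x _].
    apply: le_trans (ler_norm_sumM _ (c := 2) _) _ => [x|].
      by apply: le_trans (ler_normB _ _) _; have := f1 x; have := f1 (g ^+ m * x)%g; lra.
    by apply: ler_wpM2r.
  rewrite -{1}[m]subn0 -[iota 0 (m - 0)]/(index_iota 0 m).
  under eq_bigr do rewrite mulgA -expgS.
  by rewrite (telescope_sumr (fun k => f (g ^+ k * x)%g)) // expg0 mul1g.
(* For the older elements h, the function f(g^k -) stays in [FF] and g^k commutes past h, so the
   bound for s applies for each k separately. *)
have -> : e * m%:R * (size s)%:R = (e * (size s)%:R) * (size (iota 0 m))%:R.
  by rewrite size_iota mulrAC.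
apply: ler_norm_sumM => k.
have := sP h _ hE (FM _ _ Ff (CgX k)) (fun x => f1 _).
congr (_ <= _); congr `| _ |; apply: eq_bigr => x _.
by rewrite (FC f h) //; apply: CE; rewrite inE hE orbT.
Qed.

Definition centralSubgroup : normalSubgroup G.
Proof.
apply: (@NormalSubgroup G (@central G) (@central_subgroup G)) => x y cy.
by rewrite -cy mulgK.
Defined.

(** On functions invariant under the center, the translations by g and h commute because gh and hg
    differ by a central commutator. A multiset s for these functions, lifted by a section, is
    multiplied by a multiset t of the center. *)
Lemma reiter_class2 : (forall x y : G, central (comm x y)) -> reiter.
Proof.
move=> c2 E e e0; have e20 : 0 < e / 2 by rewrite divr_gt0.
pose Z := centralSubgroup.
pose FF := [set f : G -> R | forall x z, central z -> f (x * z)%g = f x].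
have FM f g : FF f -> setT g -> FF (fun x => f (g * x)%g).
  by move=> Ff _ x z cz; rewrite /= mulgA [LHS]Ff.
have FC f g h x : FF f -> setT g -> setT h -> f (g * (h * x))%g = f (h * (g * x))%g.
  move=> Ff _ _; have -> : (g * (h * x) = h * (g * x) * comm g h)%g.
    by move: (comm g h) (c2 g h) (commE g h) => c cc ce; rewrite -cc !mulgA ce !mulgA.
  by rewrite Ff //; exact: c2.
have [s [_ [s0 sP]]] := @reiter_commuting setT FF I (fun _ _ _ _ => I) FM FC
  E (e / 2) (fun _ _ => I) e20.
(* A section of the quotient by the center; [cc] is its cocycle, with central values. *)
pose sg x := repr (coset_pi Z x).
have sgP x : central ((sg x)^-1 * x)%g by exact: (coset_repr Z x).
have sgE x z : central z -> sg (x * z)%g = sg x.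
  by move=> cz; rewrite /sg coset_piM (coset_pi1 Z z).2 ?mulg1.
pose cc g x := ((sg (g * x))^-1 * (g * sg x))%g.
have ccP g x : central (cc g x).
  have -> : cc g x = ((sg (g * x))^-1 * (g * x) * ((sg x)^-1 * x)^-1)%g.
    by rewrite /cc invgM invgK !mulgA mulgK.
  exact: (@central_subgroup G).2.
have zM f g h x : setT f -> central g -> central h ->
    f (g * (h * x))%g = f (h * (g * x))%g :> R.
  by move=> _ cg _; rewrite !mulgA cg.
(* Only finitely many cocycle values occur for E and s, so t can be chosen after s to be almost
   invariant under all of them. *)
have zE : {in [seq cc g x | g <- E, x <- s], forall z, central z}.
  by move=> _ /allpairsP[[g x] /= [_ _ ->]].
have [t [_ [t0 tP]]] := @reiter_commuting (@central G) setT
  (subgroup1 (@central_subgroup G)) (fun _ _ => subgroupM (@central_subgroup G))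
  (fun _ _ _ _ => I) zM _ (e / 2) zE e20.
have szt : 0 < (size t)%:R :> R by rewrite ltr0n lt0n size_eq0.
exists [seq (sg x * n)%g | x <- s, n <- t]; split.
  by case: (s) s0 => // x s' _; case: (t) t0.
move=> g f gE _ f1; rewrite big_allpairs_dep size_allpairs natrM.
pose h x := (\sum_(n <- t) f (sg x * n)%g) / (size t)%:R.
have h1 x : `|h x| <= 1.
  rewrite normrM normfV [X in _ / X]ger0_norm ?ler0n // ler_pdivrMr //.
  by apply: ler_norm_sumM.
have Fh : FF h by move=> x z cz; rewrite /h sgE.
have := sP g h gE Fh h1.
have : `|\sum_(x <- s) \sum_(n <- t) (f (sg (g * x) * (cc g x * n))%g - f (sg (g * x)%g * n)%g)|
    <= e / 2 * (size t)%:R * (size s)%:R.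
  apply: ler_norm_sumM_in => x xs.
  apply: (tP (cc g x) (fun y => f (sg (g * x) * y)%g)) => //.
  by apply/allpairsP; exists (g, x).
have -> : \sum_(x <- s) (h (g * x)%g - h x) =
  (\sum_(x <- s) \sum_(n <- t) (f (sg (g * x) * n)%g - f (sg x * n)%g)) / (size t)%:R.
  by rewrite mulr_suml; apply: eq_bigr => x _; rewrite big_split /= sumrN mulrBl.
rewrite normrM normfV [`|_%:R|]ger0_norm ?ler0n // ler_pdivrMr //.
(* Since g sg(x) = sg(gx) cc(g, x), the first sum moves only the cocycle, over t, and the second
   only g, over s; each costs e / 2. *)
have -> : \sum_(x <- s) \sum_(n <- t) (f (g * (sg x * n))%g - f (sg x * n)%g) =
  (\sum_(x <- s) \sum_(n <- t) (f (sg (g * x) * (cc g x * n))%g - f (sg (g * x)%g * n)%g))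
  + (\sum_(x <- s) \sum_(n <- t) (f (sg (g * x) * n)%g - f (sg x * n)%g)).
  rewrite -big_split; apply: eq_bigr => x _ /=; rewrite -big_split.
  apply: eq_bigr => n _ /=; rewrite /cc !mulgA mulgV mul1g; ring.
move: (\sum_(x <- s) _) (\sum_(x <- s) _) => u v hu hv.
apply: le_trans (ler_normD _ _) _; nra.
Qed.

End Reiter.

(** * From Reiter's condition to almost invariant vectors and invariant means *)

Lemma fmap_ultra (T V : Type) (f : T -> V) (F : set_system T) :
  UltraFilter F -> UltraFilter (f @ F).
Proof.
move=> UF; split; first exact: fmap_proper_filter.
move=> H HF sub; apply/seteqP; split=> [X HX|]; last exact: sub.
have [//|FX] := in_ultra_setVsetC (f @^-1` X) UF.
have HXC : H (~` X) by apply: sub.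
by case: (@filter_not_empty _ H HF); rewrite -(setICr X); exact: filterI.
Qed.

Section AlmostInvariantVectors.
Variables (R : realType) (G : groupType).

Lemma sum_count (t u : seq G) (F : G -> R) : uniq u -> {subset t <= u} ->
  \sum_(x <- t) F x = \sum_(y <- u) (count_mem y t)%:R * F y.
Proof.
move=> uu; elim: t => [|z t IHt] tu.
  by rewrite big_nil big1 // => y _; rewrite mul0r.
rewrite big_cons IHt => [|x xt]; last by apply: tu; rewrite inE xt orbT.
have zu : z \in u by apply: tu; rewrite mem_head.
transitivity (\sum_(y <- u) ((z == y)%:R * F y + (count_mem y t)%:R * F y)).
  rewrite big_split /=; congr (_ + _).
  rewrite (bigD1_seq z) //= eqxx mul1r big1 ?addr0 // => y yz.
  by rewrite eq_sym (negbTE yz) mul0r.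
by apply: eq_bigr => y _; rewrite -mulrDl -natrD.
Qed.

(** Turns an l^1 estimate for densities into an l^2 estimate for their square roots: |a - b| <= a +
    b gives (a - b)^2 <= |a^2 - b^2|. *)
Lemma sqr_sqrtB_le (u v : R) : 0 <= u -> 0 <= v ->
  (Num.sqrt u - Num.sqrt v) ^+ 2 <= `|u - v|.
Proof.
move=> u0 v0; rewrite -{2}(sqr_sqrtr u0) -{2}(sqr_sqrtr v0).
have := sqrtr_ge0 u; have := sqrtr_ge0 v.
move: (Num.sqrt u) (Num.sqrt v) => a b b0 a0.
have -> : a ^+ 2 - b ^+ 2 = (a - b) * (a + b) by ring.
rewrite normrM (ger0_norm (addr_ge0 a0 b0)) -real_normK ?num_real // expr2.
apply: ler_wpM2l => //; rewrite ler_norml; lra.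
Qed.

Lemma eq_big_supp (s t : seq G) (F : G -> R) : uniq s -> uniq t ->
  (forall x, F x != 0 -> x \in s) -> (forall x, F x != 0 -> x \in t) ->
  \sum_(x <- s) F x = \sum_(x <- t) F x.
Proof.
move=> us ut Fs Ft; rewrite [LHS](bigID (fun x => x \in t)) /=.
rewrite [RHS](bigID (fun x => x \in s)) /=.
rewrite [X in _ + X]big1 => [|x]; last by apply: contraNeq => /Ft.
rewrite [X in _ = _ + X]big1 => [|x]; last by apply: contraNeq => /Fs.
rewrite !addr0 -big_filter -[RHS]big_filter; apply: perm_big; apply: uniq_perm.
- exact: filter_uniq.
- exact: filter_uniq.
- by move=> x; rewrite !mem_filter andbC.
Qed.

(** The last sum is the inner product of a unit vector with a translate, so the bound says that
    their squared distance is at most 2e. *)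
Definition almost_invariant_vectors : Prop :=
  forall (E : seq G) (e : R), 0 < e -> exists (s : seq G) (a : G -> R),
  [/\ uniq s, forall x, 0 <= a x, forall x, a x != 0 -> x \in s,
      \sum_(x <- s) a x ^+ 2 = 1
    & forall g, g \in E -> 1 - e <= \sum_(x <- s) a x * a (g * x)%g].

(** The vector is the square root of the density c of the multiset t; the dual form of Reiter's
    condition bounds the l^1 distance of c from its translates. *)
Lemma reiter_almost_invariant : reiter R G -> almost_invariant_vectors.
Proof.
move=> rG E e e0; have [t [t0 tP]] := rG E e e0.
have szt : 0 < (size t)%:R :> R by rewrite ltr0n lt0n size_eq0.
pose c x : R := (count_mem x t)%:R / (size t)%:R.
have c0 x : 0 <= c x by rewrite divr_ge0 // ler0n.
have ct x : c x != 0 -> x \in t.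
  apply: contraNT => xt; apply/eqP; rewrite /c.
  by have /count_memPn -> := xt; rewrite mul0r.
pose a x := Num.sqrt (c x).
have at_ x : a x != 0 -> x \in undup t.
  rewrite mem_undup => ax; apply: ct; apply: contra_neq ax.
  by rewrite /a => ->; rewrite sqrtr0.
have a2 x : a x ^+ 2 = c x by rewrite sqr_sqrtr.
have c1 : \sum_(x <- undup t) c x = 1.
  rewrite -mulr_suml -[RHS](divff (lt0r_neq0 szt)); congr (_ / _).
  rewrite -(count_predT t) -sum1_count natr_sum.
  rewrite (@sum_count t (undup t)) ?undup_uniq //; last by move=> x; rewrite mem_undup.
  by apply: eq_bigr => x _; rewrite mulr1.
exists (undup t), a; split; rewrite ?undup_uniq //.
- by move=> x; exact: sqrtr_ge0.
- by under eq_bigr do rewrite a2.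
move=> g gE.
pose u := undup (t ++ map (fun x => g^-1 * x)%g t).
have uu : uniq u := undup_uniq _.
have tu x : x \in t -> x \in u by move=> xt; rewrite mem_undup mem_cat xt.
have gtu x : (g * x)%g \in t -> x \in u.
  move=> gxt; rewrite mem_undup mem_cat; apply/orP; right.
  by apply/mapP; exists (g * x)%g => //; rewrite mulKg.
have suma : \sum_(x <- u) a x ^+ 2 = 1.
  rewrite -c1; under eq_bigr do rewrite a2.
  apply: eq_big_supp; rewrite ?undup_uniq // => x /ct; last by rewrite mem_undup.
  exact: tu.
have sumga : \sum_(x <- u) a (g * x)%g ^+ 2 = 1.
  rewrite -c1; under eq_bigr do rewrite a2.
  rewrite -(big_map (fun x => g * x)%g xpredT c).
  apply: eq_big_supp; rewrite ?undup_uniq //.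
  - by rewrite map_inj_uniq //; exact: mulgI.
  - move=> x /ct xt; apply/mapP; exists (g^-1 * x)%g; last by rewrite mulVKg.
    by apply: gtu; rewrite mulVKg.
  - by move=> x /ct; rewrite mem_undup.
have -> : \sum_(x <- undup t) a x * a (g * x)%g = \sum_(x <- u) a x * a (g * x)%g.
  have h x : a x * a (g * x)%g != 0 -> x \in undup t.
    by rewrite mulf_eq0 negb_or => /andP[/at_].
  apply: eq_big_supp; rewrite ?undup_uniq // => x /h //.
  by rewrite mem_undup; exact: tu.
(* The test function that attains the l^1 norm: paired with c and its translate it yields the sum of
   |c(x) - c(gx)|. *)
pose f x : R := Num.sg (c (g^-1 * x)%g - c x).
have f1 x : `|f x| <= 1 by rewrite normr_sg; case: eqP.
have := tP g f gE I f1.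
have -> : \sum_(x <- t) (f (g * x)%g - f x) =
    (size t)%:R * \sum_(x <- u) `|c x - c (g * x)%g|.
  rewrite big_split sumrN /=.
  rewrite (sum_count (fun x => f (g * x)%g) uu tu).
  pose v := undup (map (fun x => g * x)%g u ++ t).
  rewrite (@sum_count t (map (fun x => g * x)%g u) f); last 2 first.
  - by rewrite map_inj_uniq //; exact: mulgI.
  - move=> x xt; apply/mapP; exists (g^-1 * x)%g; last by rewrite mulVKg.
    by apply: gtu; rewrite mulVKg.
  rewrite big_map -sumrB mulr_sumr; apply: eq_bigr => x _.
  rewrite /f mulKg normrEsg mulrCA; rewrite /c; field; exact: lt0r_neq0.
rewrite ger0_norm; last by apply: mulr_ge0; [exact: ltW|exact: sumr_ge0].
rewrite mulrC ler_pM2r // => le_e.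
have : \sum_(x <- u) (a x - a (g * x)%g) ^+ 2 <= e.
  apply: le_trans le_e; apply: ler_sum => x _; exact: sqr_sqrtB_le.
have -> : \sum_(x <- u) (a x - a (g * x)%g) ^+ 2 =
  \sum_(x <- u) a x ^+ 2 + \sum_(x <- u) a (g * x)%g ^+ 2
   - 2 * \sum_(x <- u) a x * a (g * x)%g.
  rewrite mulr_sumr -big_split -sumrB; apply: eq_bigr => x _ /=; ring.
by rewrite suma sumga; move: (\sum_(x <- u) _) => z; lra.
Qed.

(** The mean is a limit of averages over [s n], which is within 1/(n+1) of invariance under
    [E n]. *)
Lemma reiter_amenable : countable [set: G] -> reiter R G -> amenable R G.
Proof.
move=> /countable_exhaustion[E [enc EP]] rG.
have /choice[s sP] n : exists s, reiter_seq (E n) (n.+1%:R^-1 : R) setT s.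
  by apply: rG; rewrite invr_gt0 ltr0n.
have szs n : 0 < (size (s n))%:R :> R.
  by rewrite ltr0n lt0n size_eq0; case: (sP n).
pose av (f : G -> R) n : R := (\sum_(x <- s n) f x) / (size (s n))%:R.
(* Along an ultrafilter every bounded sequence converges, so the limit exists for all bounded
   functions at once. *)
have [U [UU sU]] := @ultraFilterLemma _ (\oo : set_system nat) _.
have avM f (M : R) n : (forall g, `|f g| <= M) -> `|av f n| <= M.
  move=> fM; rewrite normrM normfV [`|_%:R|]ger0_norm ?ler0n // ler_pdivrMr //.
  exact: ler_norm_sumM.
have avlin a f h n : av (fun g => a * f g + h g) n = a * av f n + av h n.
  by rewrite /av big_split /= -mulr_sumr mulrDl mulrA.
have cav f : bounded_real f -> cvg (av f n @[n --> U]).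
  move=> [M fM]; have := @segment_compact R (- M) M.
  rewrite compact_ultra => /(_ (av f n @[n --> U])) [].
  - exact: fmap_ultra.
  - suff : U [set n | `[- M, M] (av f n)] by [].
    by apply: filterE => n /=; rewrite in_itv /= -ler_norml; exact: avM.
  - by move=> l [_ lP]; apply/cvg_ex; exists l.
exists (fun f => lim (av f n @[n --> U])); split.
- move=> a f h bf bh; apply: cvg_lim => //.
  under eq_fun do rewrite avlin.
  by apply: cvgD; [apply: cvgMl_tmp; exact: cav|exact: cav].
- move=> f bf f0; apply: limr_ge; first exact: cav.
  by apply: filterE => n; rewrite divr_ge0 ?ler0n // sumr_ge0.
- apply: cvg_lim => //; under eq_fun => n.
    rewrite /av big_const_seq count_predT iter_addr addr0 divff ?gt_eqF //; over.
  exact: cvg_cst.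
move=> f k bf; apply: cvg_lim => //.
have [M fM] := bf.
have M0 : 0 <= M := le_trans (normr_ge0 _) (fM 1%g).
have d0 : av (fun g => f (k^-1 * g)%g - f g) n @[n --> U] --> (0 : R).
  apply: cvg_trans; first exact: (cvg_app _ sU).
  apply/cvgrPdist_le => e e0; near=> n; rewrite sub0r normrN.
  have kn : k^-1%g \in E n by apply: EP; near: n; exact: nbhs_infty_ge.
  have [_ /(_ _ (fun x => f x / (M + 1)) kn I)] := sP n.
  (* Dividing by M + 1 makes f bounded by 1 even if M vanishes. *)
  have M1 : 0 < M + 1 by rewrite ltr_wpDl.
  move=> /(_ _)/wrap[x|].
    by rewrite normrM normfV (gtr0_norm M1) ler_pdivrMr // mul1r (le_trans (fM x)) // lerDl.
  have -> : \sum_(x <- s n) (f (k^-1 * x)%g / (M + 1) - f x / (M + 1)) =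
     av (fun g => f (k^-1 * g)%g - f g) n * (size (s n))%:R / (M + 1).
    rewrite /av divfK ?gt_eqF // mulr_suml; apply: eq_bigr => x _; by rewrite mulrBl.
  rewrite normrM normfV (gtr0_norm M1) ler_pdivrMr // normrM (gtr0_norm (szs n)).
  rewrite mulrAC ler_pM2r // => h; apply: le_trans h _.
  rewrite ler_pdivrMl // -ler_pdivrMr //.
  apply: (@le_trans _ _ n%:R); last by rewrite ler_nat.
  by apply: ltW; near: n; exact: nbhs_infty_gtr.
have -> : (fun n => av (fun g => f (k^-1 * g)%g) n) =
    (fun n => av (fun g => f (k^-1 * g)%g - f g) n + av f n).
  apply/funext => n; rewrite /av -mulrDl -big_split; congr (_ / _).
  by apply: eq_bigr => x _ /=; rewrite subrK.
rewrite -[X in _ --> X]add0r; apply: cvgD => //; exact: cav.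
Unshelve. all: by end_near.
Qed.

End AlmostInvariantVectors.

(** * Positive definite kernels *)

Section PositiveDefiniteKernels.
Variable C : numClosedFieldType.
Local Open Scope sesquilinear_scope.

(** Stated for kernels on any type, to cover positive definite functions, Gram matrices of vectors
    and matrices of scalars coming from completely positive maps. *)
Definition pd_kernel (T : Type) (K : T -> T -> C) : Prop :=
  forall n (g : 'I_n -> T) (c : 'I_n -> C),
    0 <= \sum_i \sum_j (c i)^* * c j * K (g i) (g j).

Lemma pd_kernel_comp (T U : Type) (f : T -> U) (K : U -> U -> C) :
  pd_kernel K -> pd_kernel (fun x y => K (f x) (f y)).
Proof. by move=> pK n g c; exact: (pK n (f \o g) c). Qed.

Lemma pd_kernel_fin (T : Type) (K : T -> T -> C) (I : finType) (g : I -> T) (c : I -> C) :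
  pd_kernel K -> 0 <= \sum_i \sum_j (c i)^* * c j * K (g i) (g j).
Proof.
move=> pK; have := pK #|I| (g \o enum_val) (c \o enum_val).
congr (0 <= _); rewrite [RHS](reindex (@enum_val I predT)) /=; last first.
  by apply: onW_bij; exact: enum_val_bij.
apply: eq_bigr => i _; rewrite [RHS](reindex (@enum_val I predT)) //=.
by apply: onW_bij; exact: enum_val_bij.
Qed.

Section TwoPoints.
Variables (T : Type) (K : T -> T -> C).
Hypothesis pK : pd_kernel K.

Lemma pd_kernel_two x y (a b : C) :
  0 <= a^* * a * K x x + a^* * b * K x y + b^* * a * K y x + b^* * b * K y y.
Proof.
have := pd_kernel_fin (fun i : bool => if i then x else y)
  (fun i : bool => if i then a else b) pK.
by rewrite !big_bool /= addrA.
Qed.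

Lemma pd_kernel_diag x : 0 <= K x x.
Proof.
by have := pd_kernel_two x x 1 0; rewrite !rmorph1 rmorph0 !(mul1r, mul0r, mulr0, addr0).
Qed.

(** The coefficients (1, 1) and (1, 'i) show that K x y + K y x and 'i (K x y - K y x) are real. *)
Lemma pd_kernel_herm x y : K y x = (K x y)^*.
Proof.
have r (z : C) : 0 <= z -> z^* = z by move=> z0; apply/CrealP; exact: ger0_real.
have hx := r _ (pd_kernel_diag x); have hy := r _ (pd_kernel_diag y).
have := r _ (pd_kernel_two x y 1 1).
have := r _ (pd_kernel_two x y 1 'i).
rewrite !(rmorphD, rmorphM, rmorph1, conjCi, rmorphN) /= hx hy !(mul1r, mulr1).
move: (K x x) (K y y) (K x y) (K y x) => p q u v.
rewrite !conjCi ?opprK !mulNr mulrN !mulCii !opprK !mul1r => e1 e2.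
have {}e2 : u^* + v^* = u + v.
  by apply: (addrI p); apply: (addIr q); rewrite !addrA e2.
have {}e1 : - ('i * u^*) + 'i * v^* = 'i * u - 'i * v.
  apply: (addrI p); apply: (addIr q); rewrite !addrA e1; ring.
have {e1} e1 : - u^* + v^* = u - v.
  apply: (mulfI (neq0Ci C)); rewrite mulrDr mulrN e1 mulrBr; ring.
suff <- : v^* = u by rewrite conjCK.
apply: (@mulfI _ 2); first by rewrite pnatr_eq0.
transitivity ((u^* + v^*) + (- u^* + v^*)); first by ring.
rewrite e1 e2; ring.
Qed.

(** Three test vectors are needed since a diagonal value may vanish: one for K y y > 0, one for K x
    x > 0, and one that forces K x y = 0 when both are zero. *)
Lemma pd_kernel_CauchySchwarz x y : `|K x y| ^+ 2 <= K x x * K y y.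
Proof.
have := pd_kernel_two x y (K y y) (- K y x).
have := pd_kernel_two y x (K x x) (- K x y).
have := pd_kernel_two x y 1 (- K y x).
have px := pd_kernel_diag x; have py := pd_kernel_diag y.
rewrite !rmorphN /= (pd_kernel_herm x y) !conjCK rmorph1.
rewrite (CrealP (ger0_real px)) (CrealP (ger0_real py)) normCK.
move: (K x x) (K y y) (K x y) px py => p q u p0 q0 h1 h2 h3.
move: q0; rewrite le_eqVlt => /predU1P[q1|q1]; last first.
  by rewrite -subr_ge0 -(pmulr_rge0 _ q1); move: h3; congr (0 <= _); ring.
move: p0; rewrite le_eqVlt => /predU1P[p1|p1]; last first.
  by rewrite -subr_ge0 -(pmulr_rge0 _ p1); move: h2; congr (0 <= _); ring.
rewrite -p1 -q1 mulr0 -oppr_ge0 -(pmulr_rge0 _ (ltr0Sn C 1)).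
by move: h1; rewrite -p1 -q1; congr (0 <= _); ring.
Qed.

End TwoPoints.

(** A family may repeat an index; the coefficients on equal indices are summed into d. *)
Lemma pd_kernel_matrix (I : finType) (N : I -> I -> C) :
  (forall c : I -> C, 0 <= \sum_i \sum_j (c i)^* * c j * N i j) -> pd_kernel N.
Proof.
move=> hN m g c; pose d i := \sum_(k | g k == i) c k.
have := hN d; congr (0 <= _).
rewrite [RHS](partition_big g predT) //=; apply: eq_bigr => i _.
transitivity (\sum_(k | g k == i) \sum_j (c k)^* * d j * N i j).
  rewrite exchange_big /=; apply: eq_bigr => j _.
  by rewrite /d rmorph_sum /= !mulr_suml.
apply: eq_bigr => k /eqP gk; rewrite [RHS](partition_big g predT) //=.
apply: eq_bigr => j _; rewrite /d mulr_sumr mulr_suml.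
by apply: eq_bigr => l /eqP ->; rewrite gk.
Qed.

(** The matrix is Hermitian, hence unitarily diagonalizable as U^* D U, and positivity makes D
    nonnegative; the v k are the rows of D^(1/2) U. *)
Lemma pd_kernel_gram n (N : 'I_n -> 'I_n -> C) : pd_kernel N ->
  exists v : 'I_n -> 'I_n -> C, forall i j, N i j = \sum_k (v k i)^* * v k j.
Proof.
move=> pN; pose A : 'M[C]_n := \matrix_(i, j) N i j.
have AH : A ^t* = A.
  by apply/matrixP => i j; rewrite !mxE -(pd_kernel_herm pN).
have /orthomx_spectralP AE : A \is normalmx by apply/normalmxP; rewrite AH.
move: AE; have := spectral_unitarymx A; set U := spectralmx A => Uu.
set D := spectral_diag A; rewrite invmx_unitary // => AE.
have DE : diag_mx D = U *m A *m (U ^t* ).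
  by rewrite AE !mulmxA (unitarymxP Uu) mul1mx mulmxtVK.
have D0 k : 0 <= D 0 k.
  have := pd_kernel_fin (fun i : 'I_n => i) (fun i => (U k i)^* ) pN.
  congr (0 <= _); have /matrixP/(_ k k) := DE.
  rewrite !mxE eqxx mulr1n => ->.
  rewrite exchange_big; apply: eq_bigr => j _ /=.
  rewrite !mxE mulr_suml; apply: eq_bigr => i _; rewrite !mxE conjCK; ring.
exists (fun k j => sqrtC (D 0 k) * U k j) => i j.
have /matrixP/(_ i j) := AE; rewrite !mxE => ->.
apply: eq_bigr => k _; rewrite mul_mx_diag !mxE rmorphM /=.
have /CrealP -> : sqrtC (D 0 k) \is Num.real by rewrite ger0_real // sqrtC_ge0.
by rewrite -[in LHS](sqrtCK (D 0 k)); ring.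
Qed.

(** Schur's product theorem: writing L as a Gram matrix turns the form into a sum over k of the form
    of K with coefficients c i * v k i. *)
Lemma pd_kernelM (T : Type) (K L : T -> T -> C) :
  pd_kernel K -> pd_kernel L -> pd_kernel (fun x y => K x y * L x y).
Proof.
move=> pK pL n g c; have [v vE] := pd_kernel_gram (pd_kernel_comp g pL).
have : 0 <= \sum_k \sum_i \sum_j (c i * v k i)^* * (c j * v k j) * K (g i) (g j).
  by apply: sumr_ge0 => k _; exact: pK.
congr (0 <= _); rewrite exchange_big; apply: eq_bigr => i _ /=.
rewrite exchange_big; apply: eq_bigr => j _ /=.
rewrite vE !mulr_sumr; apply: eq_bigr => k _; rewrite rmorphM /=; ring.
Qed.

(** The applications pair a positive scalar matrix K with the Gram matrix L of a family of
    vectors. *)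
Lemma pd_kernel_sum_ge0 (T : Type) (K L : T -> T -> C) (I : finType) (g : I -> T) :
  pd_kernel K -> pd_kernel L -> 0 <= \sum_i \sum_j K (g i) (g j) * L (g i) (g j).
Proof.
move=> pK pL; have := pd_kernel_fin g (fun=> 1) (pd_kernelM pK pL).
by congr (0 <= _); apply: eq_bigr => i _; apply: eq_bigr => j _; rewrite rmorph1 !mul1r.
Qed.

End PositiveDefiniteKernels.

(** * Amenability *)

Section InvariantMeans.
Variables (R : realType) (G : groupType) (m : (G -> R) -> R).
Hypothesis mlin : forall (a : R) f h, bounded_real f -> bounded_real h ->
  m (fun g => a * f g + h g) = a * m f + m h.
Hypothesis m_ge0 : forall f, bounded_real f -> (forall g, 0 <= f g) -> 0 <= m f.
Hypothesis m1 : m (fun=> 1) = 1.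

Lemma bounded_real_cst (c : R) : bounded_real (fun _ : G => c).
Proof. by exists `|c| => _. Qed.

Lemma mean_cst c : m (fun=> c) = c.
Proof.
have m0 : m (fun=> 0) = 0.
  have := mlin (-1) (bounded_real_cst 1) (bounded_real_cst 1).
  by rewrite m1 (_ : (fun=> _) = (fun=> 0)) => [->|]; [|apply/funext => ?]; ring.
have := mlin c (bounded_real_cst 1) (bounded_real_cst 0).
by rewrite m0 m1 mulr1 addr0.
Qed.

Lemma mean_le f M : (forall g, `|f g| <= M) -> `|m f| <= M.
Proof.
move=> fM; have bf : bounded_real f by exists M.
have h (a : R) : `|a| = 1 -> 0 <= a * m f + M.
  move=> a1; rewrite -(mean_cst M) -mlin //; last exact: bounded_real_cst.
  apply: m_ge0 => [|g].
    exists (M + `|M|) => g; apply: le_trans (ler_normD _ _) _.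
    by rewrite normrM a1 mul1r lerD2r.
  rewrite -lerBlDr sub0r; have := fM g; rewrite -[`|f g|]mul1r -a1 -normrM.
  by rewrite ler_norml => /andP[].
have := h 1 (normr1 _); have := h (-1) (normrN1 _).
by rewrite ler_norml; lra.
Qed.

End InvariantMeans.

(** A function is pulled back along [rho] and averaged over K, then B, then A. For invariance, the
    three variables are translated one at a time from the outermost mean inwards, and equivariance
    of [rho] cancels p. *)
Lemma np_amenable (R : realType) (A B : groupType) :
  countable [set: A] -> countable [set: B] ->
  amenable R A -> amenable R B -> amenable R (nilpotent_product2 A B).
Proof.
move=> cA cB aA aB.
have [K [h [k [l [[hM kM lM] K2 lsurj inj]]]]] := np_embedding A B.
have cK := countable_surj lsurj (np_countable cA cB).
have [mA [Alin A0 A1 Ainv]] := aA; have [mB [Blin B0 B1 Binv]] := aB.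
have [mK [Klin K0 K1 Kinv]] := reiter_amenable cK (reiter_class2 (R := R) K2).
pose P : groupType := nilpotent_product2 A B.
pose X : choiceType := (A * B * K)%type.
have [||||rho rhoP] := @equivariant_retraction P X
  (fun p x => (h p * x.1.1, k p * x.1.2, l p * x.2)%g).
- exact: (1, 1, 1)%g.
- by move=> [[x y] z] /=; rewrite (morph_one hM) (morph_one kM) (morph_one lM) !mul1g.
- by move=> p q [[x y] z] /=; rewrite hM kM lM !mulgA.
- move=> p [[x y] z] [] /(canRL (mulgK _)) + /(canRL (mulgK _)) + /(canRL (mulgK _)).
  by rewrite !mulgV => *; apply: inj.
pose inn (f : P -> R) x y := mK (fun z => f (rho (x, y, z))).
pose mid f x := mB (inn f x).
have innM f M x y : (forall p, `|f p| <= M) -> `|inn f x y| <= M.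
  by move=> fM; apply: (mean_le Klin K0 K1).
have midM f M x : (forall p, `|f p| <= M) -> `|mid f x| <= M.
  by move=> fM; apply: (mean_le Blin B0 B1) => y; exact: innM.
have binn0 f x y : bounded_real f -> bounded_real (fun z => f (rho (x, y, z))).
  by move=> [M fM]; exists M.
have binn f x : bounded_real f -> bounded_real (inn f x).
  by move=> [M fM]; exists M => y; exact: innM.
have bmid f : bounded_real f -> bounded_real (mid f).
  by move=> [M fM]; exists M => y; exact: midM.
exists (fun f => mA (mid f)); split.
- move=> a f g bf bg; rewrite -Alin; [|exact: bmid..]; congr mA; apply/funext => x.
  rewrite -Blin; [|exact: binn..]; congr mB; apply/funext => y.
  by rewrite -Klin; [|exact: binn0..].
- move=> f bf f0; apply: A0 => [|x]; first exact: bmid.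
  apply: B0 => [|y]; first exact: binn.
  by apply: K0 => //; exact: binn0.
- rewrite -[RHS]A1; congr mA; apply/funext => x.
  by rewrite -[RHS]B1; congr mB; apply/funext => y; exact: K1.
move=> f p bf; rewrite -(Ainv (mid f) (h p)); last exact: bmid.
congr mA; apply/funext => x; rewrite /mid -(Binv (inn f _) (k p)); last exact: binn.
congr mB; apply/funext => y.
rewrite /inn -(Kinv (fun z => f (rho (_, _, z))) (l p)); last exact: binn0.
congr mK; apply/funext => z; congr f; rewrite -rhoP /=.
by rewrite (morph_inv hM) (morph_inv kM) (morph_inv lM).
Qed.

(** * The Haagerup property *)

Lemma conjRC (R : realType) (r : R) : Num.conj (real_complex R r) = real_complex R r.
Proof. exact: conjc_real. Qed.

Section PositiveDefiniteFunctions.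
Variables (R : realType) (G : groupType).
Implicit Types (phi : G -> R[i]).
Local Open Scope complex_scope.

Lemma positive_definiteE phi :
  positive_definite phi = pd_kernel (fun x y => phi (x^-1 * y)%g).
Proof. by []. Qed.

Lemma positive_definite_le1 phi g :
  positive_definite phi -> phi 1%g = 1 -> `|phi g| <= 1.
Proof.
rewrite positive_definiteE => pphi phi1.
have := pd_kernel_CauchySchwarz pphi 1%g g.
by rewrite invg1 !mul1g mulVg phi1 mul1r expr_le1.
Qed.

(** The substitution y = g_j x turns the form into the sum over y of |sum_i c_i a(g_i^-1 y)|^2. *)
Lemma positive_definite_autocorrelation (s : seq G) (a : G -> R) : uniq s ->
  (forall x, a x != 0 -> x \in s) ->
  positive_definite (fun g => (\sum_(x <- s) a x * a (g * x)%g)%:C).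
Proof.
move=> us as_ n g c.
pose u := undup [seq (g i * x)%g | i <- enum 'I_n, x <- s].
have gs i x : x \in s -> (g i * x)%g \in u.
  by move=> xs; rewrite mem_undup; apply/allpairsP; exists (i, x); rewrite mem_enum.
have aE i j : \sum_(x <- s) a x * a ((g i)^-1 * g j * x)%g =
    \sum_(y <- u) a ((g i)^-1 * y)%g * a ((g j)^-1 * y)%g.
  transitivity (\sum_(y <- map (fun x => g j * x)%g s)
      a ((g j)^-1 * y)%g * a ((g i)^-1 * y)%g).
    by rewrite big_map; apply: eq_bigr => x _; rewrite mulKg mulgA.
  rewrite (@eq_big_supp R G _ u); last 4 first.
  - by rewrite map_inj_uniq //; exact: mulgI.
  - exact: undup_uniq.
  - move=> y; rewrite mulf_eq0 negb_or => /andP[/as_ ys _].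
    by apply/mapP; exists ((g j)^-1 * y)%g; rewrite ?mulVKg.
  - move=> y; rewrite mulf_eq0 negb_or => /andP[/as_ ys _].
    by rewrite -(mulVKg (g j) y) gs.
  by apply: eq_bigr => y _; rewrite mulrC.
have : 0 <= \sum_(y <- u) (\sum_i c i * (a ((g i)^-1 * y)%g)%:C)^* *
    (\sum_i c i * (a ((g i)^-1 * y)%g)%:C).
  by apply: sumr_ge0 => y _; rewrite mulrC mul_conjC_ge0.
congr (0 <= _).
transitivity (\sum_(y <- u) \sum_i \sum_j
    (c i)^* * c j * (a ((g i)^-1 * y)%g * a ((g j)^-1 * y)%g)%:C).
  apply: eq_bigr => y _; rewrite rmorph_sum mulr_suml; apply: eq_bigr => i _ /=.
  rewrite mulr_sumr; apply: eq_bigr => j _; rewrite !rmorphM /=.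
  rewrite conjRC; ring.
rewrite exchange_big; apply: eq_bigr => i _ /=; rewrite exchange_big.
by apply: eq_bigr => j _ /=; rewrite aE -mulr_sumr rmorph_sum.
Qed.

(** [phi n] is the autocorrelation of an almost invariant unit vector: it is supported in the finite
    set s s^-1, and it is at least 1 - 1/(n+1) at g once g lies in [E n]. *)
Lemma almost_invariant_haagerup : countable [set: G] -> almost_invariant_vectors R G ->
  haagerup R G.
Proof.
move=> /countable_exhaustion[E [enc EP]] aG.
have /choice[sa saP] n : exists sa : seq G * (G -> R),
  [/\ uniq sa.1, forall x, 0 <= sa.2 x, forall x, sa.2 x != 0 -> x \in sa.1,
      \sum_(x <- sa.1) sa.2 x ^+ 2 = 1
    & forall g, g \in E n -> 1 - n.+1%:R^-1 <= \sum_(x <- sa.1) sa.2 x * sa.2 (g * x)%g].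
  have e0 : 0 < (n.+1%:R^-1 : R) by rewrite invr_gt0 ltr0n.
  have [s [a h]] := aG (E n) _ e0.
  by exists (s, a).
pose phi n g := (\sum_(x <- (sa n).1) (sa n).2 x * (sa n).2 (g * x)%g)%:C : R[i].
have pphi n : positive_definite (phi n).
  by have [us _ h _ _] := saP n; exact: positive_definite_autocorrelation.
have phi1 n : phi n 1%g = 1.
  have [_ _ _ h _] := saP n; rewrite /phi; under eq_bigr do rewrite mul1g -expr2.
  by rewrite h.
exists phi; split=> // [n e e0|g].
  have [us a0 as_ _ _] := saP n.
  apply: (@sub_finite_set _ _ [set` [seq (y * x^-1)%g | y <- (sa n).1, x <- (sa n).1]]);
    last exact: finite_seq.
  move=> g /=; apply: contraTT => gs; rewrite /phi big_seq big1 => [|x xs].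
    by rewrite normr0 lt_geF // ltcR.
  apply/eqP; rewrite mulf_eq0; apply/orP; right; apply: contraNT gs => /as_ gxs.
  by apply/allpairsP; exists ((g * x)%g, x); rewrite /= mulgK.
apply/(@cvgrPdist_le _ R[i]^o _ _ _ (fun n => phi n g) 1) => e e0.
have [r r0 ->] : exists2 r : R, 0 < r & e = r%:C.
  exists (complex.Re e); first by move: e0; rewrite ltcE => /andP[].
  by rewrite RRe_real // ger0_real // ltW.
near=> n.
have gE : g \in E n by apply: EP; near: n; exact: nbhs_infty_ge.
have [_ _ _ _ /(_ g gE) h] := saP n.
have := positive_definite_le1 g (pphi n) (phi1 n).
have -> : 1 - phi n g =
  (1 - \sum_(x <- (sa n).1) (sa n).2 x * (sa n).2 (g * x)%g)%:C :> R[i].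
  by rewrite rmorphB.
rewrite /phi !normc_def /= expr0n addr0 addr0 !sqrtr_sqr -(rmorph1 (real_complex R)) !lecR => h'.
have : n.+1%:R^-1 <= r :> R.
  rewrite -[r]invrK lef_pV2 ?posrE ?invr_gt0 ?ltr0n //.
  apply: (@le_trans _ _ n%:R); last by rewrite ler_nat.
  by apply: ltW; near: n; exact: nbhs_infty_gtr.
move: h' h; rewrite !ler_norml; move: (\sum_(x <- _) _) (n.+1%:R^-1) => z w /andP[? ?] ? ?.
apply/andP; split; lra.
Unshelve. all: by end_near.
Qed.

End PositiveDefiniteFunctions.

(** Each factor is bounded by 1, so the product reaches e only where all three factors do. This is a
    finite subset of A x B x K, and its preimage is finite because the embedding is injective. *)
Lemma np_haagerup (R : realType) (A B : groupType) :
  countable [set: A] -> countable [set: B] ->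
  haagerup R A -> haagerup R B -> haagerup R (nilpotent_product2 A B).
Proof.
move=> cA cB [pA [pA1 pA2 pA3 pA4]] [pB [pB1 pB2 pB3 pB4]].
have [K [h [k [l [[hM kM lM] K2 lsurj inj]]]]] := np_embedding A B.
have cK := countable_surj lsurj (np_countable cA cB).
have [pK [pK1 pK2 pK3 pK4]] : haagerup R K.
  by apply: almost_invariant_haagerup => //; apply: reiter_almost_invariant; exact: reiter_class2.
pose P : groupType := nilpotent_product2 A B.
have pullback (H : groupType) (f : P -> H) (phi : H -> R[i]) : {morph f : x y / (x * y)%g} ->
    positive_definite phi -> pd_kernel (fun x y => phi (f (x^-1 * y)%g)).
  move=> fM pphi.
  have -> : (fun x y => phi (f (x^-1 * y)%g)) = (fun x y => phi ((f x)^-1 * f y)%g).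
    by apply/funext => x; apply/funext => y; rewrite fM morph_inv.
  exact: (@pd_kernel_comp _ _ _ f (fun x y => phi (x^-1 * y)%g) pphi).
exists (fun n p => pA n (h p) * pB n (k p) * pK n (l p)); split.
- move=> n; exact: (pd_kernelM (pd_kernelM (pullback _ _ _ hM (pA1 n)) (pullback _ _ _ kM (pB1 n))) (pullback _ _ _ lM (pK1 n))).
- by move=> n; rewrite !morph_one // pA2 pB2 pK2 !mulr1.
- move=> n e e0; set S := [set g | _].
  have fS := finite_setX (finite_setX (pA3 n e e0) (pB3 n e e0)) (pK3 n e e0).
  pose f (p : P) := (h p, k p, l p).
  move: fS; set Q := (X in finite_set X) => fQ.
  apply: (@sub_finite_set _ _ (f @^-1` Q)); last first.
    apply: finite_preimage fQ => x y _ _ [hxy kxy lxy].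
    apply/eqP; rewrite -divg_eq1; apply/eqP; apply: inj.
    - by rewrite hM morph_inv // hxy mulgV.
    - by rewrite kM morph_inv // kxy mulgV.
    - by rewrite lM morph_inv // lxy mulgV.
  move=> p /= Sp.
  have a1 := positive_definite_le1 (h p) (pA1 n) (pA2 n).
  have b1 := positive_definite_le1 (k p) (pB1 n) (pB2 n).
  have k1 := positive_definite_le1 (l p) (pK1 n) (pK2 n).
  move: Sp; rewrite /S /Q /f /= !normrM.
  move: `|pA n (h p)| `|pB n (k p)| `|pK n (l p)| a1 b1 k1
    (normr_ge0 (pA n (h p))) (normr_ge0 (pB n (k p))) (normr_ge0 (pK n (l p))).
  move=> a b c a1 b1 c1 a0 b0 c0 abc.
  have ab1 : a * b <= 1 by rewrite mulr_ile1.
  split; first split; apply: le_trans abc _.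
  + by rewrite -mulrA ler_piMr // mulr_ile1.
  + by rewrite mulrAC ler_piMl // mulr_ile1.
  + by rewrite ler_piMl.
move=> g; have := cvgM (cvgM (pA4 (h g)) (pB4 (k g))) (pK4 (l g)).
by rewrite mulr1 mulr1; apply.
Qed.

(** * Hilbert spaces and completely positive maps *)

Section HilbertSpaceTheory.
Variables (R : realType) (H : hilbertSpace R).
Local Notation C := R[i].
Local Notation dot := (hdot H).
Implicit Types (x y z : H) (a c : C).

Lemma hdotDl x y z : dot (x + y) z = dot x z + dot y z.
Proof. exact: linearDl. Qed.

Lemma hdotBl x y z : dot (x - y) z = dot x z - dot y z.
Proof. exact: linearBl. Qed.

Lemma hdotNl x z : dot (- x) z = - dot x z.
Proof. exact: linearNl. Qed.

Lemma hdotZl a x z : dot (a *: x) z = a * dot x z.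
Proof. exact: linearZl_LR. Qed.

Lemma hdot0l z : dot 0 z = 0.
Proof. exact: linear0l. Qed.

Lemma hdot_suml (I : Type) (r : seq I) (F : I -> H) z :
  dot (\sum_(i <- r) F i) z = \sum_(i <- r) dot (F i) z.
Proof. exact: linear_sumlz. Qed.

Lemma hdotDr x y z : dot z (x + y) = dot z x + dot z y.
Proof. exact: linearDr. Qed.

Lemma hdotBr x y z : dot z (x - y) = dot z x - dot z y.
Proof. exact: linearBr. Qed.

Lemma hdotNr x z : dot z (- x) = - dot z x.
Proof. exact: linearNr. Qed.

Lemma hdotZr a x z : dot z (a *: x) = a^* * dot z x.
Proof. exact: linearZr_LR. Qed.

Lemma hdot_sumr (I : Type) (r : seq I) (F : I -> H) z :
  dot z (\sum_(i <- r) F i) = \sum_(i <- r) dot z (F i).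
Proof. exact: linear_sumr. Qed.

Lemma hdotC x y : dot x y = (dot y x)^*.
Proof. by have := hermC (dot : {hermitian H for false & Num.conj}) x y; rewrite expr0 mul1r. Qed.

Lemma hdot_ge0 x : 0 <= dot x x.
Proof. by rewrite -hdot_norm exprn_ge0. Qed.

(** The arguments are swapped because [dot] is linear in its first variable, whereas [pd_kernel]
    conjugates the first coefficient. *)
Lemma hdot_pd : pd_kernel (fun x y : H => dot y x).
Proof.
move=> n g c; have := hdot_ge0 (\sum_i c i *: g i); congr (0 <= _).
rewrite hdot_sumr; apply: eq_bigr => i _; rewrite hdot_suml; apply: eq_bigr => j _.
rewrite hdotZl hdotZr; ring.
Qed.

Lemma hdot_CauchySchwarz x y : `|dot x y| <= `|x| * `|y|.
Proof.
rewrite -(ler_pXn2r (n := 2)) ?nnegrE ?mulr_ge0 // exprMn !hdot_norm mulrC.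
exact: (pd_kernel_CauchySchwarz hdot_pd).
Qed.

Lemma hnorm_le x c : 0 <= c -> (forall z, `|dot x z| <= c * `|z|) -> `|x| <= c.
Proof.
move=> c0 /(_ x); have [->|x0] := eqVneq x 0; first by rewrite normr0.
rewrite -hdot_norm normrX normr_id expr2 ler_pM2r ?normr_gt0 //.
Qed.

Lemma hnorm_real x : exists2 r : R, 0 <= r & `|x| = (r%:C)%C.
Proof.
have := normr_ge0 x; move: `|x| => [a b]; rewrite lecE /= => /andP[/eqP -> a0].
by exists a.
Qed.

Lemma parallelogram x y :
  `|x + y| ^+ 2 + `|x - y| ^+ 2 = 2 * (`|x| ^+ 2 + `|y| ^+ 2).
Proof. rewrite !hdot_norm !(hdotDl, hdotDr, hdotNl, hdotNr); ring. Qed.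

End HilbertSpaceTheory.

Section BoundedOperators.
Variables (R : realType) (H : hilbertSpace R).
Implicit Types (T : H -> H).

Lemma linear_additive (V W : lmodType R[i]) (T : V -> W) : linear T ->
  [/\ forall x y, T (x + y) = T x + T y, forall a x, T (a *: x) = a *: T x & T 0 = 0].
Proof.
move=> lT; have T0 : T 0 = 0.
  by have := lT (-1) 0 0; rewrite scaler0 addr0 scaleN1r addNr.
split=> // [x y|a x]; first by have := lT 1 x y; rewrite !scale1r.
by have := lT a x 0; rewrite T0 !addr0.
Qed.

Lemma linear_map_sum (V W : lmodType R[i]) (T : V -> W) (I : Type) (r : seq I) (F : I -> V) :
  linear T -> T (\sum_(i <- r) F i) = \sum_(i <- r) T (F i).
Proof.
move=> /linear_additive[TD _ T0]; elim: r => [|i r IHr]; first by rewrite !big_nil.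
by rewrite !big_cons TD IHr.
Qed.

Lemma linear_map_sub (V W : lmodType R[i]) (T : V -> W) x y :
  linear T -> T (x - y) = T x - T y.
Proof. by move=> /linear_additive[TD TZ _]; rewrite TD -scaleN1r TZ scaleN1r. Qed.

Lemma bounded_opP T c : linear T -> op_norm_le T c -> bounded_op T.
Proof.
move=> lT [c0 Tc]; split=> // x.
have c1 : 0 < c + 1 by rewrite ltr_wpDl.
apply/cvgrPdist_le => e e0; near=> y.
rewrite -linear_map_sub //; apply: le_trans (Tc _) _.
apply: (@le_trans _ _ ((c + 1) * `|x - y|)); first by rewrite ler_wpM2r // lerDl.
rewrite -ler_pdivlMl // mulrC; near: y.
by apply: cvgr_dist_le; [exact: cvg_id|rewrite divr_gt0].
Unshelve. all: by end_near.
Qed.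

End BoundedOperators.

Section L2Basis.
Variables (R : realType) (I : choiceType).
Local Notation C := R[i].

Lemma sum_single (V : nmodType) (h : I -> V) (g : I) (s : seq I) : uniq s ->
  (forall i, i != g -> h i = 0) -> \sum_(i <- s) h i = if g \in s then h g else 0.
Proof.
move=> us h0; case: ifPn => gs.
  by rewrite (bigD1_seq g) //= big1 ?addr0 // => i /h0.
rewrite big_seq big1 // => i is_; apply: h0; by apply: contraNneq gs => <-.
Qed.

Lemma summableR_single (h : I -> R) g : (forall i, i != g -> h i = 0) -> summableR h.
Proof.
move=> h0; apply: (@summableR_bound _ _ _ `|h g|) => s us.
rewrite (@sum_single _ (fun i => `|h i|) g) //; first by case: ifP.
by move=> i /h0 ->; rewrite normr0.
Qed.

Lemma sumR_single (h : I -> R) g : (forall i, i != g -> h i = 0) -> sumR h = h g.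
Proof.
have pos p : (forall i, 0 <= p i) -> (forall i, i != g -> p i = 0) -> psumR p = p g :> R.
  move=> p0 pg; apply/eqP; rewrite eq_le; apply/andP; split.
    apply: psumR_le => // s us; rewrite (sum_single us pg); by case: ifP.
  have := @ler_psumR _ _ p [:: g] (summableR_single pg) p0 isT.
  by rewrite big_seq1.
move=> h0; rewrite /sumR !pos.
- case: (lerP 0 (h g)) => hg.
    by rewrite (max_idPr _) ?oppr_le0 // subr0.
  by rewrite (max_idPl _) ?oppr_ge0 1?ltW // sub0r opprK.
- by move=> i; rewrite le_max lexx orbT.
- by move=> i /h0 ->; rewrite oppr0 maxxx.
- by move=> i; rewrite le_max lexx orbT.
- by move=> i /h0 ->; rewrite maxxx.
Qed.

Fact l2_delta_subproof (g : I) : (fun i => (i == g)%:R : C) \in @l2_pred R I.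
Proof.
rewrite inE /= /square_summable; apply: (@summableR_single _ g) => i /negbTE ->.
by rewrite /normsq /= expr0n addr0.
Qed.

Definition l2_delta (g : I) : l2 R I := L2 (l2_delta_subproof g).

Lemma l2_deltaE g i : l2_delta g i = (i == g)%:R.
Proof. by []. Qed.

Lemma l2_dot_deltar (x : l2 R I) g : l2_dot x (l2_delta g) = x g.
Proof.
have h i : i != g -> x i * (l2_delta g i)^* = 0.
  by move=> /negbTE ig; rewrite l2_deltaE ig rmorph0 mulr0.
apply/eqP; rewrite eq_complex /= !(@sumR_single _ g).
- by rewrite !eqxx !rmorph1 mulr1 !eqxx.
- by move=> i /h ->.
- by move=> i /h ->.
Qed.

Lemma l2_le_norm (x y : l2 R I) : (forall i, normsq (x i) <= normsq (y i)) -> `|x| <= `|y|.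
Proof.
move=> xy; rewrite /Num.norm /= /l2_norm lecR ler_wsqrtr //.
apply: psumR_le => [i|s us]; first exact: normsq_ge0.
apply: le_trans (ler_sum _ (fun i _ => xy i)) _.
by apply: ler_psumR => //; [exact: l2_summable|move=> i; exact: normsq_ge0].
Qed.

Lemma l2_val_sum (J : Type) (r : seq J) (F : J -> l2 R I) i :
  (\sum_(j <- r) F j) i = \sum_(j <- r) F j i.
Proof. by elim: r => [|j r IHr]; rewrite ?big_nil // !big_cons -IHr. Qed.

Lemma normsqE (z : C) : ((normsq z)%:C)%C = z * z^*.
Proof. by case: z => a b; apply/eqP; rewrite eq_complex /=; apply/andP; split; apply/eqP; rewrite /normsq /=; ring. Qed.

End L2Basis.

Section FiniteL2.
Variables (R : realType) (n : nat).
Local Notation C := R[i].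
Local Notation E := (l2_hilbert R 'I_n).

Fact fin_l2_subproof (v : 'I_n -> C) : v \in @l2_pred R 'I_n.
Proof.
rewrite inE /= /square_summable; apply: (@summableR_bound _ _ _ (\sum_i normsq (v i))) => s us.
under eq_bigr do rewrite ger0_norm ?normsq_ge0 //.
rewrite big_uniq // [leRHS](bigID (fun i => i \in s)) /= lerDl.
by apply: sumr_ge0 => i _; exact: normsq_ge0.
Qed.

Definition fin_l2 (v : 'I_n -> C) : E := L2 (fin_l2_subproof v).

Definition fin_delta (i : 'I_n) : E := @l2_delta R 'I_n i.

Lemma fin_l2_expand (x : E) : x = \sum_i x i *: fin_delta i.
Proof.
apply: l2P => i; rewrite l2_val_sum (bigD1 i) //= big1 => [|j /negbTE ji].
  by rewrite addr0 -[RHS]/(x i * (i == i)%:R) eqxx mulr1.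
by rewrite -[LHS]/(x j * (i == j)%:R) eq_sym ji mulr0.
Qed.

Lemma fin_l2_dot (x y : E) : hdot E x y = \sum_i x i * (y i)^*.
Proof.
rewrite {1}(fin_l2_expand x) hdot_suml; apply: eq_bigr => i _.
by rewrite hdotZl hdotC [hdot _ _ _]l2_dot_deltar.
Qed.

Lemma fin_l2_norm (x : E) : `|x| ^+ 2 = \sum_i `|x i| ^+ 2.
Proof. by rewrite hdot_norm fin_l2_dot; apply: eq_bigr => i _; rewrite normCK. Qed.

Lemma fin_delta_norm i : `|fin_delta i| = 1.
Proof.
apply/eqP; rewrite -(@pexpr_eq1 _ _ 2) // hdot_norm [hdot _ _ _]l2_dot_deltar.
by rewrite l2_deltaE eqxx.
Qed.

Definition op_entry (M : E -> E) (i j : 'I_n) : C := M (fin_delta j) i.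

Lemma op_entryE (M : E -> E) (x : E) i : linear M -> M x i = \sum_j op_entry M i j * x j.
Proof.
move=> lM; rewrite {1}(fin_l2_expand x) (linear_map_sum _ _ lM) l2_val_sum; apply: eq_bigr => j _.
have [_ MZ _] := linear_additive lM.
by rewrite MZ mulrC.
Qed.

End FiniteL2.

Lemma sum_pair (V : nmodType) (I J : finType) (F : I * J -> V) :
  \sum_p F p = \sum_i \sum_j F (i, j).
Proof. by rewrite pair_bigA; apply: eq_bigr => -[]. Qed.

(** * Compressions and column maps, the two halves of a factorization through matrices *)

Section CompressionMaps.
Variables (R : realType) (H1 H2 : hilbertSpace R).
Variables (J : H1 -> H2) (J' : H2 -> H1).
Hypotheses (lJ : linear J) (lJ' : linear J').
Hypothesis adJ : forall x y, hdot H2 (J x) y = hdot H1 x (J' y).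
Hypotheses (J1 : forall x, `|J x| <= `|x|) (J'1 : forall x, `|J' x| <= `|x|).

Definition compression (T : H2 -> H2) : H1 -> H1 := J' \o T \o J.

Lemma contraction_continuous (K1 K2 : hilbertSpace R) (V : K1 -> K2) : linear V ->
  (forall x, `|V x| <= `|x|) -> continuous V.
Proof.
move=> lV V1 x; apply/cvgrPdist_le => e e0; near=> y.
rewrite -linear_map_sub //; apply: le_trans (V1 _) _; near: y.
by apply: cvgr_dist_le; [exact: cvg_id|].
Unshelve. all: by end_near.
Qed.

Lemma compression_norm T c : op_norm_le T c -> op_norm_le (compression T) c.
Proof.
move=> [c0 Tc]; split=> // x; apply: le_trans (J'1 _) _; apply: le_trans (Tc _) _.
exact: ler_wpM2l.
Qed.

Lemma compression_ccp (A : set (H2 -> H2)) : A `<=` @bounded_op R H2 ->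
  ccp A compression.
Proof.
have [JD JZ _] := linear_additive lJ; have [J'D J'Z _] := linear_additive lJ'.
move=> AB; split.
- move=> T /AB[lT cT]; have [TD TZ _] := linear_additive lT; split.
    by move=> a x y; rewrite /compression /= JD JZ TD TZ J'D J'Z.
  move=> x; apply: continuous_comp; first exact: contraction_continuous.
  apply: continuous_comp; first exact: cT.
  exact: contraction_continuous.
- by move=> a S T AS AT; apply/funext => x; rewrite /compression /= J'D J'Z.
- move=> m T AT pT x; have := pT (fun i => J (x i)); congr (0 <= _).
  apply: eq_bigr => i _; apply: eq_bigr => j _.
  by rewrite [RHS]hdotC -adJ -hdotC.
- by move=> T c _; exact: compression_norm.
Qed.

End CompressionMaps.

Section ColumnMaps.
Variables (R : realType) (H : hilbertSpace R) (n : nat).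
Local Notation E := (l2_hilbert R 'I_n).
Variables (W W' : 'I_n -> H -> H).
Hypotheses (lW : forall i, linear (W i)) (lW' : forall i, linear (W' i)).
Hypothesis adW : forall i x y, hdot H (W i x) y = hdot H x (W' i y).
Hypothesis W1 : forall x, \sum_i `|W i x| ^+ 2 <= `|x| ^+ 2.

(** This is W^* (M tensor 1) W for the column W with entries [W i], spelled out through matrix
    entries to avoid tensor products of Hilbert spaces. *)
Definition column_map (M : E -> E) : H -> H :=
  fun x => \sum_i \sum_j op_entry M i j *: W' i (W j x).

Lemma column_map_dot M x y :
  hdot H (column_map M x) y = \sum_i \sum_j op_entry M i j * hdot H (W j x) (W i y).
Proof.
rewrite hdot_suml; apply: eq_bigr => i _; rewrite hdot_suml; apply: eq_bigr => j _.
by rewrite hdotZl [X in _ * X]hdotC -adW -hdotC.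
Qed.

(** The norm of M tensor 1 is that of M: the matrix c^2 - M^* M is positive, and it is paired with
    the Gram matrix of y. *)
Lemma matrix_amplification_norm M c (y : 'I_n -> H) : linear M -> op_norm_le M c ->
  \sum_i `|\sum_j op_entry M i j *: y j| ^+ 2 <= c ^+ 2 * \sum_j `|y j| ^+ 2.
Proof.
move=> lM [c0 Mc].
pose N j k := c ^+ 2 * (j == k)%:R - \sum_i (op_entry M i j)^* * op_entry M i k.
have pN : pd_kernel N.
  apply: pd_kernel_matrix => v.
  have := Mc (fin_l2 v); rewrite -(ler_pXn2r (n := 2)) ?nnegrE ?mulr_ge0 //.
  rewrite exprMn !fin_l2_norm -subr_ge0; congr (0 <= _).
  transitivity (\sum_j \sum_k (v j)^* * v k * (c ^+ 2 * (j == k)%:R) -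
    \sum_j \sum_k (v j)^* * v k * \sum_i (op_entry M i j)^* * op_entry M i k); last first.
    rewrite -sumrB; apply: eq_bigr => j _; rewrite -sumrB; apply: eq_bigr => k _.
    by rewrite mulrBr.
  congr (_ - _).
    rewrite mulr_sumr; apply: eq_bigr => j _.
    rewrite (bigD1 j) //= big1 ?addr0 => [|k /negbTE kj].
      by rewrite eqxx mulr1 normCK; ring.
    by rewrite eq_sym kj !mulr0.
  transitivity (\sum_i \sum_j \sum_k (v j)^* * v k * ((op_entry M i j)^* * op_entry M i k)).
    apply: eq_bigr => i _; rewrite normCKC op_entryE // rmorph_sum mulr_suml.
    apply: eq_bigr => j _; rewrite mulr_sumr; apply: eq_bigr => k _.
    by rewrite rmorphM /=; ring.
  rewrite exchange_big; apply: eq_bigr => j _; rewrite exchange_big.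
  by apply: eq_bigr => k _; rewrite mulr_sumr.
rewrite -subr_ge0.
have := pd_kernel_sum_ge0 (fun j => j) pN (pd_kernel_comp y (@hdot_pd R H)).
congr (0 <= _).
transitivity (\sum_j \sum_k (c ^+ 2 * (j == k)%:R) * hdot H (y k) (y j) -
    \sum_j \sum_k (\sum_i (op_entry M i j)^* * op_entry M i k) * hdot H (y k) (y j)).
  rewrite -sumrB; apply: eq_bigr => j _; rewrite -sumrB; apply: eq_bigr => k _.
  by rewrite mulrBl.
congr (_ - _).
  rewrite mulr_sumr; apply: eq_bigr => j _.
  rewrite (bigD1 j) //= big1 ?addr0 => [|k /negbTE kj].
    by rewrite eqxx mulr1 hdot_norm.
  by rewrite eq_sym kj mulr0 mul0r.
transitivity (\sum_j \sum_k \sum_i (op_entry M i j)^* * op_entry M i k * hdot H (y k) (y j)).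
  by apply: eq_bigr => j _; apply: eq_bigr => k _; rewrite mulr_suml.
under eq_bigr do rewrite exchange_big.
rewrite exchange_big; apply: eq_bigr => i _ /=.
rewrite hdot_norm hdot_sumr; apply: eq_bigr => j _; rewrite hdot_suml.
by apply: eq_bigr => k _; rewrite hdotZl hdotZr; ring.
Qed.

Lemma sum_CauchySchwarz (I : finType) (a b : I -> R[i]) (s t : R[i]) :
  (forall i, 0 <= a i) -> (forall i, 0 <= b i) -> 0 <= s -> 0 <= t ->
  \sum_i a i ^+ 2 <= s ^+ 2 -> \sum_i b i ^+ 2 <= t ^+ 2 ->
  \sum_i a i * b i <= s * t.
Proof.
move=> a0 b0 s0 t0 sa tb.
have ab0 : 0 <= \sum_i a i * b i by apply: sumr_ge0 => i _; rewrite mulr_ge0.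
have aR i : (a i)^* = a i by apply/CrealP; exact: ger0_real.
have bR i : (b i)^* = b i by apply/CrealP; exact: ger0_real.
pose f (k : bool) i := if k then a i else b i.
have pK : pd_kernel (fun k l => \sum_i f k i * f l i).
  move=> m g c.
  have : 0 <= \sum_i (\sum_k c k * f (g k) i)^* * (\sum_k c k * f (g k) i).
    by apply: sumr_ge0 => i _; rewrite mulrC mul_conjC_ge0.
  congr (0 <= _); transitivity (\sum_i \sum_k \sum_l (c k)^* * c l * (f (g k) i * f (g l) i)).
    apply: eq_bigr => i _; rewrite rmorph_sum mulr_suml; apply: eq_bigr => k _.
    rewrite mulr_sumr; apply: eq_bigr => l _; rewrite rmorphM /=.
    have -> : (f (g k) i)^* = f (g k) i by rewrite /f; case: (g k).
    ring.
  rewrite exchange_big; apply: eq_bigr => k _; rewrite exchange_big.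
  by apply: eq_bigr => l _; rewrite mulr_sumr.
have := pd_kernel_CauchySchwarz pK true false; rewrite (ger0_norm ab0) /f => h.
rewrite -(ler_pXn2r (n := 2)) ?nnegrE ?mulr_ge0 //; apply: le_trans h _.
rewrite exprMn; apply: ler_pM.
- by apply: sumr_ge0 => i _; rewrite mulr_ge0.
- by apply: sumr_ge0 => i _; rewrite mulr_ge0.
- by move: sa; congr (_ <= _); apply: eq_bigr => i _; rewrite expr2.
- by move: tb; congr (_ <= _); apply: eq_bigr => i _; rewrite expr2.
Qed.

Lemma column_map_norm M c : linear M -> op_norm_le M c -> op_norm_le (column_map M) c.
Proof.
move=> lM Mc; have [c0 _] := Mc; split=> // x.
apply: hnorm_le => [|z]; first by rewrite mulr_ge0.
rewrite column_map_dot.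
have -> : \sum_i \sum_j op_entry M i j * hdot H (W j x) (W i z) =
    \sum_i hdot H (\sum_j op_entry M i j *: W j x) (W i z).
  apply: eq_bigr => i _; rewrite hdot_suml; apply: eq_bigr => j _.
  by rewrite hdotZl.
apply: le_trans (ler_norm_sum _ _ _) _.
apply: le_trans (ler_sum _ (fun i _ => hdot_CauchySchwarz _ _)) _.
apply: sum_CauchySchwarz => //; first by rewrite mulr_ge0.
  apply: le_trans (matrix_amplification_norm _ lM Mc) _.
  by rewrite exprMn ler_wpM2l ?exprn_ge0.
Qed.

Lemma column_map_linear M : linear (column_map M).
Proof.
move=> a x y; rewrite /column_map scaler_sumr -big_split; apply: eq_bigr => i _ /=.
rewrite scaler_sumr -big_split; apply: eq_bigr => j _ /=.
have [WD WZ _] := linear_additive (lW j); have [W'D W'Z _] := linear_additive (lW' i).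
by rewrite WD WZ W'D W'Z scalerDr !scalerA mulrC.
Qed.

Lemma column_contraction i x : `|W i x| <= `|x|.
Proof.
rewrite -(ler_pXn2r (n := 2)) ?nnegrE //; apply: le_trans (W1 x).
by rewrite (bigD1 i) //= lerDl sumr_ge0 // => j _; rewrite exprn_ge0.
Qed.

Lemma column_adjoint_contraction i x : `|W' i x| <= `|x|.
Proof.
rewrite -[leRHS]mul1r -[leRHS]mul1r; apply: hnorm_le => [|z]; first by rewrite !mul1r.
rewrite hdotC -adW !mul1r -hdotC; apply: le_trans (hdot_CauchySchwarz _ _) _.
by rewrite ler_wpM2l // column_contraction.
Qed.

(** For positivity, the entries of all T k l form one scalar matrix indexed by pairs (k, i). It is
    positive by testing T on coordinate vectors, and is paired with the Gram matrix of the vectors W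
    i (x k). *)
Lemma column_map_ccp : ccp (@bounded_op R E) column_map.
Proof.
split.
- move=> M [lM _]; apply: (@bounded_opP _ _ _ (\sum_i \sum_j `|op_entry M i j|)).
    exact: column_map_linear.
  split; first by apply: sumr_ge0 => i _; apply: sumr_ge0 => j _.
  move=> x; rewrite /column_map mulr_suml.
  apply: le_trans (ler_norm_sum _ _ _) _; apply: ler_sum => i _.
  rewrite mulr_suml; apply: le_trans (ler_norm_sum _ _ _) _; apply: ler_sum => j _.
  rewrite normrZ ler_wpM2l //; apply: le_trans (column_adjoint_contraction _ _) _.
  exact: column_contraction.
- move=> a S T _ _; apply/funext => x; rewrite /column_map scaler_sumr -big_split.
  apply: eq_bigr => i _ /=; rewrite scaler_sumr -big_split; apply: eq_bigr => j _ /=.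
  by rewrite scalerA -scalerDl.
- move=> m T bT pT x.
  pose N (p q : 'I_m * 'I_n) := op_entry (T p.1 q.1) p.2 q.2.
  have pN : pd_kernel N.
    apply: pd_kernel_matrix => c.
    have := pT (fun k => fin_l2 (fun i => c (k, i))); congr (0 <= _).
    rewrite sum_pair.
    apply: eq_bigr => k _.
    transitivity (\sum_l \sum_i (T k l (fin_l2 (fun j => c (l, j)))) i * (c (k, i))^*).
      by apply: eq_bigr => l _; rewrite fin_l2_dot.
    rewrite exchange_big; apply: eq_bigr => i _ /=.
    rewrite sum_pair.
    apply: eq_bigr => l _; rewrite op_entryE; last by have [] := bT k l.
    by rewrite mulr_suml; apply: eq_bigr => j _; rewrite /N /=; ring.
  have := pd_kernel_sum_ge0 (fun p => p) pN
    (pd_kernel_comp (fun p : 'I_m * 'I_n => W p.2 (x p.1)) (@hdot_pd R H)).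
  congr (0 <= _).
  rewrite sum_pair.
  apply: eq_bigr => k _.
  transitivity (\sum_l \sum_i \sum_j op_entry (T k l) i j * hdot H (W j (x l)) (W i (x k))).
    rewrite [RHS]exchange_big; apply: eq_bigr => i _ /=.
    by rewrite sum_pair.
  by apply: eq_bigr => l _; rewrite column_map_dot.
- by move=> M c [lM _]; exact: column_map_norm.
Qed.

End ColumnMaps.

(** * The left regular representation and multiplication operators *)

Section Reindexing.
Variables (R : realType) (I : choiceType).

Lemma psumR_reindex_le (p : I -> R) (f : I -> I) : injective f -> summableR p ->
  (forall i, 0 <= p i) -> psumR (p \o f) <= psumR p.
Proof.
move=> fI sp p0; apply: psumR_le => [i|s us]; first exact: p0.
rewrite -(big_map f xpredT p); apply: ler_psumR => //.
by rewrite map_inj_uniq.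
Qed.

Lemma summableR_reindex (h : I -> R) (f : I -> I) : injective f -> summableR h ->
  summableR (h \o f).
Proof.
move=> fI sh; apply: (@summableR_bound _ _ _ (psumR (fun i => `|h i|))) => s us.
rewrite -(big_map f xpredT (fun i => `|h i|)); apply: ler_psumR => //.
  by apply: le_summableR sh => i; rewrite normr_id.
by rewrite map_inj_uniq.
Qed.

Lemma sumR_reindex (h : I -> R) (f g : I -> I) : cancel f g -> cancel g f ->
  summableR h -> sumR (h \o f) = sumR h.
Proof.
move=> fK gK sh; have fI := can_inj fK; have gI := can_inj gK.
have e (p : I -> R) : summableR p -> (forall i, 0 <= p i) -> psumR (p \o f) = psumR p.
  move=> sp p0; apply/eqP; rewrite eq_le psumR_reindex_le //=.
  have {1}-> : p = (p \o f) \o g by apply/funext => i; rewrite /= gK.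
  apply: psumR_reindex_le => //; last by move=> i; exact: p0.
  exact: summableR_reindex.
have smax (k : I -> R) : summableR k -> summableR (fun i => Num.max (k i) 0).
  apply: le_summableR => i; rewrite ger0_norm ?le_max ?lexx ?orbT //.
  by rewrite ge_max normr_ge0 ler_norm.
rewrite /sumR -(e _ (smax _ sh)); last by move=> i; rewrite le_max lexx orbT.
rewrite -(e _ (smax _ (summableRN sh))); last by move=> i; rewrite le_max lexx orbT.
by [].
Qed.

End Reindexing.

Section RegularRepresentation.
Variables (R : realType) (G : groupType).
Local Notation H := (l2_hilbert R G).
Local Notation lam := (@left_regular R G).

Lemma left_regularE g (x : H) h : lam g x h = x (g^-1 * h)%g.
Proof. by []. Qed.

Lemma left_regular_linear g : linear (lam g).
Proof. by move=> a x y; apply: l2P. Qed.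

Lemma left_regularM g h x : lam (g * h)%g x = lam g (lam h x).
Proof. by apply: l2P => s; rewrite /= invgM mulgA. Qed.

Lemma left_regular1 x : lam 1%g x = x.
Proof. by apply: l2P => s; rewrite /= invg1 mul1g. Qed.

Lemma left_regular_adjoint g x y : hdot H (lam g x) y = hdot H x (lam g^-1%g y).
Proof.
apply/eqP; rewrite eq_complex /=; apply/andP; split; apply/eqP.
  rewrite -[RHS](@sumR_reindex _ _ _ (fun h => g^-1 * h)%g (fun h => g * h)%g).
  - by congr sumR; apply/funext => h /=; rewrite invgK mulVKg.
  - exact: mulVKg.
  - exact: mulKg.
  - exact: (summable_Re x (lam g^-1%g y)).
rewrite -[RHS](@sumR_reindex _ _ _ (fun h => g^-1 * h)%g (fun h => g * h)%g).
- by congr sumR; apply/funext => h /=; rewrite invgK mulVKg.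
- exact: mulVKg.
- exact: mulKg.
- exact: (summable_Im x (lam g^-1%g y)).
Qed.

Lemma left_regular_dot g x y : hdot H (lam g x) (lam g y) = hdot H x y.
Proof. by rewrite left_regular_adjoint -left_regularM mulVg left_regular1. Qed.

Lemma left_regular_norm g x : `|lam g x| = `|x|.
Proof.
by apply/eqP; rewrite -(@eqrXn2 _ 2) // !hdot_norm left_regular_dot.
Qed.

Lemma left_regular_op_norm g : op_norm_le (lam g : H -> H) 1.
Proof. by split=> // x; rewrite left_regular_norm mul1r. Qed.

Lemma left_regular_delta g h : lam g (l2_delta R h) = l2_delta R (g * h)%g.
Proof.
by apply: l2P => s; rewrite left_regularE !l2_deltaE -(inj_eq (mulgI g)) mulVKg.
Qed.

Lemma left_regular_reduced g : reduced_Cstar (lam g : H -> H).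
Proof.
split; first by apply: (bounded_opP (left_regular_linear g) (left_regular_op_norm g)).
move=> e e0; exists [:: (1, g)]; split; first by rewrite ler0c ltW.
by move=> x; rewrite big_seq1 scale1r subrr normr0 mulr_ge0 // ler0c ltW.
Qed.

Fact mult_op_subproof (b : G -> R) (c : R) (x : H) : (forall t, `|b t| <= c) ->
  (fun t => (b t)%:C%C * x t) \in @l2_pred R G.
Proof.
move=> bc; rewrite inE /= /square_summable.
apply: le_summableR (summableRZ (c ^+ 2) (l2_summable x)) => t.
rewrite (ger0_norm (normsq_ge0 _)) (ger0_norm (mulr_ge0 (sqr_ge0 c) (normsq_ge0 (x t)))).
have -> : normsq ((b t)%:C%C * x t) = b t ^+ 2 * normsq (x t).
  by case: (x t) => u v; rewrite /normsq /=; ring.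
apply: ler_wpM2r; first exact: normsq_ge0.
have c0 : 0 <= c := le_trans (normr_ge0 _) (bc t).
by rewrite -[b t ^+ 2]real_normK ?num_real // ler_pXn2r ?nnegrE.
Qed.

Definition mult_op b c (bc : forall t, `|b t| <= c) (x : H) : H := L2 (mult_op_subproof x bc).

Section MultOp.
Variables (b : G -> R) (c : R) (bc : forall t, `|b t| <= c).

Lemma mult_opE x t : mult_op bc x t = (b t)%:C%C * x t.
Proof. by []. Qed.

Lemma mult_op_linear : linear (mult_op bc).
Proof.
move=> z x y; apply: l2P => t; rewrite -[LHS]/((b t)%:C%C * (z * x t + y t)).
rewrite -[RHS]/(z * ((b t)%:C%C * x t) + (b t)%:C%C * y t); ring.
Qed.

Lemma mult_op_adjoint x y : hdot H (mult_op bc x) y = hdot H x (mult_op bc y).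
Proof.
apply/eqP; rewrite eq_complex /=; apply/andP; split; apply/eqP; congr sumR;
  by apply/funext => t /=; case: (x t) (y t) => [? ?] [? ?] /=; ring.
Qed.

Lemma mult_op_norm x : `|mult_op bc x| <= c%:C%C * `|x|.
Proof.
have c0 : 0 <= c := le_trans (normr_ge0 _) (bc 1%g).
have -> : c%:C%C * `|x| = `|c%:C%C *: x|.
  by rewrite normrZ [`|c%:C%C|]ger0_norm // ler0c.
apply: l2_le_norm => t; rewrite mult_opE.
have -> : (c%:C%C *: x : l2 R G) t = c%:C%C * x t by [].
have h r : normsq (r%:C%C * x t) = r ^+ 2 * normsq (x t).
  by case: (x t) => u v; rewrite /normsq /=; ring.
rewrite !h; apply: ler_wpM2r; first exact: normsq_ge0.
by rewrite -[b t ^+ 2]real_normK ?num_real // ler_pXn2r ?nnegrE.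
Qed.

End MultOp.
End RegularRepresentation.

(** * Property A *)

Lemma ler_sum_supp (R : realType) (T : eqType) (h : T -> R) (s F : seq T) : uniq s -> uniq F ->
  (forall x, 0 <= h x) -> (forall x, h x != 0 -> x \in F) ->
  \sum_(x <- s) h x <= \sum_(x <- F) h x.
Proof.
move=> us uF h0 hF; rewrite [leLHS](bigID (fun x => x \in F)) /=.
rewrite [X in _ + X]big1 => [|x]; last by apply: contraNeq => /hF.
rewrite addr0 [leRHS](bigID (fun x => x \in s)) /=.
rewrite -big_filter -[X in _ <= X + _]big_filter.
rewrite (perm_big [seq i <- F | i \in s]) /= => [|]; last first.
  by apply: uniq_perm; rewrite ?filter_uniq // => x; rewrite !mem_filter andbC.
by rewrite lerDl sumr_ge0.
Qed.

Section PropertyA.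
Variables (R : realType) (G : groupType).

(* A form of Yu's property A, that is of exactness of G in the sense of
   Kirchberg and Wassermann, by Ozawa's theorem.  In the usual notation,
   a t f = xi_t (t^-1 f) for a unit vector xi_t of l^2(G) supported in t^-1 F. *)
Definition property_A : Prop :=
  forall (E : seq G) (e : R), 0 < e -> exists (F : seq G) (a : G -> G -> R),
  [/\ uniq F, forall t f, 0 <= a t f, forall t f, a t f != 0 -> f \in F,
      forall t, \sum_(f <- F) a t f ^+ 2 <= 1
    & forall g t, g \in E -> 1 - e <= \sum_(f <- F) a t f * a (g * t)%g (g * f)%g].

End PropertyA.

(** * Property A implies exactness *)

Section PropertyAExact.
Variables (R : realType) (G : groupType).
Local Notation H := (l2_hilbert R G).
Local Notation lam := (@left_regular R G).
Variables (F : seq G) (a : G -> G -> R).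
Hypotheses (uF : uniq F) (a0 : forall t f, 0 <= a t f).
Hypothesis aF : forall t f, a t f != 0 -> f \in F.
Hypothesis a1 : forall t, \sum_(f <- F) a t f ^+ 2 <= 1.
Let n := size F.
Local Notation E := (l2_hilbert R 'I_n).
Let fn (i : 'I_n) : G := nth 1%g F i.

Let fn_inj : injective fn.
Proof.
by move=> i j /eqP; rewrite nth_uniq // => /eqP/val_inj.
Qed.

Let sum_fn (V : nmodType) (h : G -> V) : \sum_(f <- F) h f = \sum_i h (fn i).
Proof. by rewrite (big_nth 1%g) big_mkord. Qed.

Let a_le1 f t : `|a t f| <= 1.
Proof.
rewrite ger0_norm //; have [->//|/aF fF] := eqVneq (a t f) 0.
rewrite -(@expr_le1 _ 2) //; apply: le_trans (a1 t).
by rewrite (bigD1_seq f) //= lerDl sumr_ge0 // => x _; exact: sqr_ge0.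
Qed.

Definition coordinate_embedding (x : E) : H := \sum_i x i *: (l2_delta R (fn i) : H).
Definition coordinate_restriction (y : H) : E := fin_l2 (fun i => y (fn i)).

(* (W_f x) y = a(f y, f) x(f y) defines a column contraction; for M the
   compression of lam_g to F, sum_ij M_ij W_i^* W_j is lam_g multiplied by the
   function sum_f a(t, f) a(g t, g f), which is close to 1. *)
Let mulA f : H -> H := mult_op (a_le1 f).
Let W (i : 'I_n) (x : H) : H := lam (fn i)^-1%g (mulA (fn i) x).
Let W' (i : 'I_n) (x : H) : H := mulA (fn i) (lam (fn i) x).

Let emb_linear : linear coordinate_embedding.
Proof.
move=> c x y; rewrite /coordinate_embedding scaler_sumr -big_split.
by apply: eq_bigr => i _ /=; rewrite scalerA -scalerDl.
Qed.

Let restr_linear : linear coordinate_restriction.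
Proof. by move=> c x y; apply: l2P. Qed.

Let emb_adjoint x y :
  hdot H (coordinate_embedding x) y = hdot E x (coordinate_restriction y).
Proof.
rewrite hdot_suml fin_l2_dot; apply: eq_bigr => i _.
by rewrite hdotZl hdotC [hdot _ _ _]l2_dot_deltar.
Qed.

Let embE (x : E) i : coordinate_embedding x (fn i) = x i.
Proof.
rewrite l2_val_sum (bigD1 i) //= big1 => [|j ji].
  by rewrite addr0 -[LHS]/(x i * (fn i == fn i)%:R) eqxx mulr1.
rewrite -[LHS]/(x j * (fn i == fn j)%:R) (inj_eq fn_inj) eq_sym (negbTE ji).
by rewrite mulr0.
Qed.

Let emb_norm x : `|coordinate_embedding x| <= `|x|.
Proof.
rewrite -(@ler_pXn2r _ 2) ?nnegrE // !hdot_norm emb_adjoint.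
suff -> : coordinate_restriction (coordinate_embedding x) = x by [].
by apply: l2P => i; exact: embE.
Qed.

Let restr_norm y : `|coordinate_restriction y| <= `|y|.
Proof.
rewrite -[leRHS]mul1r -[leRHS]mul1r; apply: hnorm_le => [|z]; first by rewrite !mul1r.
rewrite hdotC -emb_adjoint !mul1r -hdotC; apply: le_trans (hdot_CauchySchwarz _ _) _.
by rewrite ler_wpM2l.
Qed.

Let W_linear i : linear (W i).
Proof. by move=> c x y; rewrite /W /mulA mult_op_linear left_regular_linear. Qed.

Let W'_linear i : linear (W' i).
Proof. by move=> c x y; rewrite /W' left_regular_linear /mulA mult_op_linear. Qed.

Let W_adjoint i x y : hdot H (W i x) y = hdot H x (W' i y).
Proof. by rewrite left_regular_adjoint invgK mult_op_adjoint. Qed.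

(** The operators W_i^* W_i are multiplications, and they add up to multiplication by t |-> sum_f
    a(t, f)^2 <= 1. *)
Let W_column x : \sum_i `|W i x| ^+ 2 <= `|x| ^+ 2.
Proof.
have e i : `|W i x| ^+ 2 = hdot H (mulA (fn i) (mulA (fn i) x)) x.
  by rewrite left_regular_norm hdot_norm -mult_op_adjoint.
under eq_bigr do rewrite e.
have := hdot_CauchySchwarz (\sum_i mulA (fn i) (mulA (fn i) x) : H) x.
rewrite hdot_suml ger0_norm; last first.
  by apply: sumr_ge0 => i _; rewrite -e exprn_ge0.
move=> h; apply: le_trans h _; rewrite expr2 ler_wpM2r //.
apply: l2_le_norm => t; rewrite l2_val_sum.
have -> : \sum_i mulA (fn i) (mulA (fn i) x) t = (\sum_i a t (fn i) ^+ 2)%:C%C * x t.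
  rewrite rmorph_sum mulr_suml; apply: eq_bigr => i _.
  by rewrite !mult_opE rmorphXn /=; ring.
have : 0 <= \sum_i a t (fn i) ^+ 2 by apply: sumr_ge0 => i _; exact: sqr_ge0.
have := a1 t; rewrite sum_fn; move: (\sum_i _) => r r1 r0.
have -> : normsq (r%:C%C * x t) = r ^+ 2 * normsq (x t).
  by case: (x t) => u v; rewrite /normsq /=; ring.
by rewrite ler_piMl ?normsq_ge0 // expr_le1.
Qed.

Let Phi : (H -> H) -> (E -> E) := compression coordinate_embedding coordinate_restriction.
Let Psi : (E -> E) -> (H -> H) := column_map W W'.

Lemma property_A_ccp : ccp (@reduced_Cstar R G) Phi /\ ccp (@bounded_op R E) Psi.
Proof.
split; last exact: column_map_ccp.
by apply: compression_ccp => // T [].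
Qed.

Lemma property_A_norm T c : linear T -> op_norm_le T c -> op_norm_le (Psi (Phi T)) c.
Proof.
move=> lT Tc; apply: column_map_norm => //; last exact: compression_norm.
by move=> b x y; rewrite /Phi /compression /= emb_linear lT restr_linear.
Qed.

Lemma property_A_linear (c : R[i]) S T :
  Psi (Phi (fun x => c *: S x + T x)) = fun x => c *: Psi (Phi S) x + Psi (Phi T) x.
Proof.
apply/funext => x; rewrite /Psi /column_map scaler_sumr -big_split.
apply: eq_bigr => i _ /=; rewrite scaler_sumr -big_split; apply: eq_bigr => j _ /=.
by rewrite scalerA -scalerDl.
Qed.

Lemma property_A_sum (s : seq (R[i] * G)) :
  Psi (Phi (fun x => \sum_(p <- s) p.1 *: lam p.2 x)) =
  fun x => \sum_(p <- s) p.1 *: Psi (Phi (lam p.2)) x.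
Proof.
elim: s => [|p s IHs].
  apply/funext => x; rewrite big_nil /Psi /column_map big1 // => i _; rewrite big1 // => j _.
  rewrite (_ : op_entry _ i j = 0) ?scale0r //.
  by rewrite /op_entry /Phi /compression /= big_nil.
have -> : (fun x => \sum_(p <- p :: s) p.1 *: lam p.2 x : H) =
  (fun x => p.1 *: lam p.2 x + \sum_(p <- s) p.1 *: lam p.2 x).
  by apply/funext => x; rewrite big_cons.
by rewrite property_A_linear IHs; apply/funext => x; rewrite big_cons.
Qed.

Let kap g t := \sum_(f <- F) a t f * a (g * t)%g (g * f)%g.

(** By 2uv <= u^2 + v^2; translating F by g can only lose part of the support of a(gt, -). *)
Lemma property_A_le1 g t : kap g t <= 1.
Proof.
have h : \sum_(f <- F) a (g * t)%g (g * f)%g ^+ 2 <= 1.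
  apply: le_trans (a1 (g * t)%g).
  rewrite -(big_map (fun f => g * f)%g xpredT (fun f => a (g * t)%g f ^+ 2)).
  apply: ler_sum_supp => //.
  - by rewrite map_inj_uniq //; exact: mulgI.
  - by move=> x; exact: sqr_ge0.
  - by move=> x; rewrite sqrf_eq0 => /aF.
have := lerD (a1 t) h; rewrite -big_split /= => h2.
have : 2 * kap g t <= 1 + 1.
  apply: le_trans h2; rewrite mulr_sumr; apply: ler_sum => f _.
  by have := sqr_ge0 (a t f - a (g * t)%g (g * f)%g); nra.
lra.
Qed.

(** The entry (i, j) of the compressed translation is 1 exactly if f_i = g f_j, so the double sum
    collapses to one over f = f_j. If g f leaves F, the term of [kap] vanishes too, as a(s, g f) =
    0. *)
Lemma property_A_translation g x s :
  Psi (Phi (lam g)) x s = (kap g (g^-1 * s)%g)%:C%C * lam g x s.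
Proof.
rewrite /Psi /column_map l2_val_sum.
have ent i j : op_entry (Phi (lam g)) i j = (fn i == g * fn j)%g%:R.
  transitivity (coordinate_embedding (fin_delta R j) (g^-1 * fn i)%g); first by [].
  rewrite l2_val_sum (bigD1 j) //= big1 => [|k kj].
    rewrite addr0 -[LHS]/((j == j)%:R * (g^-1 * fn i == fn j)%g%:R) eqxx mul1r.
    by rewrite -[in LHS](inj_eq (mulgI g)) mulVKg.
  by rewrite -[LHS]/((k == j)%:R * (g^-1 * fn i == fn k)%g%:R) (negbTE kj) mul0r.
have val i j : (op_entry (Phi (lam g)) i j *: W' i (W j x)) s =
    ((fn i == g * fn j)%g%:R * (a (g^-1 * s)%g (fn j) * a s (fn i)))%:C%C * lam g x s.
  transitivity ((op_entry (Phi (lam g)) i j) * ((a s (fn i))%:C%C *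
    ((a ((fn j)^-1^-1 * ((fn i)^-1 * s))%g (fn j))%:C%C *
      x ((fn j)^-1^-1 * ((fn i)^-1 * s))%g))); first by [].
  rewrite ent left_regularE; have [->|_] := eqVneq (fn i) (g * fn j)%g; last by rewrite !mul0r.
  have -> : ((fn j)^-1^-1 * ((g * fn j)^-1 * s) = g^-1 * s)%g.
    by rewrite invgK invgM !mulgA mulgV mul1g.
  by rewrite !mul1r rmorphM /=; ring.
transitivity (\sum_j \sum_i (op_entry (Phi (lam g)) i j *: W' i (W j x)) s).
  by rewrite exchange_big; apply: eq_bigr => i _; rewrite l2_val_sum.
rewrite /kap sum_fn rmorph_sum mulr_suml; apply: eq_bigr => j _.
rewrite (eq_bigr _ (fun i _ => val i j)).
rewrite -mulr_suml -rmorph_sum -(sum_fn (fun f =>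
  (f == g * fn j)%g%:R * (a (g^-1 * s)%g (fn j) * a s f))).
rewrite (@sum_single _ _ _ (g * fn j)%g _ uF) => [|f /negbTE ->]; last by rewrite mul0r.
rewrite eqxx mul1r mulVKg; case: ifPn => // gF.
suff -> : a s (g * fn j)%g = 0 by rewrite mulr0.
by apply: contraNeq gF => /aF.
Qed.

Lemma property_A_factorization : exists m (phi : (H -> H) -> (l2_hilbert R 'I_m -> l2_hilbert R 'I_m))
  (psi : (l2_hilbert R 'I_m -> l2_hilbert R 'I_m) -> (H -> H)),
  [/\ ccp (@reduced_Cstar R G) phi /\ ccp (@bounded_op R _) psi,
      forall T c, linear T -> op_norm_le T c -> op_norm_le (psi (phi T)) c,
      forall c S T, psi (phi (fun x => c *: S x + T x)) =
        fun x => c *: psi (phi S) x + psi (phi T) x,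
      forall s : seq (R[i] * G), psi (phi (fun x => \sum_(p <- s) p.1 *: lam p.2 x)) =
        fun x => \sum_(p <- s) p.1 *: psi (phi (lam p.2)) x
    & forall g x s, psi (phi (lam g)) x s =
        (\sum_(f <- F) a (g^-1 * s)%g f * a s (g * f)%g)%:C%C * lam g x s].
Proof.
exists n, Phi, Psi; split.
- exact: property_A_ccp.
- exact: property_A_norm.
- exact: property_A_linear.
- exact: property_A_sum.
- by move=> g x s; rewrite property_A_translation /kap mulVKg.
Qed.

End PropertyAExact.

Lemma real_norm (R : realType) (z : R[i]) : ((complex.Re `|z|)%:C)%C = `|z|.
Proof. by rewrite RRe_real // normr_real. Qed.

Lemma finite_set_list (T : Type) (A : set T) : finite_set A ->
  exists s : seq {classic T}, forall x, A x -> x \in s.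
Proof.
move=> fA; have [s sE] := (@finite_seqP {classic T} A).1 fA.
by exists s => x Ax; have : [set` s] x by rewrite -sE.
Qed.

(** The identity representation is nuclear. T is within e/3 of a group ring element V; the
    factorization does not increase the norm of T - V, and moves V by at most e/3 because it
    multiplies each translation by a function close to 1. *)
Lemma property_A_exact (R : realType) (G : groupType) :
  property_A R G -> exact_group R G.
Proof.
move=> pA; pose H := l2_hilbert R G.
exists H, id; split.
  by split=> // T [].
move=> S e fS SA e0; have e30 : 0 < e / 3 by rewrite divr_gt0.
have /choice[c cP] (T : H -> H) : exists s : seq (R[i] * G), S T ->
    op_norm_le (fun x => T x - \sum_(p <- s) p.1 *: @left_regular R G p.2 x) ((e / 3)%:C)%C.
  have [ST|nST] := pselect (S T); last by exists [::].
  by have [_ /(_ _ e30)[s sP]] := SA T ST; exists s.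
have [l lP] := finite_set_list fS.
pose M (T : H -> H) : R := \sum_(p <- c T) complex.Re `|p.1|.
have M0 T : 0 <= M T by apply: sumr_ge0 => p _; have := normr_ge0 p.1; rewrite -(real_norm p.1) ler0c real_norm.
(* A common bound for the l^1 norms of the coefficients; the 1 keeps it positive when all of them
   vanish. *)
pose N := 1 + \sum_(T <- l) M T.
have N0 : 0 < N by rewrite ltr_pwDl // sumr_ge0.
have MN T : S T -> M T <= N.
  move=> /lP Tl; rewrite /N (big_rem T) //= addrCA lerDl addr_ge0 //.
  by rewrite sumr_ge0.
have d0 : 0 < e / 3 / N by rewrite divr_gt0.
have [F [a [uF a0 aF a1 aE]]] := pA (flatten [seq [seq p.2 | p <- c T] | T <- l]) _ d0.
have [n [phi [psi [[ccphi ccpsi] nrm lin sm tr]]]] := property_A_factorization uF a0 aF a1.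
exists n, phi, psi; split=> // T ST.
pose V x : H := \sum_(p <- c T) p.1 *: @left_regular R G p.2 x.
have [[lT _] _] := SA T ST.
have lV : linear V.
  move=> b x y; rewrite /V scaler_sumr -big_split; apply: eq_bigr => p _ /=.
  by rewrite left_regular_linear scalerDr !scalerA mulrC.
pose D x := (-1) *: V x + T x.
have DE x : D x = T x - V x by rewrite /D scaleN1r addrC.
have lD : linear D.
  move=> b x y; rewrite !DE lT lV scalerBr opprD addrACA -scalerBr.
  by rewrite scalerBr.
have nD : op_norm_le D ((e / 3)%:C)%C.
  by have [h0 h] := cP T ST; split=> // x; rewrite DE.
have [_ n1] := nrm D _ lD nD; have [_ n2] := nD.
split; first by rewrite ler0c ltW.
move=> x.
have n3 : `|psi (phi V) x - V x| <= ((e / 3)%:C)%C * `|x|.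
  rewrite sm /V -sumrB; apply: le_trans (ler_norm_sum _ _ _) _.
  apply: (@le_trans _ _ (\sum_(p <- c T) `|p.1| * (((e / 3 / N)%:C)%C * `|x|))); last first.
    rewrite -mulr_suml mulrA ler_wpM2r //.
    have -> : \sum_(p <- c T) `|p.1| = ((M T)%:C)%C.
      by rewrite /M rmorph_sum; apply: eq_bigr => p _; exact/esym/real_norm.
    rewrite -rmorphM lecR mulrA ler_pdivrMr // mulrC ler_wpM2l ?MN //; exact: ltW.
  rewrite big_seq [leRHS]big_seq; apply: ler_sum => p pT.
  rewrite -scalerBr normrZ ler_wpM2l // -(left_regular_norm p.2 x).
  have b1 t : `|\sum_(f <- F) a (p.2^-1 * t)%g f * a t (p.2 * f)%g - 1| <= e / 3 / N.
    have h := property_A_le1 uF aF a1 p.2 (p.2^-1 * t)%g.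
    have pE : p.2 \in flatten [seq [seq p.2 | p <- c T] | T <- l].
      apply/flatten_mapP; exists T; first exact: lP.
      by apply/mapP; exists p.
    have := aE _ (p.2^-1 * t)%g pE.
    rewrite mulVKg in h *; move: (\sum_(f <- F) _) h => z z1 zd.
    by rewrite ler_norml; apply/andP; split; lra.
  apply: le_trans (mult_op_norm b1 (left_regular p.2 x : H)).
  rewrite le_eqVlt; apply/orP; left; apply/eqP; congr `|_|.
  apply: l2P => t; transitivity (psi (phi (left_regular p.2)) x t - (left_regular p.2 x : H) t).
    by [].
  by rewrite tr mult_opE rmorphB /= mulrBl mul1r.
have TE : T = fun x => 1 *: V x + D x.
  by apply/funext => y; rewrite scale1r DE addrC subrK.
have -> : psi (phi T) x - T x = (psi (phi V) x - V x) + (psi (phi D) x - D x).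
  by rewrite {1}TE lin scale1r DE [RHS]addrACA opprB addKr.
have -> : (e%:C)%C * `|x| = ((e / 3)%:C)%C * `|x| + (((e / 3)%:C)%C * `|x| + ((e / 3)%:C)%C * `|x|).
  rewrite -!mulrDl -!rmorphD; congr (_%:C%C * _); by field.
apply: le_trans (ler_normD _ _) _; apply: lerD => //.
by apply: le_trans (ler_normB _ _) _; apply: lerD.
Qed.

(** * Exactness implies property A *)

(* Membership in the closure of a convex cone, tested on linear functionals:
   a point c0 of the cone nearly minimizing the distance to w yields the
   functional X = w - c0, which is almost nonpositive on the cone and almost
   zero at c0. *)
Lemma cone_approx (R : realType) (J : finType) (T : Type) (c : T -> J -> R) (N : T -> R)
    (w : J -> R) (n : R) :
  0 <= n -> (forall x, 0 <= N x) -> (forall x p, `|c x p| <= N x) ->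
  (forall x t, 0 <= t -> exists y, forall p, c y p = t * c x p) ->
  (forall (X : J -> R) k, 0 <= k -> (forall x, \sum_p c x p * X p <= k * N x) ->
     \sum_p w p * X p <= k * n) ->
  forall e : R, 0 < e -> exists s : seq T, forall p, `|w p - \sum_(x <- s) c x p| <= e.
Proof.
move=> n0 N0 cN cZ cP e e0.
pose S (s : seq T) p := \sum_(x <- s) c x p.
pose D (s : seq T) := \sum_p (w p - S s p) ^+ 2.
have D0 s : 0 <= D s by apply: sumr_ge0 => p _; exact: sqr_ge0.
have [[s Ds]|noS] := pselect (exists s, D s <= e ^+ 2).
  exists s => p; rewrite -(@ler_pXn2r _ 2) ?nnegrE ?(ltW e0) //.
  rewrite real_normK ?num_real //; apply: le_trans Ds.
  by rewrite /D (bigD1 p) //= lerDl sumr_ge0 // => q _; exact: sqr_ge0.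
have De s : e ^+ 2 <= D s by rewrite leNgt; apply/negP => /ltW h; apply: noS; exists s.
exfalso.
pose DD := [set D s | s in [set: seq T]].
have hD : has_inf DD.
  by split; [exists (D [::]), [::]|exists 0 => _ [s _ <-]].
pose d := inf DD.
have dle s : d <= D s by apply: ge_inf; [exact: hD.2|exists s].
have SZ s t : 0 <= t -> exists s', forall p, S s' p = t * S s p.
  move=> t0; elim: s => [|x s [s' IHs]]; first by exists [::] => p; rewrite /S big_nil mulr0.
  have [y yP] := cZ x t t0; exists (y :: s') => p.
  by have := IHs p; rewrite /S !big_cons yP mulrDr => ->.
pose sq (f : J -> R) := \sum_p f p ^+ 2.
(* The two terms bound, up to the factor th, the products of X with w and with - S s. Thus D s <= th
   K < e^2, against [De]. *)
pose K := (1 + (#|J|)%:R) * n / 2 + (1 + (2 * sq w + 2 * (d + 1))) / 2.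
have sq0 f : 0 <= sq f by apply: sumr_ge0 => p _; exact: sqr_ge0.
have d0 : 0 <= d by apply: lb_le_inf => [|_ [s _ <-]]; [exact: hD.1|exact: D0].
have K0 : 0 < K.
  have h : 0 <= (1 + (#|J|)%:R) * n / 2 by rewrite !mulr_ge0 // addr_ge0.
  by have := sq0 w; rewrite /K; lra.
pose th := Num.min (1 / 2) (e ^+ 2 / K / 2).
have e20 : 0 < e ^+ 2 by rewrite exprn_gt0.
have th0 : 0 < th by rewrite lt_min !divr_gt0.
have th1 : th <= 1 / 2 by rewrite ge_min lexx.
have thK : th * K < e ^+ 2.
  apply: (@le_lt_trans _ _ (e ^+ 2 / 2)); last by lra.
  by rewrite -ler_pdivlMr // mulrAC ge_min lexx orbT.
have [_ [s _ <-] Ds] := @inf_adherent _ DD (th ^+ 2) (exprn_gt0 2 th0) hD.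
rewrite -/d in Ds.
pose X p := w p - S s p.
have Dmv (f : J -> R) t : \sum_p (X p - t * f p) ^+ 2 =
    D s - 2 * t * \sum_p f p * X p + t ^+ 2 * sq f.
  rewrite /D /sq !mulr_sumr -sumrB -big_split; apply: eq_bigr => p _ /=.
  by rewrite /X; ring.
(* Compares s with s enlarged by the multiple th / N x of c x: since D s < d + th^2, this step
   cannot lower D by more than th^2. *)
have gen x : \sum_p c x p * X p <= th * (1 + (#|J|)%:R) / 2 * N x.
  have [Nx0|Nx0] := eqVneq (N x) 0.
    rewrite Nx0 mulr0 big1 // => p _; have := cN x p; rewrite Nx0 normr_le0 => /eqP ->.
    by rewrite mul0r.
  have Npos : 0 < N x by rewrite lt_neqAle eq_sym Nx0 N0.
  have [y yP] := cZ x (th / N x) (ltW (divr_gt0 th0 Npos)).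
  have := dle (y :: s).
  have -> : D (y :: s) = \sum_p (X p - th / N x * c x p) ^+ 2.
    by apply: eq_bigr => p _; rewrite /S big_cons yP /X /S; congr (_ ^+ 2); ring.
  rewrite Dmv; set u := \sum_p _.
  have cxx : sq (c x) <= (#|J|)%:R * N x ^+ 2.
    rewrite mulr_natl -sumr_const; apply: ler_sum => p _.
    by rewrite -[c x p ^+ 2]real_normK ?num_real // ler_pXn2r ?nnegrE.
  move=> h.
  have h2 : 2 * (th / N x) * u <= th ^+ 2 + (th / N x) ^+ 2 * ((#|J|)%:R * N x ^+ 2).
    have : (th / N x) ^+ 2 * sq (c x) <= (th / N x) ^+ 2 * ((#|J|)%:R * N x ^+ 2).
      by apply: ler_wpM2l => //; exact: sqr_ge0.
    lra.
  have e1 : th * (1 + (#|J|)%:R) / 2 * N x =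
     (th ^+ 2 + (th / N x) ^+ 2 * ((#|J|)%:R * N x ^+ 2)) / (2 * (th / N x)).
    by field; rewrite Nx0 gt_eqF.
  rewrite e1 ler_pdivlMr; last by rewrite mulr_gt0 // divr_gt0.
  by rewrite [u * _]mulrC.
have w1 : \sum_p w p * X p <= th * (1 + (#|J|)%:R) / 2 * n.
  by apply: cP => //; rewrite divr_ge0 // mulr_ge0 ?(ltW th0) // addr_ge0.
(* The same comparison, with s shrunk by the factor 1 - th. *)
have w2 : - \sum_p S s p * X p <= th * (1 + sq (S s)) / 2.
  have t10 : 0 <= 1 - th by lra.
  have [s' sP] := SZ s (1 - th) t10.
  have := dle s'.
  have -> : D s' = \sum_p (X p - (- th) * S s p) ^+ 2.
    by apply: eq_bigr => p _; rewrite sP /X; congr (_ ^+ 2); ring.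
  rewrite Dmv; set u := \sum_p _ => h.
  have : 2 * th * (- u) <= th ^+ 2 * (1 + sq (S s)) by lra.
  have -> : th * (1 + sq (S s)) / 2 = th ^+ 2 * (1 + sq (S s)) / (2 * th).
    by field; rewrite gt_eqF.
  rewrite ler_pdivlMr; last by rewrite mulr_gt0.
  by rewrite [(- u) * _]mulrC.
have sqS : sq (S s) <= 2 * sq w + 2 * D s.
  rewrite /sq /D !mulr_sumr -big_split; apply: ler_sum => p _ /=.
  by have := sqr_ge0 (2 * w p - S s p); nra.
have DsE : D s = \sum_p w p * X p - \sum_p S s p * X p.
  by rewrite -sumrB; apply: eq_bigr => p _; rewrite /X; ring.
have th21 : th ^+ 2 <= 1.
  by rewrite expr_le1 ?(ltW th0) //; lra.
have : D s <= th * K.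
  apply: le_trans (_ : _ <= th * (1 + (#|J|)%:R) / 2 * n + th * (1 + sq (S s)) / 2) _.
    by rewrite DsE lerD.
  have : th * (sq (S s)) <= th * (2 * sq w + 2 * (d + 1)).
    apply: ler_wpM2l; first exact: ltW.
    by apply: le_trans sqS _; lra.
  rewrite /K; set z := sq (S s); set y := sq w; set j := (#|J|)%:R.
  have -> : th * ((1 + j) * n / 2 + (1 + (2 * y + 2 * (d + 1))) / 2) =
     th * (1 + j) / 2 * n + (th + th * (2 * y + 2 * (d + 1))) / 2 by field.
  have -> : th * (1 + z) / 2 = (th + th * z) / 2 by field.
  by move: (th * z) (th * (2 * y + _)) => p q; lra.
by have := De s; lra.
Qed.

Section RealNorm.
Variables (R : realType) (H : hilbertSpace R).
Implicit Types (x y : H).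

(** The norm as a real number, so that linear and nonlinear real arithmetic apply. *)
Definition hn x : R := complex.Re `|x|.

Lemma hnE x : `|x| = ((hn x)%:C)%C.
Proof. by have [r _ xE] := hnorm_real x; rewrite /hn xE. Qed.

Lemma hn_ge0 x : 0 <= hn x.
Proof. by rewrite -ler0c -hnE. Qed.

Lemma hdot_hn x : hdot H x x = ((hn x ^+ 2)%:C)%C.
Proof. by rewrite -hdot_norm hnE rmorphXn. Qed.

Lemma hn_triangle x y : hn (x + y) <= hn x + hn y.
Proof. by rewrite -lecR rmorphD /= -!hnE ler_normD. Qed.

Lemma Re_le_norm (z : R[i]) : `|complex.Re z| <= complex.Re `|z|.
Proof. by rewrite -lecR real_norm; exact: normc_ge_Re. Qed.

Lemma Im_le_norm (z : R[i]) : `|complex.Im z| <= complex.Re `|z|.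
Proof.
case: z => a b; rewrite normc_def /= -sqrtr_sqr ler_wsqrtr //.
by rewrite lerDr sqr_ge0.
Qed.

Lemma hdot_CS_real x y : complex.Re `|hdot H x y| <= hn x * hn y.
Proof. by rewrite -lecR real_norm rmorphM /= -!hnE hdot_CauchySchwarz. Qed.

End RealNorm.

(** * Finitely supported vectors and group ring operators *)

Section Truncation.
Variables (R : realType) (G : groupType).
Local Notation H := (l2_hilbert R G).

Fact indicator_le1 (S : seq G) t : `|(t \in S)%:R : R| <= 1.
Proof. by rewrite normr_nat lern1 leq_b1. Qed.

Definition truncation (S : seq G) : H -> H := mult_op (indicator_le1 S).

Lemma truncationE S x t : truncation S x t = if t \in S then x t else 0.
Proof. by rewrite mult_opE; case: ifP => _; rewrite ?rmorph1 ?mul1r ?rmorph0 ?mul0r. Qed.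

Lemma truncation_hn S x : hn (truncation S x) <= hn x.
Proof.
rewrite -lecR -!hnE; have := mult_op_norm (indicator_le1 S) x.
by rewrite rmorph1 mul1r.
Qed.

(** S nearly attains the supremum that defines the squared norm of x. *)
Lemma truncation_approx (x : H) (e : R) : 0 < e ->
  exists S, hn (x - truncation S x) <= e.
Proof.
move=> e0; have [S uS hS] : exists2 S, uniq S & l2_norm2 x - e ^+ 2 <= \sum_(t <- S) normsq (x t).
  apply: contrapT => h.
  have : l2_norm2 x <= l2_norm2 x - e ^+ 2.
    apply: psumR_le => [t|S uS]; first exact: normsq_ge0.
    by rewrite leNgt; apply/negP => /ltW h'; apply: h; exists S.
  by rewrite -subr_ge0 addrAC subrr sub0r oppr_ge0 leNgt exprn_gt0.
exists S; rewrite -lecR -hnE; apply: l2_norm_le => [|s us]; first exact: ltW.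
have e1 t : normsq ((x - truncation S x) t) = if t \in S then 0 else normsq (x t).
  have -> : (x - truncation S x) t = x t - truncation S x t by [].
  rewrite truncationE; case: ifP => _; last by rewrite subr0.
  by rewrite subrr /normsq /= expr0n addr0.
under eq_bigr do rewrite e1.
rewrite (bigID (fun t => t \in S)) /= big1 => [|t ->//]; rewrite add0r.
have := @ler_psumR _ _ _ (S ++ [seq t <- s | t \notin S]) (l2_summable x) (fun i => normsq_ge0 _).
rewrite cat_uniq uS filter_uniq // andbT => /(_ _)/wrap[|].
  by apply/hasPn => t; rewrite mem_filter => /andP[].
rewrite big_cat big_filter /= -/(l2_norm2 x) => h.
have -> : \sum_(t <- s | t \notin S) (if t \in S then 0 else normsq (x t)) =
    \sum_(t <- s | t \notin S) normsq (x t).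
  by apply: eq_bigr => t /negbTE ->.
by move: hS h; move: (\sum_(t <- S) _) (\sum_(t <- s | _) _) => u v; lra.
Qed.

End Truncation.

Section GroupRingOperators.
Variables (R : realType) (G : groupType).
Local Notation H := (l2_hilbert R G).
Local Notation lam := (@left_regular R G).

Definition group_ring_op (s : seq (R[i] * G)) (x : H) : H :=
  \sum_(p <- s) p.1 *: lam p.2 x.

Lemma group_ring_op_linear s : linear (group_ring_op s).
Proof.
move=> b x y; rewrite /group_ring_op scaler_sumr -big_split; apply: eq_bigr => p _ /=.
by rewrite left_regular_linear scalerDr !scalerA mulrC.
Qed.

Lemma group_ring_op_reduced s : reduced_Cstar (group_ring_op s).
Proof.
split.
  apply: (@bounded_opP _ _ _ (\sum_(p <- s) `|p.1|)); first exact: group_ring_op_linear.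
  split; first by apply: sumr_ge0 => p _.
  move=> x; rewrite mulr_suml; apply: le_trans (ler_norm_sum _ _ _) _.
  by apply: ler_sum => p _; rewrite normrZ left_regular_norm.
move=> e e0; exists s; split; first by rewrite ler0c ltW.
by move=> x; rewrite subrr normr0 mulr_ge0 // ler0c ltW.
Qed.

Section Ccp.
Variables (n : nat).
Local Notation En := (l2_hilbert R 'I_n).
Variable phi : (H -> H) -> (En -> En).
Hypothesis cphi : ccp (@reduced_Cstar R G) phi.

Let phi_lin g : linear (phi (lam g)).
Proof. by case: cphi => + _ _ _; case/(_ _ (left_regular_reduced R g)). Qed.

Lemma ccp_group_ring s :
  phi (group_ring_op s) = fun x => \sum_(p <- s) p.1 *: phi (lam p.2) x.
Proof.
case: cphi => _ lin _ _; elim: s => [|p s IHs].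
  (* [linear_on] speaks of combinations of two members, so zero has to be written as one. *)
  have -> : group_ring_op [::] = fun x => (-1) *: lam 1%g x + lam 1%g x.
    by apply/funext => x; rewrite /group_ring_op big_nil scaleN1r addNr.
  rewrite lin; try exact: left_regular_reduced.
  by apply/funext => x; rewrite big_nil scaleN1r addNr.
have -> : group_ring_op (p :: s) = fun x => p.1 *: lam p.2 x + group_ring_op s x.
  by apply/funext => x; rewrite /group_ring_op big_cons.
rewrite lin; [|exact: left_regular_reduced|exact: group_ring_op_reduced].
by rewrite IHs; apply/funext => x; rewrite big_cons.
Qed.

Lemma op_entry_dot (M : En -> En) i j :
  op_entry M i j = hdot En (M (fin_delta R j)) (fin_delta R i).
Proof. by rewrite [hdot _ _ _]l2_dot_deltar. Qed.

(** The operator matrix with entries lambda(g_p)^* lambda(g_q) is positive, and phi is completely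
    positive. *)
Lemma ccp_left_regular_pd :
  pd_kernel (fun p q : G * En => hdot En (phi (lam (p.1^-1 * q.1)%g) q.2) p.2).
Proof.
case: cphi => _ _ pos _ m g c.
have := pos m (fun p q => lam ((g p).1^-1 * (g q).1)%g) (fun _ _ => left_regular_reduced R _).
move=> /(_ _)/wrap[|].
  move=> x; have := hdot_ge0 (\sum_q lam (g q).1 (x q) : H); congr (0 <= _).
  rewrite hdot_sumr; apply: eq_bigr => i _; rewrite hdot_suml; apply: eq_bigr => j _.
  by rewrite left_regularM [RHS]left_regular_adjoint invgK.
move=> /(_ (fun p => c p *: (g p).2)); congr (0 <= _).
apply: eq_bigr => i _; apply: eq_bigr => j _.
have [_ Z _] := linear_additive (phi_lin ((g i).1^-1 * (g j).1)%g).
by rewrite Z hdotZl hdotZr; ring.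
Qed.

(** Compatibility with adjoints is not among the clauses of [ccp]; it comes from the Hermitian
    symmetry of the positive kernel above. *)
Lemma ccp_left_regular_herm g i j :
  op_entry (phi (lam g^-1%g)) i j = (op_entry (phi (lam g)) j i)^*.
Proof.
have := pd_kernel_herm ccp_left_regular_pd (1%g, fin_delta R j) (g, fin_delta R i).
by rewrite /= mulg1 invg1 mul1g !op_entry_dot.
Qed.

Lemma ccp_entry_le1 g i j : `|op_entry (phi (lam g)) i j| <= 1.
Proof.
case: cphi => _ _ _ /(_ _ _ (left_regular_reduced R g) (left_regular_op_norm R g))[_ nrm].
rewrite op_entry_dot; apply: le_trans (hdot_CauchySchwarz _ _) _.
by rewrite fin_delta_norm mulr1; apply: le_trans (nrm _) _; rewrite fin_delta_norm mulr1.
Qed.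

End Ccp.
End GroupRingOperators.

(** * Approximation of completely positive maps by vector functionals *)

Section CcpApproximation.
Variables (R : realType) (G : groupType) (n : nat).
Local Notation H := (l2_hilbert R G).
Local Notation lam := (@left_regular R G).
Local Notation En := (l2_hilbert R 'I_n).
Variable phi : (H -> H) -> (En -> En).
Hypothesis cphi : ccp (@reduced_Cstar R G) phi.
Variable E : seq G.
Let q := size E.
Let gq (k : 'I_q) : G := nth 1%g E k.
Let T : Type := 'I_n -> seq G * H.
Let tr (x : T) i : H := truncation (x i).1 (x i).2.
Let J : finType := (('I_q * 'I_n * 'I_n) * bool)%type.
Let part (b : bool) (z : R[i]) : R := if b then complex.Re z else complex.Im z.
Let coef (y : 'I_n -> H) (p : 'I_q * 'I_n * 'I_n) : R[i] :=
  hdot H (lam (gq p.1.1) (y p.2)) (y p.1.2).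
Let target (p : 'I_q * 'I_n * 'I_n) : R[i] :=
  op_entry (phi (lam (gq p.1.1))) p.1.2 p.2.

Let partD b u v : part b (u + v) = part b u + part b v.
Proof. by case: b u v => [] [? ?] [? ?]. Qed.

Let part_le b z : `|part b z| <= complex.Re `|z|.
Proof. by case: b; [exact: Re_le_norm|exact: Im_le_norm]. Qed.

(** A real functional on real and imaginary parts is the real part of a complex one, with the
    conjugates of these coefficients. *)
Let weight (X : J -> R) p : R[i] := Complex (X (p, true)) (X (p, false)).

Let pairing (z : 'I_q * 'I_n * 'I_n -> R[i]) X :
  \sum_p part p.2 (z p.1) * X p = complex.Re (\sum_p (weight X p)^* * z p).
Proof.
have -> : complex.Re (\sum_p (weight X p)^* * z p) = \sum_p complex.Re ((weight X p)^* * z p).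
  apply: (@big_morph _ _ (@complex.Re R) 0 +%R) => //; by move=> [? ?] [? ?].
rewrite sum_pair; apply: eq_bigr => p _; rewrite big_bool /= /weight.
by case: (z p) => a b /=; ring.
Qed.

Let coef_le (y : 'I_n -> H) p : complex.Re `|coef y p| <= \sum_j hn (y j) ^+ 2.
Proof.
apply: le_trans (hdot_CS_real _ _) _.
have -> : hn (lam (gq p.1.1) (y p.2)) = hn (y p.2) by rewrite /hn left_regular_norm.
have h j : hn (y j) ^+ 2 <= \sum_j hn (y j) ^+ 2.
  by rewrite (bigD1 j) //= lerDl sumr_ge0 // => i _; exact: sqr_ge0.
have := h p.1.2; have := h p.2; move: (\sum_j _) => N.
have := sqr_ge0 (hn (y p.1.2) - hn (y p.2)); nra.
Qed.

(* Truncation is dense, so that positivity may be tested on finitely supported vectors. *)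
Let pairing_extend (X : J -> R) (kp : R) : 0 <= kp ->
  (forall x : T, complex.Re (\sum_p (weight X p)^* * coef (tr x) p) <= kp * \sum_j hn (tr x j) ^+ 2) ->
  forall y : 'I_n -> H, complex.Re (\sum_p (weight X p)^* * coef y p) <= kp * \sum_j hn (y j) ^+ 2.
Proof.
move=> kp0 hT y.
pose B := \sum_j hn (y j); pose M := \sum_p complex.Re `|weight X p|.
have hnB j : hn (y j) <= B.
  by rewrite /B (bigD1 j) //= lerDl sumr_ge0 // => i _; exact: hn_ge0.
have B0 : 0 <= B by apply: sumr_ge0 => i _; exact: hn_ge0.
have cabs0 (z : R[i]) : 0 <= complex.Re `|z|.
  by rewrite -ler0c real_norm.
have M0 : 0 <= M by apply: sumr_ge0.
apply/ler_addgt0Pr => e e0.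
(* Makes the total error M * (2 B r) at most e; the 1 keeps the denominator positive. *)
pose r := e / (2 * B * M + 1).
have c0 : 0 < 2 * B * M + 1 by rewrite ltr_wpDl // !mulr_ge0.
have r0 : 0 < r by rewrite divr_gt0.
have /choice[S SP] j : exists S, hn (y j - truncation S (y j)) <= r by exact: truncation_approx.
pose x : T := fun j => (S j, y j).
have trle j : hn (tr x j) <= hn (y j) by exact: truncation_hn.
have sumle : \sum_j hn (tr x j) ^+ 2 <= \sum_j hn (y j) ^+ 2.
  by apply: ler_sum => j _; rewrite ler_pXn2r ?nnegrE ?hn_ge0.
have cle p : complex.Re `|coef y p - coef (tr x) p| <= 2 * B * r.
  have -> : coef y p - coef (tr x) p = hdot H (lam (gq p.1.1) (y p.2 - tr x p.2)) (y p.1.2)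
     + hdot H (lam (gq p.1.1) (tr x p.2)) (y p.1.2 - tr x p.1.2).
    rewrite (linear_map_sub _ _ (@left_regular_linear R G _)) hdotBl hdotBr /coef; ring.
  apply: (@le_trans _ _ (r * B + B * r)); last by rewrite le_eqVlt; apply/orP; left; apply/eqP; ring.
  rewrite -lecR real_norm; apply: le_trans (ler_normD _ _) _.
  have -> : (r * B + B * r)%:C%C = (r * B)%:C%C + (B * r)%:C%C by rewrite rmorphD.
  apply: lerD; apply: le_trans (hdot_CauchySchwarz _ _) _;
    rewrite left_regular_norm !hnE -rmorphM lecR; apply: ler_pM; rewrite ?hn_ge0 //.
  exact: le_trans (trle p.2) (hnB p.2).
have e1 : complex.Re (\sum_p (weight X p)^* * coef y p) =
    complex.Re (\sum_p (weight X p)^* * coef (tr x) p) +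
    complex.Re (\sum_p (weight X p)^* * (coef y p - coef (tr x) p)).
  have ReD (u v : R[i]) : complex.Re (u + v) = complex.Re u + complex.Re v.
    by case: u v => [? ?] [? ?].
  rewrite -ReD -big_split; congr complex.Re; apply: eq_bigr => p _ /=; ring.
rewrite e1; apply: lerD.
  by apply: le_trans (hT x) _; apply: ler_wpM2l.
apply: le_trans (ler_norm _) _; apply: le_trans (Re_le_norm _) _.
apply: (@le_trans _ _ (M * (2 * B * r))).
  rewrite -lecR real_norm; apply: le_trans (ler_norm_sum _ _ _) _.
  rewrite rmorphM /= /M rmorph_sum mulr_suml; apply: ler_sum => p _ /=.
  apply: (@le_trans _ _ (`|weight X p| * (2 * B * r)%:C%C)).
    rewrite normrM norm_conjC ler_wpM2l // -(real_norm (coef y p - _)) lecR; exact: cle.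
  by rewrite -(real_norm (weight X p)).
have -> : M * (2 * B * r) = (2 * B * M) / (2 * B * M + 1) * e by rewrite /r; field; rewrite gt_eqF.
by rewrite ler_piMl ?(ltW e0) // ler_pdivrMr // mul1r lerDl.
Qed.

(** The functional becomes an operator matrix Z: kp times the identity minus the Hermitian part of
    the matrix of group ring elements with coefficients [weight X]. The hypothesis says that Z is
    positive. Applying phi and testing on the basis vectors gives the conclusion, n being a bound
    for the trace of phi(1). *)
Let ccp_target (X : J -> R) (kp : R) : 0 <= kp ->
  (forall y : 'I_n -> H, complex.Re (\sum_p (weight X p)^* * coef y p) <= kp * \sum_j hn (y j) ^+ 2) ->
  complex.Re (\sum_p (weight X p)^* * target p) <= kp * n%:R.
Proof.
move=> kp0 hy.
pose Y k i j := weight X (k, i, j).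
pose Z i j : seq (R[i] * G) :=
  ((kp * (i == j)%:R)%:C%C, 1%g) ::
  [seq (- (2^-1 * (Y k i j)^* ), gq k) | k <- index_enum 'I_q] ++
  [seq (- (2^-1 * Y k j i), (gq k)^-1%g) | k <- index_enum 'I_q].
pose Q (z : 'I_q * 'I_n * 'I_n -> R[i]) := \sum_p (weight X p)^* * z p.
have QE z : Q z = \sum_i \sum_j \sum_k (Y k i j)^* * z (k, i, j).
  rewrite /Q sum_pair sum_pair exchange_big; apply: eq_bigr => i _ /=.
  by rewrite exchange_big.
have ReQ (z : R[i]) : 2^-1 * (z + z^* ) = ((complex.Re z)%:C)%C.
  by rewrite ReJ_add mulrC.
have Zsum (L : G -> 'I_n -> 'I_n -> R[i]) :
    (forall g i j, L g^-1%g i j = (L g j i)^* ) ->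
    \sum_i \sum_j \sum_(p <- Z i j) p.1 * L p.2 i j =
    (kp%:C)%C * (\sum_i L 1%g i i) -
      ((complex.Re (Q (fun p => L (gq p.1.1) p.1.2 p.2)))%:C)%C.
  move=> Lherm; rewrite -ReQ QE.
  have ZE i j : \sum_(p <- Z i j) p.1 * L p.2 i j = (kp%:C)%C * (i == j)%:R * L 1%g i j
      - 2^-1 * (\sum_k (Y k i j)^* * L (gq k) i j) - 2^-1 * (\sum_k Y k j i * L (gq k)^-1%g i j).
    rewrite /Z big_cons big_cat !big_map /= !mulr_sumr -!sumrN -addrA.
    congr (_ + (_ + _)).
    - by rewrite rmorphM /= rmorph_nat.
    - by apply: eq_bigr => k _; ring.
    - by apply: eq_bigr => k _; ring.
  under eq_bigr do under eq_bigr do rewrite ZE.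
  under eq_bigr do rewrite !sumrB.
  rewrite !sumrB -addrA; congr (_ + _).
    rewrite mulr_sumr; apply: eq_bigr => i _.
    rewrite (bigD1 i) //= big1 ?addr0 => [|j /negbTE ji]; first by rewrite eqxx mulr1.
    by rewrite eq_sym ji mulr0 mul0r.
  rewrite mulrDr opprD; congr (_ + _); congr (- _).
    by rewrite mulr_sumr; apply: eq_bigr => i _; rewrite mulr_sumr; apply: eq_bigr.
  rewrite rmorph_sum mulr_sumr exchange_big; apply: eq_bigr => i _ /=.
  rewrite rmorph_sum mulr_sumr; apply: eq_bigr => j _ /=.
  rewrite rmorph_sum; congr (_ * _); apply: eq_bigr => k _ /=.
  by rewrite rmorphM /= Lherm conjCK.
have Zpos : pos_op_matrix (fun i j => group_ring_op (Z i j)).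
  move=> y; have Lh g i j : hdot H (lam g^-1%g (y j)) (y i) = (hdot H (lam g (y i)) (y j))^*.
    by rewrite left_regular_adjoint invgK hdotC.
  have := Zsum (fun g i j => hdot H (lam g (y j)) (y i)) Lh.
  have -> : \sum_i hdot H (lam 1%g (y i)) (y i) = ((\sum_j hn (y j) ^+ 2)%:C)%C.
    by rewrite rmorph_sum; apply: eq_bigr => i _; rewrite left_regular1 hdot_hn.
  rewrite -rmorphM -rmorphB => e.
  have -> : \sum_i \sum_j hdot H (group_ring_op (Z i j) (y j)) (y i) =
      \sum_i \sum_j \sum_(p <- Z i j) p.1 * hdot H (lam p.2 (y j)) (y i).
    apply: eq_bigr => i _; apply: eq_bigr => j _; rewrite hdot_suml.
    by apply: eq_bigr => p _; rewrite hdotZl.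
  by rewrite e; apply: (etrans (ler0c _)); rewrite subr_ge0; exact: hy.
case: (cphi) => _ _ pos _.
have := pos _ _ (fun i j => group_ring_op_reduced (Z i j)) Zpos (fin_delta R (n := n)).
have -> : \sum_i \sum_j hdot En (phi (group_ring_op (Z i j)) (fin_delta R j)) (fin_delta R i) =
   \sum_i \sum_j \sum_(p <- Z i j) p.1 * op_entry (phi (lam p.2)) i j.
  apply: eq_bigr => i _; apply: eq_bigr => j _.
  rewrite (ccp_group_ring cphi) hdot_suml; apply: eq_bigr => p _.
  by rewrite hdotZl op_entry_dot.
rewrite (Zsum (fun g i j => op_entry (phi (lam g)) i j) (ccp_left_regular_herm cphi)).
rewrite subr_ge0 lecE => /andP[_] /= h; apply: le_trans h _.
apply: le_trans (ler_norm _) _; apply: le_trans (Re_le_norm _) _.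
rewrite -lecR real_norm normrM rmorphM /= [`|kp%:C%C|]ger0_norm ?ler0c //.
rewrite ler_wpM2l ?ler0c //; apply: le_trans (ler_norm_sum _ _ _) _.
apply: (@le_trans _ _ (\sum_(i < n) 1)); last by rewrite sumr_const card_ord rmorph_nat.
by apply: ler_sum => i _; exact: ccp_entry_le1.
Qed.

(** Sums of vector functionals form a convex cone, to which [cone_approx] applies: a functional that
    is almost nonpositive on the cone is so on phi by [ccp_target]. Real and imaginary parts are
    separate coordinates, each approximated up to e / 2. *)
Lemma ccp_approximation (e : R) : 0 < e -> exists s : seq T, forall g i j, g \in E ->
  `|op_entry (phi (lam g)) i j - \sum_(x <- s) hdot H (lam g (tr x j)) (tr x i)| <= (e%:C)%C.
Proof.
move=> e0; have e20 : 0 < e / 2 by rewrite divr_gt0.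
pose c (x : T) (p : J) := part p.2 (coef (tr x) p.1).
pose N (x : T) : R := \sum_j hn (tr x j) ^+ 2.
have N0 x : 0 <= N x by apply: sumr_ge0 => j _; exact: sqr_ge0.
have cN x p : `|c x p| <= N x by apply: le_trans (part_le _ _) _; exact: coef_le.
(* Scaling the vectors by the square root of t scales the functional by t. *)
have cZ x t : 0 <= t -> exists y, forall p, c y p = t * c x p.
  move=> t0; exists (fun i => ((x i).1, (Num.sqrt t)%:C%C *: (x i).2)) => p; rewrite /c.
  have -> : coef (tr (fun i => ((x i).1, (Num.sqrt t)%:C%C *: (x i).2))) p.1 =
      (t%:C)%C * coef (tr x) p.1.
    have trZ i : tr (fun i => ((x i).1, (Num.sqrt t)%:C%C *: (x i).2)) i =
        (Num.sqrt t)%:C%C *: tr x i.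
      have [_ Z _] := linear_additive (mult_op_linear (indicator_le1 R (x i).1)).
      exact: Z.
    rewrite /coef !trZ; have [_ Z _] := linear_additive (left_regular_linear (R := R) (gq p.1.1.1)).
    rewrite Z hdotZl hdotZr conjRC -{3}(sqr_sqrtr t0) rmorphXn /=; ring.
  by case: (p.2) (coef _ _) => [] [u v] /=; ring.
have cP (X : J -> R) k : 0 <= k -> (forall x, \sum_p c x p * X p <= k * N x) ->
    \sum_p part p.2 (target p.1) * X p <= k * n%:R.
  move=> k0 h; rewrite pairing; apply: ccp_target => // y.
  by apply: pairing_extend => // x; rewrite -pairing; exact: h.
have [s sP] := cone_approx (ler0n R n) N0 cN cZ cP e20.
exists s => g i j gE.
have kq : (index g E < q)%N by rewrite index_mem.
have gk : gq (Ordinal kq) = g by rewrite /gq /= nth_index.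
set z := _ - _.
have zp b : `|part b z| <= e / 2.
  have := sP ((Ordinal kq, i, j), b); rewrite /c /target /coef /= gk.
  have -> : part b z = part b (op_entry (phi (lam g)) i j) -
      \sum_(x <- s) part b (hdot H (lam g (tr x j)) (tr x i)).
    have -> : \sum_(x <- s) part b (hdot H (lam g (tr x j)) (tr x i)) =
        part b (\sum_(x <- s) hdot H (lam g (tr x j)) (tr x i)).
      by apply/esym/(big_morph (part b) (partD b)); case: b.
    by rewrite /z; case: b (op_entry _ _ _) (\sum_(x <- s) _) => [] [? ?] [? ?].
  by [].
have := zp true; have := zp false; rewrite /part; clearbody z; case: z {zp} => a b /= hb ha.
rewrite normc_def /= lecR -[e](ger0_norm (ltW e0)) -sqrtr_sqr ler_wsqrtr //.
move: ha hb; rewrite !ler_norml => /andP[? ?] /andP[? ?]; nra.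
Qed.

End CcpApproximation.

Section MatrixUnits.
Variables (R : realType) (n : nat) (H2 : hilbertSpace R).
Local Notation En := (l2_hilbert R 'I_n).

Definition matrix_unit (i j : 'I_n) (y : En) : En := y j *: fin_delta R i.

Lemma fin_coord_le (y : En) j : `|y j| <= `|y|.
Proof.
rewrite -(@ler_pXn2r _ 2) ?nnegrE // fin_l2_norm (bigD1 j) //= lerDl.
by apply: sumr_ge0 => k _; rewrite exprn_ge0.
Qed.

Lemma matrix_unit_norm i j : op_norm_le (matrix_unit i j : En -> En) 1.
Proof. by split=> // y; rewrite normrZ fin_delta_norm mulr1 mul1r fin_coord_le. Qed.

Lemma fin_linear_bounded (M : En -> En) : linear M -> bounded_op M.
Proof.
move=> lM; apply: (@bounded_opP _ _ _ (\sum_j `|M (fin_delta R j)|)) => //.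
split; first by apply: sumr_ge0.
move=> x; rewrite {1}(fin_l2_expand x) (linear_map_sum _ _ lM) mulr_suml.
apply: le_trans (ler_norm_sum _ _ _) _; apply: ler_sum => j _.
have [_ -> _] := linear_additive lM.
by rewrite normrZ mulrC ler_wpM2l // fin_coord_le.
Qed.

Lemma matrix_unit_bounded i j : @bounded_op R En (matrix_unit i j).
Proof.
apply: fin_linear_bounded => a x y; rewrite /matrix_unit.
have -> : (a *: x + y) j = a * x j + y j by [].
by rewrite scalerDl scalerA.
Qed.

(** The sum of matrix units is built along a list because linearity is given for two terms at a
    time. *)
Lemma ccp_matrix_expand (psi : (En -> En) -> (H2 -> H2)) (M : En -> En) :
  ccp (@bounded_op R En) psi -> linear M ->
  psi M = fun x => \sum_i \sum_j op_entry M i j *: psi (matrix_unit i j) x.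
Proof.
move=> [_ lin _ _] lM.
pose S (r : seq ('I_n * 'I_n)) (x : En) : En :=
  \sum_(p <- r) op_entry M p.1 p.2 *: matrix_unit p.1 p.2 x.
have lS r : linear (S r).
  move=> a x y; rewrite /S scaler_sumr -big_split; apply: eq_bigr => p _ /=.
  have [lU _] := matrix_unit_bounded p.1 p.2.
  move: (matrix_unit p.1 p.2) lU => U lU.
  by rewrite lU scalerDr !scalerA mulrC.
have bS r := fin_linear_bounded (lS r).
have SE r : psi (S r) = fun x => \sum_(p <- r) op_entry M p.1 p.2 *: psi (matrix_unit p.1 p.2) x.
  elim: r => [|p r IHr].
    have e : S [::] = fun x => (-1) *: S [::] x + S [::] x.
      by apply/funext => x; rewrite /S big_nil scaler0 addr0.
    by rewrite e lin //; apply/funext => x; rewrite big_nil scaleN1r addNr.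
  have -> : S (p :: r) = fun x => op_entry M p.1 p.2 *: matrix_unit p.1 p.2 x + S r x.
    by apply/funext => x; rewrite /S big_cons.
  rewrite lin //; last exact: matrix_unit_bounded.
  by rewrite IHr; apply/funext => x; rewrite big_cons.
have {1}-> : M = S (index_enum _).
  apply/funext => x; rewrite /S sum_pair [LHS]fin_l2_expand; apply: eq_bigr => i _.
  rewrite (op_entryE _ _ lM) scaler_suml; apply: eq_bigr => j _.
  by rewrite /matrix_unit scalerA.
by rewrite SE; apply/funext => x; rewrite sum_pair.
Qed.

End MatrixUnits.

(** * From a nuclear faithful representation to property A *)

Section ExactPropertyA.
Variables (R : realType) (G : groupType).
Local Notation H := (l2_hilbert R G).
Local Notation lam := (@left_regular R G).

Lemma finsupp_dot (S : seq G) (y z : H) g : uniq S -> (forall x, x \notin S -> y x = 0) ->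
  hdot H (lam g y) z = \sum_(f <- S) y f * (z (g * f)%g)^*.
Proof.
move=> uS yS.
have {1}-> : y = \sum_(f <- S) y f *: (l2_delta R f : H).
  apply: l2P => x; rewrite l2_val_sum.
  have h f : (y f *: (l2_delta R f : H)) x = y f * (x == f)%:R by [].
  under eq_bigr do rewrite h.
  rewrite (@sum_single _ _ _ x _ uS) => [|f fx]; last by rewrite eq_sym (negbTE fx) mulr0.
  by rewrite eqxx mulr1; case: ifPn => // /yS.
rewrite (linear_map_sum _ _ (@left_regular_linear R G g)) hdot_suml.
apply: eq_bigr => f _; have [_ -> _] := linear_additive (left_regular_linear (R := R) g).
by rewrite left_regular_delta hdotZl hdotC [hdot _ _ _]l2_dot_deltar.
Qed.

(* Let psi o phi approximate a faithful representation pi, and let v be a unit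
   vector with pi(1) v = v.  Once the entries of phi(lam_g) are replaced by vector
   functionals <lam_g eta_j, eta_i> with finitely supported eta, the number
   <psi (phi lam_g) pi(t) v, pi(g t) v>, close to 1, becomes a sum over f of
   L((g t, g f), (t, f)) with L positive definite, so that
   a(t, f) = L((t, f), (t, f))^(1/2) does up to normalization. *)
Lemma exact_property_A : exact_group R G -> property_A R G.
Proof.
move=> [H2 [pi [[pib pilin piM piA pif] nuc]]] E e e0.
have rl g : reduced_Cstar (lam g : H -> H) := left_regular_reduced R g.
have piE (S T : H -> H) : (forall x, S x = T x) -> pi S = pi T.
  by move=> ST; congr pi; apply/funext.
have piL g : linear (pi (lam g)) by have [] := pib _ (rl g).
have piMg g h x : pi (lam g) (pi (lam h) x) = pi (lam (g * h)%g) x.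
  have -> : pi (lam g) (pi (lam h) x) = (pi (lam g) \o pi (lam h)) x by [].
  by rewrite -piM //; congr (_ x); apply: piE => y /=; rewrite left_regularM.
(* [faithful_rep] allows a non-unital pi, so v is taken in the range of pi(lambda_1). This range is
   nonzero, for otherwise lambda_1 and 0 would have the same image. *)
have [v v1 pv] : exists2 v : H2, `|v| = 1 & pi (lam 1%g) v = v.
  have [[u u0]|all0] := pselect (exists u, pi (lam 1%g) u != 0).
    set w := pi (lam 1%g) u in u0.
    have pw : pi (lam 1%g) w = w by rewrite /w piMg mulg1.
    exists (`|w|^-1 *: w); last by have [_ -> _] := linear_additive (piL 1%g); rewrite pw.
    by rewrite normrZ normfV normr_id mulVf // normr_eq0.
  exfalso.
  have red0 : reduced_Cstar (fun _ : H => 0 : H).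
    have := group_ring_op_reduced (R := R) (G := G) [::].
    by have -> // : group_ring_op [::] = (fun _ : H => 0 : H)
      by apply/funext => x; rewrite /group_ring_op big_nil.
  have : lam 1%g = (fun _ : H => 0 : H).
    apply: pif => //; apply/funext => x.
    have -> : pi (lam 1%g) x = 0.
      by apply: contrapT => /eqP h; apply: all0; exists x.
    have -> : (fun _ : H => 0 : H) = fun x => (-1) *: lam 1%g x + lam 1%g x.
      by apply/funext => y; rewrite scaleN1r addNr.
    by rewrite pilin // scaleN1r addNr.
  move=> /(congr1 (fun f => (f (l2_delta R 1%g) : H) 1%g)) /eqP.
  by rewrite left_regular1 l2_deltaE eqxx oner_eq0.
pose xt t := pi (lam t) v.
have xt1 t : hdot H2 (xt t) (xt t) = 1.
  have ad : adjoint (pi (lam t)) (pi (lam t^-1%g)).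
    by apply: piA => // x y; exact: left_regular_adjoint.
  by rewrite {1}/xt ad /xt piMg mulVg pv -hdot_norm v1 expr1n.
have xtn t : `|xt t| = 1.
  by apply/eqP; rewrite -(@pexpr_eq1 _ _ 2) // hdot_norm xt1.
have xtM g t : pi (lam g) (xt t) = xt (g * t)%g by exact: piMg.
(* With d <= e / 8 the final bound (1 - 2d) / (1 + 2d) is at least 1 - e. *)
pose d := Num.min (e / 8) (1 / 4).
have d0 : 0 < d by rewrite lt_min !divr_gt0.
have de : d <= e / 8 by rewrite ge_min lexx.
have d4 : d <= 1 / 4 by rewrite ge_min lexx orbT.
(* The estimate at g = 1 bounds the sum over f of L((t, f), (t, f)) by 1 + 2d, which is the
   normalization of a. *)
pose E1 := 1%g :: E.
have fE1 : finite_set [set (lam g : H -> H) | g in [set` E1]].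
  by apply: finite_image; exact: finite_seq.
have sE1 : [set (lam g : H -> H) | g in [set` E1]] `<=` @reduced_Cstar R G.
  by move=> _ [g _ <-].
have [n [phi [psi [cphi cpsi appr]]]] := nuc _ _ fE1 sE1 d0.
(* Each of the n^2 entries may be off by d / (n^2 + 1), as it is multiplied by a value of K of
   modulus at most 1; together they cost at most d. *)
have N1 : 0 < (n%:R ^+ 2 + 1 : R) by rewrite ltr_wpDl // sqr_ge0.
have [s sP] := ccp_approximation cphi E1 (divr_gt0 d0 N1).
pose eu := @matrix_unit R n.
have beu i j : @bounded_op R (l2_hilbert R 'I_n) (eu i j) := matrix_unit_bounded R i j.
pose K (p q : G * 'I_n) := hdot H2 (psi (eu p.2 q.2) (xt q.1)) (xt p.1).
have psiL M : @bounded_op R (l2_hilbert R 'I_n) M -> linear (psi M).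
  by case: cpsi => + _ _ _ bM; case/(_ _ bM).
have pK : pd_kernel K.
  case: cpsi => _ _ pos _ m g c.
  have := pos m (fun p q => eu (g p).2 (g q).2) (fun _ _ => beu _ _).
  move=> /(_ _)/wrap[|].
    move=> y; set b := \sum_q y q (g q).2.
    have := mul_conjC_ge0 b; congr (0 <= _).
    rewrite mulrC rmorph_sum mulr_suml; apply: eq_bigr => p _.
    rewrite mulr_sumr; apply: eq_bigr => q _.
    by rewrite /eu /matrix_unit hdotZl hdotC [hdot _ _ _]l2_dot_deltar mulrC.
  move=> /(_ (fun p => c p *: xt (g p).1)); congr (0 <= _).
  apply: eq_bigr => i _; apply: eq_bigr => j _.
  have [_ Z _] := linear_additive (psiL _ (beu (g i).2 (g j).2)).
  by rewrite Z hdotZl hdotZr /K; ring.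
have K1 p q : `|K p q| <= 1.
  apply: le_trans (hdot_CauchySchwarz _ _) _; rewrite xtn mulr1.
  case: cpsi => _ _ _ /(_ (eu p.2 q.2) 1 (beu _ _) (matrix_unit_norm R _ _)) [_].
  by move=> /(_ (xt q.1)); rewrite xtn mulr1.
pose tr (x : 'I_n -> seq G * H) i : H := truncation (x i).1 (x i).2.
pose S := undup (flatten [seq flatten [seq (x i).1 | i <- enum 'I_n] | x <- s]).
have uS : uniq S := undup_uniq _.
pose L (p q : G * G) := \sum_(x <- s) \sum_i \sum_j
  tr x j q.2 * (tr x i p.2)^* * K (p.1, i) (q.1, j).
(* For each x this is the form of K on the points (t, i), with coefficients multiplied by the values
   of [tr x i]. *)
have pL : pd_kernel L.
  move=> m g c.
  have : 0 <= \sum_(x <- s) \sum_(p : 'I_m * 'I_n) \sum_(q : 'I_m * 'I_n)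
      (c p.1 * tr x p.2 (g p.1).2)^* * (c q.1 * tr x q.2 (g q.1).2) *
      K ((g p.1).1, p.2) ((g q.1).1, q.2).
    apply: sumr_ge0 => x _; exact: (pd_kernel_fin (fun p : 'I_m * 'I_n => ((g p.1).1, p.2))).
  congr (0 <= _).
  transitivity (\sum_(x <- s) \sum_p \sum_q (c p)^* * c q *
      (\sum_i \sum_j tr x j (g q).2 * (tr x i (g p).2)^* * K ((g p).1, i) ((g q).1, j))).
    apply: eq_bigr => x _; rewrite sum_pair; apply: eq_bigr => p _.
    under [LHS]eq_bigr do rewrite sum_pair.
    rewrite exchange_big; apply: eq_bigr => q _ /=.
    rewrite mulr_sumr; apply: eq_bigr => i _; rewrite mulr_sumr; apply: eq_bigr => j _.
    by rewrite rmorphM /=; ring.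
  rewrite exchange_big; apply: eq_bigr => p _; rewrite exchange_big.
  by apply: eq_bigr => q _; rewrite mulr_sumr.
pose cc g t := \sum_(f <- S) L (g * t, g * f)%g (t, f).
have trS x j f : x \in s -> f \notin S -> tr x j f = 0.
  move=> xs fS; rewrite /tr truncationE; case: ifP => // fx.
  case/negP: fS; rewrite mem_undup; apply/flatten_mapP; exists x => //.
  by apply/flatten_mapP; exists j => //; rewrite mem_enum.
have ccE g t : cc g t = \sum_i \sum_j (\sum_(x <- s) hdot H (lam g (tr x j)) (tr x i)) *
    K ((g * t)%g, i) (t, j).
  rewrite /cc /L exchange_big /=.
  transitivity (\sum_(x <- s) \sum_i \sum_j hdot H (lam g (tr x j)) (tr x i) * K ((g * t)%g, i) (t, j)).
    rewrite big_seq [RHS]big_seq; apply: eq_bigr => x xs.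
    rewrite exchange_big; apply: eq_bigr => i _ /=; rewrite exchange_big; apply: eq_bigr => j _ /=.
    by rewrite (@finsupp_dot S) ?mulr_suml // => f; exact: trS.
  rewrite exchange_big; apply: eq_bigr => i _; rewrite exchange_big.
  by apply: eq_bigr => j _; rewrite mulr_suml.
have cc1 g t : g \in E1 -> `|cc g t - 1| <= ((2 * d)%:C)%C.
  move=> gE.
  have lphi : linear (phi (lam g)) by case: cphi => + _ _ _; case/(_ _ (rl g)).
  have aE : hdot H2 (psi (phi (lam g)) (xt t)) (xt (g * t)%g) =
      \sum_i \sum_j op_entry (phi (lam g)) i j * K ((g * t)%g, i) (t, j).
    rewrite (ccp_matrix_expand cpsi lphi) hdot_suml; apply: eq_bigr => i _.
    by rewrite hdot_suml; apply: eq_bigr => j _; rewrite hdotZl.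
  have h1 : `|hdot H2 (psi (phi (lam g)) (xt t)) (xt (g * t)%g) - 1| <= (d%:C)%C.
    rewrite -(xt1 (g * t)%g) -{2}xtM -hdotBl; apply: le_trans (hdot_CauchySchwarz _ _) _.
    rewrite xtn mulr1.
    have [|_ /(_ (xt t))] := appr (lam g); first by exists g.
    by rewrite xtn mulr1.
  have h2 : `|cc g t - hdot H2 (psi (phi (lam g)) (xt t)) (xt (g * t)%g)| <= (d%:C)%C.
    rewrite aE ccE -sumrB; under eq_bigr do rewrite -sumrB.
    apply: (@le_trans _ _ (\sum_(i < n) \sum_(j < n) ((d / (n%:R ^+ 2 + 1))%:C)%C)).
      apply: le_trans (ler_norm_sum _ _ _) _; apply: ler_sum => i _.
      apply: le_trans (ler_norm_sum _ _ _) _; apply: ler_sum => j _.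
      rewrite -mulrBl normrM distrC -[leRHS]mulr1; apply: ler_pM => //.
      exact: sP.
    rewrite !sumr_const card_ord -mulrnA -(rmorphMn (real_complex R)) lecR -mulr_natl.
    rewrite natrM -expr2 mulrA ler_pdivrMr // mulrC ler_wpM2l ?(ltW d0) // lerDl //.
  have -> : cc g t - 1 = (cc g t - hdot H2 (psi (phi (lam g)) (xt t)) (xt (g * t)%g)) +
     (hdot H2 (psi (phi (lam g)) (xt t)) (xt (g * t)%g) - 1) by rewrite addrA subrK.
  apply: le_trans (ler_normD _ _) _.
  have -> : (2 * d)%:C%C = d%:C%C + d%:C%C by rewrite -rmorphD; congr (_%:C%C); ring.
  exact: lerD.
have D0 : 0 < 1 + 2 * d by lra.
pose l t f : R := complex.Re (L (t, f) (t, f)).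
have lE t f : L (t, f) (t, f) = ((l t f)%:C)%C.
  by rewrite /l RRe_real // ger0_real // (pd_kernel_diag pL).
have l0 t f : 0 <= l t f by rewrite -ler0c -lE (pd_kernel_diag pL).
pose a t f := Num.sqrt (l t f) / Num.sqrt (1 + 2 * d).
have ab t f t' f' : a t f * a t' f' = Num.sqrt (l t f) * Num.sqrt (l t' f') / (1 + 2 * d).
  by rewrite /a mulrACA -invfM -expr2 sqr_sqrtr // ltW.
exists S, a; split=> //.
- by move=> t f; rewrite divr_ge0 // sqrtr_ge0.
- move=> t f; apply: contraNT => fS.
  apply/eqP; suff ltf : l t f = 0 by rewrite /a ltf sqrtr0 mul0r.
  apply: complexI; rewrite -lE /L big_seq big1 // => x xs; rewrite big1 // => i _.
  by rewrite big1 // => j _; rewrite trS // !mul0r.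
- move=> t; have := cc1 1%g t (mem_head _ _).
  have -> : cc 1%g t = ((\sum_(f <- S) l t f)%:C)%C.
    by rewrite rmorph_sum; apply: eq_bigr => f _; rewrite !mul1g lE.
  have -> : \sum_(f <- S) a t f ^+ 2 = (\sum_(f <- S) l t f) / (1 + 2 * d).
    by rewrite mulr_suml; apply: eq_bigr => f _; rewrite expr2 ab -expr2 sqr_sqrtr.
  move=> h; rewrite ler_pdivrMr // mul1r -lerBlDl -lecR; apply: le_trans h.
  rewrite rmorphB rmorph1 /=.
  have -> : (\sum_(f <- S) l t f)%:C%C - 1 = (\sum_(f <- S) l t f - 1)%:C%C.
    by rewrite rmorphB rmorph1.
  rewrite normc_def /= expr0n addr0 sqrtr_sqr lecR; exact: ler_norm.
move=> g t gE; have gE1 : g \in E1 by rewrite inE gE orbT.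
have -> : \sum_(f <- S) a t f * a (g * t)%g (g * f)%g =
    (\sum_(f <- S) Num.sqrt (l t f) * Num.sqrt (l (g * t) (g * f))%g) / (1 + 2 * d).
  by rewrite mulr_suml; apply: eq_bigr => f _; rewrite ab.
rewrite ler_pdivlMr //.
have h1 : 1 - 2 * d <= complex.Re `|cc g t|.
  rewrite -lecR real_norm rmorphB rmorph1 /= lerBlDr.
  have <- : `|cc g t - (cc g t - 1)| = 1 by rewrite opprB addrCA subrr addr0 normr1.
  by apply: le_trans (ler_normB _ _) _; rewrite lerD2l cc1.
have h2 : complex.Re `|cc g t| <=
    \sum_(f <- S) Num.sqrt (l t f) * Num.sqrt (l (g * t) (g * f))%g.
  rewrite -lecR real_norm rmorph_sum /=; apply: le_trans (ler_norm_sum _ _ _) _.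
  apply: ler_sum => f _; rewrite -(real_norm (L _ _)) lecR.
  have n0 : 0 <= complex.Re `|L (g * t, g * f)%g (t, f)| by rewrite -ler0c real_norm.
  rewrite -[leLHS](ger0_norm n0) -sqrtr_sqr -sqrtrM // ler_wsqrtr //.
  rewrite -lecR rmorphXn /= real_norm mulrC rmorphM /= -!lE.
  exact: pd_kernel_CauchySchwarz.
apply: le_trans h2; apply: le_trans h1.
have : 0 <= e * d by rewrite mulr_ge0 ?ltW.
nra.
Qed.

End ExactPropertyA.

(** * Exactness of the second nilpotent product *)

Lemma sum_CauchySchwarz_sqrt (R : realType) (T : Type) (s : seq T) (u v : T -> R) :
  \sum_(x <- s) u x * v x <=
  Num.sqrt (\sum_(x <- s) u x ^+ 2) * Num.sqrt (\sum_(x <- s) v x ^+ 2).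
Proof.
set al := \sum_(x <- s) u x ^+ 2; set be := \sum_(x <- s) v x ^+ 2.
set ga := \sum_(x <- s) u x * v x.
have al0 : 0 <= al by apply: sumr_ge0 => x _; exact: sqr_ge0.
have be0 : 0 <= be by apply: sumr_ge0 => x _; exact: sqr_ge0.
have q (r t : R) : 0 <= r ^+ 2 * al - 2 * r * t * ga + t ^+ 2 * be.
  have : 0 <= \sum_(x <- s) (r * u x - t * v x) ^+ 2.
    by apply: sumr_ge0 => x _; exact: sqr_ge0.
  congr (0 <= _); rewrite !mulr_sumr -sumrB -big_split; apply: eq_bigr => x _ /=; ring.
apply: le_trans (ler_norm _) _; rewrite -sqrtrM // -sqrtr_sqr ler_wsqrtr //.
move: be0; rewrite le_eqVlt => /predU1P[b0|b0].
  have [->|ga0] := eqVneq ga 0; first by rewrite -b0 mulr0 expr0n.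
  (* For be = 0 the form is affine in t, and this t makes it equal to - al - 2. *)
  have := q 1 ((al + 1) / ga); rewrite -b0 mulr0 addr0 mulr1 expr1n mul1r.
  have -> : 2 * ((al + 1) / ga) * ga = 2 * (al + 1) by field.
  lra.
by rewrite -subr_ge0 -(pmulr_rge0 _ b0); have := q be ga; congr (0 <= _); ring.
Qed.

Lemma almost_invariant_property_A (R : realType) (G : groupType) :
  almost_invariant_vectors R G -> property_A R G.
Proof.
move=> aG E e e0; have [s [a [us a0 as_ a1 aE]]] := aG E e e0.
by exists s, (fun _ => a); split=> // [_|g _]; [rewrite a1|exact: aE].
Qed.

(** The three families multiply to a family w on A x B x K. On P, [aP t p] is the l^2 norm of w t
    over the fiber of [rho] at p; by Cauchy-Schwarz on each fiber this can only increase the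
    correlations. *)
Lemma np_property_A (R : realType) (A B : groupType) :
  property_A R A -> property_A R B -> property_A R (nilpotent_product2 A B).
Proof.
move=> pA pB.
have [K [h [k [l [[hM kM lM] K2 lsurj inj]]]]] := np_embedding A B.
have pK : property_A R K.
  apply: almost_invariant_property_A; apply: reiter_almost_invariant; exact: reiter_class2.
pose P : groupType := nilpotent_product2 A B.
pose X : choiceType := (A * B * K)%type.
pose act (p : P) (x : X) : X := (h p * x.1.1, k p * x.1.2, l p * x.2)%g.
have actM p q x : act (p * q)%g x = act p (act q x).
  by rewrite /act hM kM lM !mulgA.
have act1 x : act 1%g x = x.
  by rewrite /act (morph_one hM) (morph_one kM) (morph_one lM) !mul1g; case: x => [[]].
have actI p : injective (act p).
  by move=> x y e; rewrite -[x]act1 -[y]act1 -(mulVg p) !actM e.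
have [|//|//||rho rhoP] := @equivariant_retraction P X act.
- exact: (1, 1, 1)%g.
- move=> p [[x y] z] [] /(canRL (mulgK _)) + /(canRL (mulgK _)) + /(canRL (mulgK _)).
  by rewrite !mulgV => *; apply: inj.
(* For 0 <= d <= 1 one has (1 - d)^3 >= 1 - 3d >= 1 - e, and the three lower bounds 1 - d are
   nonnegative, so they may be multiplied. *)
move=> E e e0; pose d := Num.min (e / 3) 1.
have d0 : 0 < d by rewrite lt_min divr_gt0 // ltr01.
have d1 : d <= 1 by rewrite ge_min lexx orbT.
have de : d <= e / 3 by rewrite ge_min lexx.
have [FA [a [uA a0 aF a1 aE]]] := pA (map h E) d d0.
have [FB [b [uB b0 bF b1 bE]]] := pB (map k E) d d0.
have [FK [c [uK c0 cF c1 cE]]] := pK (map l E) d d0.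
pose w (t : P) (x : X) : R := a (h t) x.1.1 * b (k t) x.1.2 * c (l t) x.2.
pose FX : seq X := [seq (p, z) | p <- [seq (x, y) | x <- FA, y <- FB], z <- FK].
have sumX (F : X -> R) : \sum_(x <- FX) F x =
    \sum_(x <- FA) \sum_(y <- FB) \sum_(z <- FK) F (x, y, z).
  by rewrite /FX big_allpairs big_allpairs.
have prodX (fa : A -> R) (fb : B -> R) (fc : K -> R) :
    \sum_(x <- FX) fa x.1.1 * fb x.1.2 * fc x.2 =
    (\sum_(x <- FA) fa x) * (\sum_(y <- FB) fb y) * (\sum_(z <- FK) fc z).
  rewrite sumX !mulr_suml; apply: eq_bigr => x _; rewrite -mulrA mulr_suml mulr_sumr.
  by apply: eq_bigr => y _; rewrite mulrA mulr_sumr.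
have uX : uniq FX.
  apply: allpairs_uniq => //; last by move=> [? ?] [? ?] _ _ /= [-> ->].
  by apply: allpairs_uniq => // [[? ?] [? ?]] _ _ /= [-> ->].
have w0 t x : 0 <= w t x by rewrite !mulr_ge0.
have wF t x : w t x != 0 -> x \in FX.
  rewrite /w !mulf_eq0 !negb_or => /andP[/andP[/aF xA /bF xB] /cF xK].
  apply/allpairsP; exists (x.1, x.2); split=> //=; last by case: x {xA xB xK}.
  by apply/allpairsP; exists (x.1.1, x.1.2); split=> //=; case: x.1.
have w1 t : \sum_(x <- FX) w t x ^+ 2 <= 1.
  under eq_bigr do rewrite /w !exprMn.
  rewrite (prodX (fun x => a (h t) x ^+ 2) (fun y => b (k t) y ^+ 2) (fun z => c (l t) z ^+ 2)).
  have sa : 0 <= \sum_(x <- FA) a (h t) x ^+ 2 by apply: sumr_ge0 => x _; exact: sqr_ge0.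
  have sb : 0 <= \sum_(x <- FB) b (k t) x ^+ 2 by apply: sumr_ge0 => x _; exact: sqr_ge0.
  have sc : 0 <= \sum_(x <- FK) c (l t) x ^+ 2 by apply: sumr_ge0 => x _; exact: sqr_ge0.
  by rewrite mulr_ile1 ?mulr_ge0 ?mulr_ile1.
have wE g t : g \in E -> 1 - e <= \sum_(x <- FX) w t x * w (g * t)%g (act g x).
  move=> gE.
  have -> : \sum_(x <- FX) w t x * w (g * t)%g (act g x) = \sum_(x <- FX)
      (a (h t) x.1.1 * a (h g * h t)%g (h g * x.1.1)%g) *
      (b (k t) x.1.2 * b (k g * k t)%g (k g * x.1.2)%g) *
      (c (l t) x.2 * c (l g * l t)%g (l g * x.2)%g).
    by apply: eq_bigr => x _; rewrite /w /act /= hM kM lM; ring.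
  rewrite (prodX (fun x => a (h t) x * a (h g * h t)%g (h g * x)%g)
    (fun y => b (k t) y * b (k g * k t)%g (k g * y)%g)
    (fun z => c (l t) z * c (l g * l t)%g (l g * z)%g)).
  have := aE (h g) (h t) (map_f _ gE); have := bE (k g) (k t) (map_f _ gE).
  have := cE (l g) (l t) (map_f _ gE).
  move: (\sum_(x <- FA) _) (\sum_(x <- FB) _) (\sum_(x <- FK) _) => u v z hz hv hu.
  have d10 : 0 <= 1 - d by rewrite subr_ge0.
  have huv : (1 - d) * (1 - d) <= u * v by apply: ler_pM.
  have huvz : (1 - d) * (1 - d) * (1 - d) <= u * v * z by apply: ler_pM => //; rewrite mulr_ge0.
  apply: le_trans huvz; nra.
pose aP (t p : P) := Num.sqrt (\sum_(x <- [seq x <- FX | rho x == p]) w t x ^+ 2).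
pose FP := undup (map rho FX).
have fib (F : X -> R) : \sum_(p <- FP) \sum_(x <- [seq x <- FX | rho x == p]) F x = \sum_(x <- FX) F x.
  under eq_bigr do rewrite big_filter big_mkcond.
  rewrite exchange_big big_seq [RHS]big_seq; apply: eq_bigr => x xF /=.
  rewrite (@sum_single _ _ (fun p => if rho x == p then F x else 0) (rho x)) ?undup_uniq //.
    by rewrite eqxx mem_undup map_f.
  by move=> p; rewrite eq_sym => /negbTE ->.
exists FP, aP; split.
- exact: undup_uniq.
- by move=> t p; exact: sqrtr_ge0.
- move=> t p; apply: contraNT => pF; apply/eqP; rewrite /aP big_seq big1 ?sqrtr0 // => x.
  rewrite mem_filter => /andP[/eqP rx xF]; case/negP: pF.
  by rewrite mem_undup -rx map_f.
- move=> t; apply: le_trans (w1 t); rewrite -fib; apply: ler_sum => p _.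
  by rewrite sqr_sqrtr // sumr_ge0 // => x _; exact: sqr_ge0.
move=> g t gE; apply: le_trans (wE g t gE) _; rewrite -fib; apply: ler_sum => p _.
apply: le_trans (sum_CauchySchwarz_sqrt _ _ _) _.
apply: ler_wpM2l; first exact: sqrtr_ge0.
rewrite ler_wsqrtr //.
rewrite -(big_map (act g) xpredT (fun x => w (g * t)%g x ^+ 2)).
apply: (@le_trans _ _ (\sum_(x <- map (act g) [seq x <- FX | rho x == p])
  (if rho x == (g * p)%g then w (g * t)%g x ^+ 2 else 0))).
  rewrite !big_map big_seq [leRHS]big_seq; apply: ler_sum => x.
  by rewrite mem_filter rhoP => /andP[/eqP -> _]; rewrite eqxx.
(* A translated fiber lies in the fiber over g p; it may leave [FX], but w vanishes there. *)
apply: le_trans (_ : _ <= \sum_(x <- FX) (if rho x == (g * p)%g then w (g * t)%g x ^+ 2 else 0)) _.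
  apply: ler_sum_supp => //.
  - by rewrite map_inj_uniq // filter_uniq.
  - by move=> x; case: ifP => // _; exact: sqr_ge0.
  - by move=> x; case: ifP => [_|]; rewrite ?eqxx // sqrf_eq0 => /wF.
by rewrite big_filter [leRHS]big_mkcond.
Qed.

Lemma np_exact (R : realType) (A B : groupType) :
  exact_group R A -> exact_group R B -> exact_group R (nilpotent_product2 A B).
Proof.
move=> /exact_property_A pA /exact_property_A pB.
by apply: property_A_exact; exact: np_property_A.
Qed.

(** * Closed subspaces and orthogonal projections *)

Record closedSubspace (R : realType) (H : hilbertSpace R) := ClosedSubspace {
  csub_set :> H -> Prop;
  csub_zero : csub_set 0;
  csub_linear : forall (a : R[i]) x y, csub_set x -> csub_set y -> csub_set (a *: x + y);
  csub_closed : forall y, (forall e : R, 0 < e ->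
    exists z, csub_set z /\ `|z - y| <= (e%:C)%C) -> csub_set y }.

Section SubHilbertSpace.
Variables (R : realType) (H : hilbertSpace R) (S : closedSubspace H).

Definition csub_pred : {pred H} := mem [set x : H | S x].

Fact csub_submod_closed : submod_closed csub_pred.
Proof.
split; first by rewrite inE; exact: csub_zero.
by move=> a x y; rewrite !inE; exact: csub_linear.
Qed.

HB.instance Definition _ := GRing.isSubmodClosed.Build R[i] H csub_pred csub_submod_closed.

Record csub := CSub { csub_val :> H; csub_valP : csub_val \in csub_pred }.

HB.instance Definition _ := [isSub for csub_val].
HB.instance Definition _ := [Choice of csub by <:].
HB.instance Definition _ := [SubChoice_isSubLmodule of csub by <:].

Lemma csubP (x : csub) : S (csub_val x).
Proof. by have := csub_valP x; rewrite inE. Qed.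

Definition csub_norm (x : csub) : R[i] := `|csub_val x|.

Fact csub_normD (x y : csub) : csub_norm (x + y) <= csub_norm x + csub_norm y.
Proof. exact: ler_normD. Qed.

Fact csub_normZ (a : R[i]) (x : csub) : csub_norm (a *: x) = `|a| * csub_norm x.
Proof. exact: normrZ. Qed.

Fact csub_norm_eq0 (x : csub) : csub_norm x = 0 -> x = 0.
Proof. by move=> /normr0_eq0 x0; apply: val_inj. Qed.

HB.instance Definition _ :=
  Lmodule_isNormed.Build R[i] csub csub_normD csub_normZ csub_norm_eq0.

Definition csub_dot (x y : csub) : R[i] := hdot H (csub_val x) (csub_val y).

Fact csub_dot_bilinear :
  bilinear_for (GRing.Scale.Law.clone _ _ ( *%R) _)
               (GRing.Scale.Law.clone _ _ (Num.conj \; *%R) _) csub_dot.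
Proof.
split=> [y a x x'|x a y y'] /=.
  by rewrite /csub_dot -hdotZl -hdotDl.
by rewrite /csub_dot -hdotZr -hdotDr.
Qed.

HB.instance Definition _ :=
  bilinear_isBilinear.Build R[i] csub csub R[i] *%R (Num.conj \; *%R) csub_dot
    csub_dot_bilinear.

Fact csub_dotC (x y : csub) : csub_dot x y = (-1) ^+ false * (csub_dot y x)^*.
Proof. by rewrite expr0 mul1r; exact: hdotC. Qed.

HB.instance Definition _ :=
  isHermitianSesquilinear.Build R[i] csub false Num.conj csub_dot csub_dotC.

Fact csub_dot_gt0 (x : csub) : x != 0 -> 0 < csub_dot x x.
Proof.
move=> x0; rewrite /csub_dot -hdot_norm exprn_gt0 // normr_gt0.
by apply: contra_neq x0 => e; apply: val_inj.
Qed.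

HB.instance Definition _ := isDotProduct.Build R[i] csub csub_dot csub_dot_gt0.

Lemma csub_complete (F : set_system csub) : ProperFilter F -> cauchy F -> cvg F.
Proof.
move=> FF Fc; pose F' : set_system H := csub_val @ F.
have F'c : cauchy F'.
  apply/cauchy_ballP => e e0; move/cauchy_ballP: Fc => /(_ e e0)[[A B] /= [FA FB] AB].
  exists (csub_val @` A, csub_val @` B).
    by split; [apply: filterS FA|apply: filterS FB] => x Ax; exists x.
  move=> [_ _] /= [[x Ax <-] [y By <-]].
  by have := AB (x, y) (conj Ax By); rewrite -!ball_normE.
have F'F : ProperFilter F' := fmap_proper_filter csub_val FF.
have F'l : F' --> lim F' := @cauchy_cvg _ F' F'F F'c.
have near_l (e : R[i]) : 0 < e -> F [set x : csub | `|lim F' - csub_val x| <= e].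
  by move=> e0; move/cvgrPdist_le: F'l => /(_ e e0).
have Sl : S (lim F').
  apply: csub_closed => e e0.
  have e0' : 0 < e%:C%C by rewrite ltcR.
  have [x xe] := filter_ex (near_l _ e0').
  by exists (csub_val x); split; [exact: csubP|rewrite distrC].
have Sl' : lim F' \in csub_pred by rewrite inE.
apply/cvg_ex; exists (CSub Sl'); apply/cvgrPdist_le => e e0.
exact: near_l.
Qed.

HB.instance Definition _ := Uniform_isComplete.Build csub csub_complete.

Fact csub_dot_norm (x : csub) : `|x| ^+ 2 = csub_dot x x.
Proof. exact: hdot_norm. Qed.

Definition csub_hilbert : hilbertSpace R := @HilbertSpace R csub csub_dot csub_dot_norm.

End SubHilbertSpace.

Section OrthogonalProjection.
Variables (R : realType) (H : hilbertSpace R).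

Lemma hilbert_cauchy_seq (u : nat -> H) :
  (forall e : R, 0 < e -> exists N, forall m n, (N <= m)%N -> (N <= n)%N -> hn (u m - u n) <= e) ->
  exists y, forall e : R, 0 < e -> exists N, forall n, (N <= n)%N -> hn (u n - y) <= e.
Proof.
move=> uC.
have uc : cauchy (u n @[n --> \oo]).
  apply/cauchy_ballP => e e0.
  have [r r0 er] : exists2 r : R, 0 < r & e = r%:C%C.
    exists (complex.Re e); first by move: e0; rewrite ltcE => /andP[].
    by rewrite RRe_real // ger0_real // ltW.
  have [N NP] := uC (r / 2) (divr_gt0 r0 (ltr0Sn R 1)).
  exists (u @` [set n | (N <= n)%N], u @` [set n | (N <= n)%N]).
    by split; exists N => // n /= Nn; exists n.
  move=> [_ _] /= [[m Nm <-] [n Nn <-]]; rewrite -ball_normE /= hnE er ltcR.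
  apply: le_lt_trans (NP _ _ Nm Nn) _; lra.
have ul : u n @[n --> \oo] --> lim (u n @[n --> \oo]) by exact: cauchy_cvg uc.
exists (lim (u n @[n --> \oo])) => e e0.
have e0' : 0 < e%:C%C by rewrite ltcR.
move/cvgrPdist_le: ul => /(_ _ e0')[N _ NP].
by exists N => n Nn; have := NP n Nn; rewrite /= distrC hnE lecR.
Qed.

Lemma hn_parallelogram (x y : H) :
  hn (x + y) ^+ 2 + hn (x - y) ^+ 2 = 2 * (hn x ^+ 2 + hn y ^+ 2).
Proof.
have := parallelogram x y; rewrite !hnE -!rmorphXn -!rmorphD => e.
apply: (@complexI R); rewrite [LHS]e; rewrite rmorphM; congr (_ * _).
by rewrite rmorph_nat.
Qed.

Lemma hnZ (t : R) (x : H) : hn (t%:C%C *: x) = `|t| * hn x.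
Proof.
apply: (@complexI R); rewrite rmorphM /= -!hnE normrZ; congr (_ * _).
by rewrite normc_def /= expr0n addr0 sqrtr_sqr.
Qed.

Lemma hnN (x : H) : hn (- x) = hn x.
Proof. by rewrite /hn normrN. Qed.

Variable S : closedSubspace H.

Lemma csub_add x y : S x -> S y -> S (x + y).
Proof. by move=> Sx Sy; have := csub_linear 1 Sx Sy; rewrite scale1r. Qed.

Lemma csub_scale a x : S x -> S (a *: x).
Proof. by move=> Sx; have := csub_linear a Sx (csub_zero S); rewrite addr0. Qed.

Lemma csub_sub x y : S x -> S y -> S (x - y).
Proof. by move=> Sx Sy; apply: csub_add => //; rewrite -scaleN1r; exact: csub_scale. Qed.

(** A minimizing sequence is Cauchy, its limit attains the distance, and varying the limit along z
    gives orthogonality. *)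
Lemma orthogonal_projection (x : H) :
  exists2 y, S y & forall z, S z -> hdot H (x - y) z = 0.
Proof.
pose DD := [set hn (x - z) ^+ 2 | z in [set z | S z]].
have hD : has_inf DD.
  split; first by exists (hn (x - 0) ^+ 2), 0 => //; exact: csub_zero.
  by exists 0 => _ [z _ <-]; exact: sqr_ge0.
pose d := inf DD.
have dle z : S z -> d <= hn (x - z) ^+ 2 by move=> Sz; apply: ge_inf; [exact: hD.2|exists z].
have /choice[u uP] (n : nat) : exists z, S z /\ hn (x - z) ^+ 2 < d + n.+1%:R^-1.
  have n0 : 0 < (n.+1%:R^-1 : R) by rewrite invr_gt0 ltr0n.
  by have [_ [z Sz <-] zd] := @inf_adherent _ DD _ n0 hD; exists z.
(* The parallelogram law, with the midpoint of u m and u n in S and so at squared distance at least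
   d from x. *)
have uu m n : hn (u m - u n) ^+ 2 <= 2 * (m.+1%:R^-1 + n.+1%:R^-1).
  have [Sm dm] := uP m; have [Sn dn] := uP n.
  have Smid : S ((2^-1 : R)%:C%C *: (u m + u n)) by apply: csub_scale; exact: csub_add.
  have := dle _ Smid.
  have -> : hn (x - (2^-1 : R)%:C%C *: (u m + u n)) = 2^-1 * hn ((x - u m) + (x - u n)).
    rewrite -[X in X * _](@ger0_norm R) ?invr_ge0 // -hnZ; congr hn.
    rewrite addrACA -opprD scalerBr; congr (_ - _).
    have -> : x + x = (2 : R)%:C%C *: x by rewrite rmorph_nat scaler_nat mulr2n.
    rewrite scalerA -rmorphM mulVf ?pnatr_eq0 //.
    by rewrite rmorph1 scale1r.
  have -> : u m - u n = (x - u n) - (x - u m) by rewrite opprB [RHS]addrC addrA subrK.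
  have := hn_parallelogram (x - u n) (x - u m).
  rewrite [(x - u n) + _]addrC exprMn; move: dm dn.
  move: (hn (x - u m) ^+ 2) (hn (x - u n) ^+ 2) (hn (x - u m + _) ^+ 2) (hn (x - u n - _) ^+ 2).
  move: (m.+1%:R^-1) (n.+1%:R^-1) => p q a b c e; lra.
have uC (e : R) : 0 < e -> exists N, forall m n, (N <= m)%N -> (N <= n)%N -> hn (u m - u n) <= e.
  move=> e0; have e20 : 0 < e ^+ 2 / 4 by rewrite divr_gt0 // exprn_gt0.
  pose N := Num.truncn (e ^+ 2 / 4)^-1.
  have Nh m : (N <= m)%N -> m.+1%:R^-1 <= e ^+ 2 / 4.
    move=> Nm; rewrite -[leRHS]invrK lef_pV2 ?posrE ?invr_gt0 ?ltr0n //.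
    apply: (@le_trans _ _ N.+1%:R); last by rewrite ler_nat.
    by apply: ltW; exact: truncnS_gt.
  exists N => m n /Nh hm /Nh hn'.
  rewrite -(@ler_pXn2r _ 2) ?nnegrE ?hn_ge0 ?(ltW e0) //.
  by apply: le_trans (uu m n) _; move: hm hn'; move: (e ^+ 2) (m.+1%:R^-1) (n.+1%:R^-1) => ? ? ? ? ?; lra.
have [y yP] := hilbert_cauchy_seq uC.
have Sy : S y.
  apply: csub_closed => e e0; have [N NP] := yP e e0.
  by exists (u N); split; [case: (uP N)|rewrite hnE lecR NP].
have yd : hn (x - y) ^+ 2 <= d.
  apply/ler_addgt0Pr => e e0.
  have c0 : 0 < 2 * hn (x - y) + 1 by rewrite ltr_wpDl // mulr_ge0 // hn_ge0.
  have e20 : 0 < e / 2 by rewrite divr_gt0.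
  (* With p = |x - y|, the bound t (2p + 1) <= e / 2 controls the change of the squared distance
     when u M replaces y; the other e / 2 covers 1 / (M + 1). *)
  pose t := Num.min 1 (e / 2 / (2 * hn (x - y) + 1)).
  have t0 : 0 < t by rewrite lt_min ltr01 divr_gt0.
  have [N NP] := yP t t0.
  pose M := maxn N (Num.truncn (e / 2)^-1).
  have hM : M.+1%:R^-1 <= e / 2.
    rewrite -[leRHS]invrK lef_pV2 ?posrE ?invr_gt0 ?ltr0n //.
    apply: (@le_trans _ _ (Num.truncn (e / 2)^-1).+1%:R); last by rewrite ler_nat ltnS leq_maxr.
    by apply: ltW; exact: truncnS_gt.
  have [_ uM] := uP M; have yM := NP M (leq_maxl _ _).
  have tr : hn (x - y) <= hn (x - u M) + hn (u M - y).
    by have := hn_triangle (x - u M) (u M - y); rewrite addrA subrK.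
  have tt : t * (2 * hn (x - y) + 1) <= e / 2.
    by rewrite -ler_pdivlMr // ge_min lexx orbT.
  have p0 := hn_ge0 (x - y).
  have [h|h] := lerP (hn (x - y)) t.
    have d0 : 0 <= d by apply: lb_le_inf => [|_ [z _ <-]]; [exact: hD.1|exact: sqr_ge0].
    move: tt h d0 e0; move: (hn (x - y)) p0 => p p0; nra.
  have : hn (x - y) - t <= hn (x - u M) by lra.
  move=> h2; have h3 : (hn (x - y) - t) ^+ 2 <= hn (x - u M) ^+ 2.
    by rewrite ler_pXn2r ?nnegrE ?hn_ge0 // subr_ge0 ltW.
  move: tt h3 uM hM t0; move: (hn (x - y)) (hn (x - u M) ^+ 2) (M.+1%:R^-1) p0 => p q s p0.
  nra.
exists y => // z Sz.
set c := hdot H (x - y) z.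
have expand (w : H) (a : R[i]) : hdot H (w - a *: z) (w - a *: z) - hdot H w w =
    - (a * hdot H z w) - a^* * hdot H w z + a * a^* * hdot H z z.
  by rewrite hdotBl !hdotBr !hdotZl !hdotZr; ring.
have key (a : R[i]) : 0 <= complex.Re (- (a * c^* ) - a^* * c + a * a^* * hdot H z z).
  have := dle (y + a *: z) (csub_add Sy (csub_scale a Sz)).
  move=> /(le_trans yd); rewrite -lecR -!hdot_hn -subr_ge0.
  have -> : x - (y + a *: z) = (x - y) - a *: z by rewrite opprD addrA.
  by rewrite expand (hdotC z (x - y)) -/c lecE => /andP[_].
(* For a = c / K the variation is |c|^2 / K times |z|^2 / K - 2, and the latter is negative; hence c
   = 0. *)
pose K := hn z ^+ 2 + 1.
have K0 : 0 < K by rewrite ltr_wpDl // sqr_ge0.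
have := key ((K^-1)%:C%C * c).
rewrite hdot_hn.
have -> : - (((K^-1)%:C%C * c) * c^* ) - ((K^-1)%:C%C * c)^* * c +
   ((K^-1)%:C%C * c) * ((K^-1)%:C%C * c)^* * (hn z ^+ 2)%:C%C =
   (normsq c * (K^-1) * (K^-1 * hn z ^+ 2 - 2))%:C%C.
  rewrite !(rmorphM, rmorphB, rmorphXn) /= conjRC normsqE rmorph_nat; ring.
rewrite /= => h; apply: normsq_eq0; apply/eqP; rewrite eq_le normsq_ge0 andbT.
have h1 : K^-1 * hn z ^+ 2 <= 1 by rewrite ler_pdivrMl // mulr1 lerDl.
have h2 : 0 < K^-1 by rewrite invr_gt0.
have h3 := normsq_ge0 c.
rewrite leNgt; apply/negP => h4.
have : 0 < normsq c * K^-1 by rewrite mulr_gt0.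
by move: h; move: (normsq c * K^-1) => w; nra.
Qed.

End OrthogonalProjection.

(** * Property (T) *)

(** The regular representation of Q, pulled back to G, has almost invariant vectors. A nonzero
    invariant vector is a constant function on Q, and it is square summable only if Q is finite. *)
Lemma property_T_amenable_quotient (R : realType) (G Q : groupType) (f : G -> Q) :
  {morph f : x y / (x * y)%g} -> (forall c, exists x, c = f x) ->
  almost_invariant_vectors R Q -> property_T R G -> finite_set [set: Q].
Proof.
move=> fM fsurj aQ [S [e [fS e0 TS]]].
have [E SE] := (finite_seqP S).1 fS.
pose H := l2_hilbert R Q.
have ur : unitary_rep (fun g => @left_regular R Q (f g) : H -> H).
  split=> [g|g x y|x|g h x].
  - exact: left_regular_linear.
  - exact: left_regular_dot.
  - by rewrite (morph_one fM) left_regular1.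
  - by rewrite fM left_regularM.
(* The squared displacement is 2 - 2r with r >= 1 - e^2 / 4, hence at most e^2 / 2 < e^2. *)
have e40 : 0 < e ^+ 2 / 4 by rewrite divr_gt0 // exprn_gt0.
have [s [a [us a0 as_ a1 aE]]] := aQ (map f E) _ e40.
pose x : H := \sum_(y <- s) (a y)%:C%C *: (l2_delta R y : H).
have xE t : x t = (a t)%:C%C.
  rewrite l2_val_sum.
  have h y : ((a y)%:C%C *: (l2_delta R y : H)) t = (a y)%:C%C * (t == y)%:R by [].
  under eq_bigr do rewrite h.
  rewrite (@sum_single _ _ _ t _ us) => [|y yt]; last by rewrite eq_sym (negbTE yt) mulr0.
  rewrite eqxx mulr1; case: ifPn => // ts.
  by have -> : a t = 0 by apply: contraNeq ts => /as_.
have xs t : t \notin s -> x t = 0.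
  move=> ts; rewrite xE; have -> // : a t = 0 by apply: contraNeq ts => /as_.
have dE g : hdot H (left_regular g x) x = (\sum_(y <- s) a y * a (g * y)%g)%:C%C.
  rewrite (@finsupp_dot R Q s) // rmorph_sum; apply: eq_bigr => y _.
  by rewrite !xE conjRC rmorphM.
have x1 : hdot H x x = 1.
  rewrite -[X in hdot H X _]left_regular1 dE -(rmorph1 (real_complex R)); congr (_%:C%C).
  by rewrite -a1; apply: eq_bigr => y _; rewrite mul1g expr2.
have hx : hn x = 1.
  apply/eqP; rewrite -(@pexpr_eq1 _ _ 2) ?hn_ge0 //; apply/eqP.
  by apply: (@complexI R); rewrite -hdot_hn x1.
have ax : exists2 x : H, x != 0 &
    forall g, S g -> `|left_regular (f g) x - x| < e%:C%C * `|x|.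
  exists x.
    by apply: contraTneq isT => x0; move: x1; rewrite x0 hdot0l => /eqP; rewrite eq_sym oner_eq0.
  move=> g Sg; rewrite !hnE hx -rmorphM mulr1 ltcR.
  rewrite -(@ltr_pXn2r _ 2) ?nnegrE ?hn_ge0 ?(ltW e0) //.
  have gE : f g \in map f E by apply: map_f; move: Sg; rewrite SE.
  have := aE _ gE; set r := \sum_(y <- s) _ => hr.
  have -> : hn (left_regular (f g) x - x) ^+ 2 = 2 - 2 * r.
    apply: (@complexI R); rewrite -hdot_hn hdotBl !hdotBr left_regular_dot x1.
    rewrite (hdotC x) dE conjRC -/r rmorphB rmorphM rmorph_nat /=; ring.
  by have := e40; lra.
have [z z0 zinv] := TS H _ ur ax.
have zc t : z t = z 1%g.
  have [g gt] := fsurj t; have := zinv g => /(congr1 (fun w : H => w t)) <-.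
  by rewrite left_regularE -gt mulVg.
have c0 : normsq (z 1%g) != 0.
  apply: contra_neq z0 => /normsq_eq0 h; apply: l2P => t; rewrite zc h //.
have cpos : 0 < normsq (z 1%g) by rewrite lt_neqAle eq_sym c0 normsq_ge0.
apply: contrapT => infQ.
pose n := (Num.truncn (l2_norm2 z / normsq (z 1%g))).+1.
have [D _ nD] := infinite_set_fset n infQ.
have := ler_psumR (l2_summable z) (fun t => normsq_ge0 _) (finmap.fset_uniq D).
rewrite -/(l2_norm2 z) (eq_bigr (fun=> normsq (z 1%g))) => [|t _]; last by rewrite zc.
rewrite big_const_seq count_predT iter_addr addr0 -mulr_natl.
rewrite -ler_pdivlMr // leNgt => /negP; apply.
apply: lt_le_trans (truncnS_gt _) _; by rewrite ler_nat.
Qed.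

Lemma abelianization_finite (R : realType) (G : groupType) :
  property_T R G -> finite_set [set: quotient_group (derivedSubgroup G)].
Proof.
apply: (property_T_amenable_quotient (@coset_piM _ (derivedSubgroup G))).
  exact: coset_pi_surj.
apply: reiter_almost_invariant; apply: reiter_class2 => x y.
have [u ->] := coset_pi_surj x; have [v ->] := coset_pi_surj y.
rewrite -(morph_comm (@coset_piM _ _)).
suff -> : coset_pi (derivedSubgroup G) (comm u v) = 1%g by exact: subgroup1 (@central_subgroup _).
by apply/coset_pi1; apply: subset_generated; exists u, v.
Qed.

(* [A, B] is the product of the finitely many finite groups [A, b]. *)
Lemma np_center_finite (R : realType) (A B : groupType) :
  property_T R A -> property_T R B -> finite_set (@np_center A B).
Proof.
move=> /abelianization_finite fA /abelianization_finite fB.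
pose P : groupType := nilpotent_product2 A B.
pose c (a : A) (b : B) : P := comm (np_inl B a) (np_inr A b).
(* Elements with the same class in the abelianization differ by a derived element, on which the
   morphism c(-, b) is trivial; so finitely many representatives give all values. *)
have cA a a' b : coset_pi (derivedSubgroup A) a = coset_pi (derivedSubgroup A) a' -> c a b = c a' b.
  move=> /coset_eqP d; rewrite -[a'](mulVKg a) /c (np_comml_morph b) /=.
  rewrite [X in _ = (_ * X)%g](comm1P _ _).2 ?mulg1 //; exact: np_comm_derivedl.
have cB a b b' : coset_pi (derivedSubgroup B) b = coset_pi (derivedSubgroup B) b' -> c a b = c a b'.
  move=> /coset_eqP d; rewrite -[b'](mulVKg b) /c (np_commr_morph a) /=.
  rewrite [X in _ = (_ * X)%g](comm1P _ _).2 ?mulg1 //; exact: np_comm_derivedr.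
have fC b : finite_set [set c a b | a in [set: A]].
  apply: (@sub_finite_set _ _ [set c (repr q) b | q in [set: quotient_group (derivedSubgroup A)]]).
    move=> _ [a _ <-]; exists (coset_pi _ a) => //.
    by apply: cA; rewrite /coset_pi reprK.
  exact: finite_image.
have [bs bsE] := (finite_seqP _).1 fB.
pose F := fix F (r : seq (quotient_group (derivedSubgroup B))) : set P :=
  if r is q :: r' then [set (x * y)%g | x in [set c a (repr q) | a in [set: A]] & y in F r']
  else [set 1%g].
have fF r : finite_set (F r).
  elim: r => [|q r IHr]; first exact: finite_set1.
  exact: finite_image2.
have cc a b : central (c a b) := np_comm_central a b.
have Fc r x : F r x -> central x.
  elim: r x => [x ->|q r IHr _ [_ [a _ <-] [y /IHr cy <-]]].
    exact: subgroup1 (@central_subgroup _).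
  exact: subgroupM (@central_subgroup _) (cc _ _) cy.
have sF r : is_subgroup (F r).
  elim: r => [|q r IHr].
    by split=> // x y -> ->; rewrite /= mulgV.
  split=> [|_ _ [_ [a _ <-] [y Fy <-]] [_ [a' _ <-] [y' Fy' <-]]].
    exists 1%g; first by exists 1%g => //; rewrite /c (morph_one (np_comml_morph _)).
    by exists 1%g; [exact: subgroup1 IHr|rewrite mulg1].
  exists (c (a * a'^-1)%g (repr q)); first by exists (a * a'^-1)%g.
  exists (y * y'^-1)%g; first exact: IHr.2.
  rewrite /c (np_comml_morph (repr q)) (morph_inv (np_comml_morph (repr q))) -/(c _ _) -/(c _ _).
  have Fyc := Fc _ _ Fy; have Fyc' := Fc _ _ Fy'.
  have Vc := subgroupV (@central_subgroup _) (cc a' (repr q)).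
  move: (c a (repr q)) (c a' (repr q)) Vc => u u' Vc.
  by rewrite invgM -!mulgA; congr (_ * _)%g; rewrite Vc !mulgA.
apply: sub_finite_set (fF bs) => x; apply; first exact: sF.
move=> _ [a [b ->]].
pose q := coset_pi (derivedSubgroup B) b.
have -> : comm (np_inl B a) (np_inr A b) = c a (repr q).
  by apply: cB; rewrite /coset_pi reprK.
have : q \in bs by have : [set: quotient_group (derivedSubgroup B)] q by []; rewrite bsE.
elim: (bs) => // q' r IHr; rewrite inE => /predU1P[<-|/IHr Fr].
  exists (c a (repr q)); first by exists a.
  by exists 1%g; [exact: subgroup1 (sF r)|rewrite mulg1].
exists 1%g; first by exists 1%g => //; rewrite /c (morph_one (np_comml_morph _)).
by exists (c a (repr q)) => //; rewrite mul1g.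
Qed.

(** * Fixed vectors and subrepresentations *)

Section FixedSpaces.
Variables (R : realType) (G : groupType) (H : hilbertSpace R) (pi : G -> H -> H).
Hypothesis upi : unitary_rep pi.

Lemma unitary_linear g : linear (pi g).
Proof. by case: upi. Qed.

Lemma unitaryM g h x : pi (g * h)%g x = pi g (pi h x).
Proof. by case: upi. Qed.

Lemma unitary1 x : pi 1%g x = x.
Proof. by case: upi. Qed.

Lemma unitary_hn g x : hn (pi g x) = hn x.
Proof.
case: upi => _ dotp _ _; apply/eqP; rewrite -(@eqrXn2 _ 2) ?hn_ge0 //; apply/eqP.
by apply: (@complexI R); rewrite -!hdot_hn dotp.
Qed.

Lemma unitary_adjoint g x y : hdot H (pi g x) y = hdot H x (pi g^-1%g y).
Proof. by case: upi => _ dotp _ _; rewrite -[RHS](dotp g) -unitaryM mulgV unitary1. Qed.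

Lemma unitary_sub g x y : pi g (x - y) = pi g x - pi g y.
Proof. exact: linear_map_sub (unitary_linear g). Qed.

Lemma hn_le_eq0 (x : H) : (forall e : R, 0 < e -> hn x <= e) -> x = 0.
Proof.
move=> h; apply/eqP; rewrite -normr_eq0 hnE; apply/eqP; congr (_%:C%C).
apply/eqP; rewrite eq_le hn_ge0 andbT; apply/ler_addgt0Pr => e e0.
by rewrite add0r h.
Qed.

Section FixedSpace.
Variable S : set G.
Local Notation fixed x := (forall g, S g -> pi g x = x).

Fact fixed_zero : fixed 0.
Proof. by move=> g _; have [_ _ ->] := linear_additive (unitary_linear g). Qed.

Fact fixed_linear (a : R[i]) x y : fixed x -> fixed y -> fixed (a *: x + y).
Proof. by move=> xS yS g Sg; rewrite unitary_linear xS // yS. Qed.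

Fact fixed_closed y : (forall e : R, 0 < e ->
  exists z, fixed z /\ `|z - y| <= (e%:C)%C) -> fixed y.
Proof.
move=> hy g Sg; apply/eqP; rewrite -subr_eq0; apply/eqP; apply: hn_le_eq0 => e e0.
have [z [zS zy]] := hy (e / 2) (divr_gt0 e0 (ltr0Sn R 1)).
have zy' : hn (y - z) <= e / 2 by rewrite -hnN opprB -lecR -hnE.
have -> : pi g y - y = pi g (y - z) + (z - y).
  by rewrite unitary_sub zS // addrA subrK.
apply: le_trans (hn_triangle _ _) _; rewrite unitary_hn.
have : hn (z - y) <= e / 2 by rewrite -lecR -hnE.
by move: zy'; lra.
Qed.

Definition fixedSpace : closedSubspace H :=
  ClosedSubspace fixed_zero fixed_linear fixed_closed.

End FixedSpace.

Section Orthocomplement.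
Variables K L : closedSubspace H.
Local Notation orth x := (K x /\ forall z, L z -> hdot H x z = 0).

Fact orth_zero : orth 0.
Proof. by split=> [|z _]; [exact: csub_zero|rewrite hdot0l]. Qed.

Fact orth_linear (a : R[i]) x y : orth x -> orth y -> orth (a *: x + y).
Proof.
move=> [Kx Lx] [Ky Ly]; split=> [|z Lz]; first exact: csub_linear.
by rewrite hdotDl hdotZl Lx // Ly // mulr0 addr0.
Qed.

Fact orth_closed y : (forall e : R, 0 < e ->
  exists z, orth z /\ `|z - y| <= (e%:C)%C) -> orth y.
Proof.
move=> hy; split=> [|z Lz].
  by apply: csub_closed => e /hy[z [[Kz _] zy]]; exists z.
apply/eqP; rewrite -normr_eq0; apply/eqP; rewrite -real_norm; congr (_%:C%C).
apply/eqP; rewrite eq_le -[X in _ && X]ler0c real_norm normr_ge0 andbT.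
apply/ler_addgt0Pr => e e0; rewrite add0r.
have c0 : 0 < hn z + 1 by rewrite ltr_wpDl // hn_ge0.
have [t [[_ Lt] ty]] := hy (e / (hn z + 1)) (divr_gt0 e0 c0).
have -> : hdot H y z = - hdot H (t - y) z by rewrite hdotBl Lt // sub0r opprK.
rewrite normrN; apply: le_trans (hdot_CS_real _ _) _.
have ty' : hn (t - y) <= e / (hn z + 1) by rewrite -lecR -hnE.
apply: (@le_trans _ _ (e / (hn z + 1) * (hn z + 1))); last by rewrite divfK // gt_eqF.
by apply: ler_pM; rewrite ?hn_ge0 // lerDl.
Qed.

Definition orthocomplement : closedSubspace H :=
  ClosedSubspace orth_zero orth_linear orth_closed.

End Orthocomplement.

End FixedSpaces.

(** The Kazhdan pair is applied to the subrepresentation on K, so that the invariant vector is found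
    inside K. *)
Lemma property_T_subspace (R : realType) (G : groupType) (Q : set G) (e : R)
    (H : hilbertSpace R) (pi : G -> H -> H) (K : closedSubspace H) :
  (forall (H : hilbertSpace R) (pi : G -> H -> H), unitary_rep pi ->
    (exists2 x : H, x != 0 & forall g, Q g -> `|pi g x - x| < (e%:C)%C * `|x|) ->
    exists2 x : H, x != 0 & forall g, pi g x = x) ->
  unitary_rep pi -> (forall g x, K x -> K (pi g x)) ->
  forall x, K x -> x != 0 -> (forall g, Q g -> hn (pi g x - x) < e * hn x) ->
  exists2 z, K z & z != 0 /\ forall g, pi g z = z.
Proof.
move=> TG [lpi dpi pi1 piM] piK x Kx x0 hx.
have inK y : K y -> y \in csub_pred K by rewrite inE.
pose pi' g (y : csub_hilbert K) : csub_hilbert K := CSub (inK _ (piK g _ (csubP y))).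
have upi' : unitary_rep pi'.
  split.
  - by move=> g a y z; apply: val_inj; exact: lpi.
  - by move=> g y z; exact: dpi.
  - by move=> y; apply: val_inj; exact: pi1.
  - by move=> g h y; apply: val_inj; exact: piM.
have [|z z0 zinv] := TG _ _ upi'.
  exists (CSub (inK _ Kx) : csub_hilbert K).
    by apply: contra_neq x0 => /(congr1 (fun w : csub_hilbert K => csub_val w)).
  move=> g Qg; have := hx g Qg; rewrite -ltcR rmorphM /= -!hnE; exact.
exists (csub_val z); first exact: csubP.
split; first by apply: contra_neq z0 => h; apply: val_inj.
by move=> g; have := zinv g => /(congr1 (fun w : csub_hilbert K => csub_val w)).
Qed.

(** H1 consists of the vectors fixed by N and A. Its complement K among the N-fixed vectors contains
    no nonzero A-invariant vector, so a nearly A-invariant vector has a small component there, and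
    projecting to H1 keeps it almost B-invariant. *)
Lemma np_property_T (R : realType) (A B : groupType) :
  property_T R A -> property_T R B -> property_T R (nilpotent_product2 A B).
Proof.
move=> TA TB; have fN := np_center_finite TA TB.
have [QA [eA [fQA eA0 TA']]] := TA; have [QB [eB [fQB eB0 TB']]] := TB.
pose P : groupType := nilpotent_product2 A B.
pose iA : A -> P := @np_inl A B; pose iB : B -> P := @np_inr A B.
have iAM : {morph iA : x y / (x * y)%g} := @np_inlM A B.
have iBM : {morph iB : x y / (x * y)%g} := @np_inrM A B.
pose N : set P := @np_center A B.
have sN : is_subgroup N := np_center_subgroup A B.
have cN n : N n -> central n by exact: np_center_central.
(* r |x| will bound |y1 - x|, where e (1 + 3 / eA) = r. Then r <= 1/2 gives |y1| >= |x| / 2, and B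
   moves y1 by at most (2r + e) |x| <= 3r |x| < eB |y1|. *)
pose r := Num.min (1 / 2) (eB / 8).
have r0 : 0 < r by rewrite lt_min !divr_gt0.
have r1 : r <= 1 / 2 by rewrite ge_min lexx.
have r2 : r <= eB / 8 by rewrite ge_min lexx orbT.
have m0 : 0 < 1 + 3 / eA by rewrite addr_gt0 // divr_gt0.
pose e := r / (1 + 3 / eA).
have e0 : 0 < e by rewrite divr_gt0.
exists ((iA @` QA) `|` (iB @` QB) `|` N), e; split=> //.
  by rewrite !finite_setU; split=> //; split; exact: finite_image.
move=> H pi upi [x x0 hx].
have [lpi dpi pi1 piM] := upi.
have hx' g : ((iA @` QA) `|` (iB @` QB) `|` N) g -> hn (pi g x - x) <= e * hn x.
  by move=> /hx /ltW; rewrite !hnE -rmorphM lecR.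
have hnx : 0 < hn x.
  by rewrite lt_neqAle hn_ge0 andbT eq_sym; apply: contra_neq x0 => h;
    apply/eqP; rewrite -normr_eq0 hnE h.
have uA : unitary_rep (fun a => pi (iA a)).
  split=> [a|a y z|y|a a' y]; [exact: lpi|exact: dpi| |by rewrite iAM piM].
  by rewrite (morph_one iAM) pi1.
have uB : unitary_rep (fun b => pi (iB b)).
  split=> [a|a y z|y|a a' y]; [exact: lpi|exact: dpi| |by rewrite iBM piM].
  by rewrite (morph_one iBM) pi1.
have [ln lnE] := (finite_seqP N).1 fN.
pose l := undup ln.
have lE n : n \in l <-> N n by rewrite mem_undup lnE.
have ul : uniq l := undup_uniq _.
have l1 : 1%g \in l by apply/lE; exact: subgroup1 sN.
have szl : 0 < (size l)%:R :> R by rewrite ltr0n; case: (l) l1.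
(* The average over N is fixed by N. It stays within e |x| of x because the Kazhdan set contains all
   of N. *)
pose y := ((size l)%:R^-1 : R)%:C%C *: \sum_(n <- l) pi n x.
have yN n : N n -> pi n y = y.
  move=> Nn; have [_ Z _] := linear_additive (lpi n).
  rewrite /y Z (linear_map_sum _ _ (lpi n)); congr (_ *: _).
  under eq_bigr do rewrite -piM.
  rewrite -(big_map (fun m => n * m)%g xpredT (fun m => pi m x)).
  apply: perm_big; apply: uniq_perm => //; first by rewrite map_inj_uniq //; exact: mulgI.
  move=> m; apply/mapP/idP => [[k /lE Nk ->]|/lE Nm]; first by apply/lE; exact: (subgroupM sN).
  exists (n^-1 * m)%g; last by rewrite mulVKg.
  by apply/lE; apply: (subgroupM sN) => //; exact: (subgroupV sN).
have yx : hn (y - x) <= e * hn x.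
  have -> : y - x = ((size l)%:R^-1 : R)%:C%C *: \sum_(n <- l) (pi n x - x).
    rewrite sumrB scalerBr; congr (_ - _).
    rewrite big_const_seq count_predT iter_addr addr0.
    have -> : x *+ size l = ((size l)%:R : R)%:C%C *: x by rewrite rmorph_nat scaler_nat.
    by rewrite scalerA -rmorphM mulVf ?gt_eqF // rmorph1 scale1r.
  rewrite hnZ ger0_norm ?invr_ge0 ?ler0n // ler_pdivrMl //.
  have hsum (s : seq P) : {in s, forall n, N n} ->
      hn (\sum_(n <- s) (pi n x - x)) <= (size s)%:R * (e * hn x).
    elim: s => [|n s IHs] sN'; first by rewrite big_nil /hn normr0 mul0r.
    rewrite big_cons; apply: le_trans (hn_triangle _ _) _.
    rewrite /= -natr1 mulrDl mul1r addrC; apply: lerD.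
      by apply: IHs => m ms; apply: sN'; rewrite inE ms orbT.
    by apply: hx'; right; apply: sN'; rewrite mem_head.
  by apply: hsum => n /lE.
pose H0 := fixedSpace upi N.
pose H1 := fixedSpace upi (N `|` range iA).
have H10 z : H1 z -> H0 z by move=> H1z g Ng; apply: H1z; left.
have H0P g z : H0 z -> H0 (pi g z).
  by move=> H0z n Nn; rewrite -piM (cN n Nn) piM H0z.
have H1A a z : H1 z -> pi (iA a) z = z by apply; right; exists a.
have H1N n z : N n -> H1 z -> pi n z = z by move=> Nn; apply; left.
pose K := orthocomplement H0 H1.
have KA a z : K z -> K (pi (iA a) z).
  move=> [H0z zo]; split=> [|w H1w]; first exact: H0P.
  by rewrite (unitary_adjoint upi) -(morph_inv iAM) H1A // zo.
have H1B b z : H1 z -> H1 (pi (iB b) z).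
  move=> H1z g [Ng|[a _ <-]].
    by rewrite -piM (cN g Ng) piM (H1N _ _ Ng).
  have Nc : N (comm (iA a) (iB b)) by apply: subset_generated; exists a, b.
  rewrite -piM commE piM (piM (iB b)) H1A //.
  by rewrite -piM (cN _ Nc) piM (H1N _ _ Nc).
have [y1 H1y1 yo] := orthogonal_projection H1 y.
pose y2 := y - y1.
have Ky2 : K y2 by split=> //; apply: csub_sub => //; exact: H10.
have hy g : ((iA @` QA) `|` (iB @` QB) `|` N) g -> hn (pi g y - y) <= 3 * e * hn x.
  move=> Qg; have -> : pi g y - y = pi g (y - x) + (pi g x - x) + (x - y).
    by rewrite (unitary_sub upi) !addrA !subrK.
  apply: le_trans (hn_triangle _ _) _; rewrite -[hn (x - y)]hnN opprB.
  have := hn_triangle (pi g (y - x)) (pi g x - x); rewrite (unitary_hn upi).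
  have := hx' g Qg; move: yx; rewrite -mulrA; lra.
(* By [hy], A moves y2 by at most 3 e |x|. Were y2 longer than claimed, property (T) would give a
   nonzero A-invariant vector in K; it would lie in H1 and so be orthogonal to itself. *)
have y2le : hn y2 <= 3 * e / eA * hn x.
  rewrite mulrAC ler_pdivlMr // leNgt; apply/negP => h.
  have y20 : y2 != 0.
    apply: contraTneq h => ->; rewrite /hn normr0 mul0r -leNgt.
    by apply: mulr_ge0; [apply: mulr_ge0 => //|]; exact: ltW.
  have [|z Kz [z0 zinv]] := property_T_subspace TA' uA KA Ky2 y20.
    move=> a Qa; apply: le_lt_trans (_ : _ <= 3 * e * hn x) _.
      have -> : pi (iA a) y2 - y2 = pi (iA a) y - y.
        by rewrite /y2 (unitary_sub upi) (H1A _ _ H1y1) opprB addrA subrK.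
      by apply: hy; left; left; exists a.
    by rewrite [eA * _]mulrC.
  have H1z : H1 z by move=> g [Ng|[a _ <-]]; [case: Kz => + _; apply|exact: zinv].
  case/eqP: z0; have [_ /(_ z H1z)] := Kz; rewrite hdot_hn => h0.
  by apply/eqP; rewrite -normr_eq0 -sqrf_eq0 hdot_norm hdot_hn h0.
have rE : r * hn x = e * hn x + 3 * e / eA * hn x.
  have re : r = e * (1 + 3 / eA) by rewrite divfK ?gt_eqF.
  by rewrite {1}re; ring.
have y1x : hn (y1 - x) <= r * hn x.
  have -> : y1 - x = (y - x) - y2 by rewrite /y2 opprB [RHS]addrC addrA subrK.
  by apply: le_trans (hn_triangle _ _) _; rewrite hnN rE lerD.
have y1ge : hn x - r * hn x <= hn y1.
  have := hn_triangle y1 (x - y1); rewrite addrC subrK -[hn (x - y1)]hnN opprB; lra.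
have hpos : r * hn x <= 1 / 2 * hn x by rewrite ler_pM2r.
have hB : r * hn x <= eB / 8 * hn x by rewrite ler_pM2r.
have y10 : y1 != 0.
  by apply: contraTneq y1ge => ->; rewrite /hn normr0 -ltNge; move: hnx hpos; rewrite /hn; lra.
have er : e * hn x <= r * hn x.
  by rewrite rE lerDl !mulr_ge0 ?invr_ge0 ?hn_ge0 // ltW.
have [|z H1z [z0 zinv]] := property_T_subspace TB' uB H1B H1y1 y10.
  move=> b Qb; have -> : pi (iB b) y1 - y1 = pi (iB b) (y1 - x) + (pi (iB b) x - x) + (x - y1).
    by rewrite (unitary_sub upi) !addrA !subrK.
  apply: le_lt_trans (hn_triangle _ _) _; rewrite -[hn (x - y1)]hnN opprB.
  have := hn_triangle (pi (iB b) (y1 - x)) (pi (iB b) x - x); rewrite (unitary_hn upi).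
  have := hx' (iB b) (or_introl (or_intror (ex_intro2 _ _ b Qb erefl))).
  have : eB * (1 / 2 * hn x) <= eB * hn y1.
    by rewrite ler_pM2l //; lra.
  have : 0 < eB * hn x by rewrite mulr_gt0.
  have -> : eB * (1 / 2 * hn x) = eB * hn x / 2 by ring.
  have hB' : r * hn x <= eB * hn x / 8 by apply: le_trans hB _; rewrite mulrAC.
  lra.
exists z => // g; have : forall w, H1 w -> (forall b, pi (iB b) w = w) -> pi g w = w.
  move: g; apply: (@np_ind A B [set g | forall w, H1 w -> _ -> pi g w = w]) => /=.
  - by move=> w _ _; exact: pi1.
  - by move=> a g IH w H1w Bw; rewrite piM IH // H1A.
  - by move=> b g IH w H1w Bw; rewrite piM IH.
by apply.
Qed.

Theorem mainTheorem1 (R : realType) (A B : groupType)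
    (countA : countable [set: A]%classic) (countB : countable [set: B]%classic) :
  (amenable R A -> amenable R B -> amenable R (nilpotent_product2 A B)) /\
  (haagerup R A -> haagerup R B -> haagerup R (nilpotent_product2 A B)) /\
  (property_T R A -> property_T R B -> property_T R (nilpotent_product2 A B)) /\
  (exact_group R A -> exact_group R B ->
     exact_group R (nilpotent_product2 A B)).
Proof.
split; first exact: np_amenable.
split; first exact: np_haagerup.
split; first exact: np_property_T.
exact: np_exact.
Qed.
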